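(* Let $p\ge1$ and let $\zeta_1,\dots,\zeta_p\in\partial\mathbb{D}$ be distinct. Let $\mu$ be a non-trivial probability measure on $\partial\mathbb{D}$ (i.e. its support is infinite) with Verblunsky coefficients $(\alpha_n)_{n\ge0}$, and suppose that there are complex numbers $\beta_{n,k}$ ($n\ge0$, $1\le k\le p$) such that $\alpha_n=\sum_{k=1}^p\beta_{n,k}$ for all $n\ge 0$ and, for each $1\le k\le p$, $$\sum_{n=0}^\infty|\zeta_k\beta_{n+1,k}-\beta_{n,k}|<\infty\qquad\text{and}\qquad\sum_{n=0}^\infty|\beta_{n,k}|^2<\infty .$$ (That is, $d\mu\in W_p(\zeta_1,\dots,\zeta_p)$ with each component sequence in $\ell^2$.) Write $d\mu=w(\theta)\frac{d\theta}{2\pi}+d\mu_s$ with $\mu_s$ singular with respect to Lebesgue measure. Then: (1) For every compact subset $K$ of $\partial\mathbb{D}\setminus\{\zeta_1,\dots,\zeta_p\}$, $$\sup_{n\ge 0,\ z\in K}|\Phi_n^*(z)|<\infty .$$ (2) For every $z\in\partial\mathbb{D}\setminus\{\zeta_1,\dots,\zeta_p\}$ the limits $$\Phi_\infty^*(z)=\lim_{n\to\infty}\Phi_n^*(z)=D(0)D(z)^{-1},\qquad \varphi_\infty^*(z)=\lim_{n\to\infty}\varphi_n^*(z)=D(z)^{-1}$$ exist and have the indicated values; both limits are continuous functions of $z$ on $\partial\mathbb{D}\setminus\{\zeta_1,\dots,\zeta_p\}$, and the convergence is uniform on every compact subset $K\subset\partial\mathbb{D}\setminus\{\zeta_1,\dots,\zeta_p\}$.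 Moreover, $\mu_s$ is a pure point measure supported on a subset of $\{\zeta_1,\dots,\zeta_p\}$.
   Context: Notation: $\mathbb{D}=\{z\in\mathbb{C}:|z|<1\}$, $\partial\mathbb{D}=\{z\in\mathbb{C}:|z|=1\}$. For a probability measure $\mu$ on $\partial\mathbb{D}$ with infinite support, put $\langle f,g\rangle=\int_{\partial\mathbb{D}}\overline{f}\,g\,d\mu$ and $\|f\|=\langle f,f\rangle^{1/2}$. $\Phi_n(z)=\Phi_n(z,d\mu)$ is the monic polynomial of degree $n$ orthogonal to $1,z,\dots,z^{n-1}$ in $L^2(\partial\mathbb{D},d\mu)$, and $\varphi_n=\Phi_n/\|\Phi_n\|$. The reversed polynomials are $\Phi_n^*(z)=z^n\overline{\Phi_n(1/\overline{z})}$ and $\varphi_n^*=\Phi_n^*/\|\Phi_n\|$. The Verblunsky coefficients $\alpha_n=\alpha_n(d\mu)\in\mathbb{D}$, $n\ge0$, are the unique numbers such that $\Phi_{n+1}(z)=z\Phi_n(z)-\overline{\alpha_n}\,\Phi_n^*(z)$. Generalized bounded variation: for $\zeta_1,\dots,\zeta_p\in\partial\mathbb{D}$, $W_p(\zeta_1,\dots,\zeta_p)$ is the class of complex sequences $(\alpha_n)_{n\ge0}$ admitting a decomposition $\alpha_n=\sum_{k=1}^p\beta_{n,k}$ with $\beta_{n,k}\in\mathbb{C}$ and $\sum_{n=0}^\infty|\zeta_k\beta_{n+1,k}-\beta_{n,k}|<\infty$ for each $1\le k\le p$. One writes $d\mu\in W_p(\zeta_1,\dots,\zeta_p)$ if the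 Verblunsky coefficients of $\mu$ form a sequence in this class. Szegő function: if $d\mu=w(\theta)\frac{d\theta}{2\pi}+d\mu_s$ and $\sum_{j}|\alpha_j|^2<\infty$, then $\log w$ is integrable (Szegő's theorem) and $$D(z)=\exp\left(\frac1{4\pi}\int_0^{2\pi}\frac{e^{i\theta}+z}{e^{i\theta}-z}\log w(\theta)\,d\theta\right),\qquad z\in\mathbb{D},$$ is analytic on $\mathbb{D}$. For $z\in\partial\mathbb{D}$, $D(z)$ denotes the boundary value $\lim_{r\uparrow1}D(rz)$. *)

(* Defs.v *)
From HB Require Import structures.
From mathcomp Require Import all_boot all_order all_algebra.
From mathcomp Require Import all_classical all_reals all_analysis.
From mathcomp Require Import complex.

Set Implicit Arguments.
Unset Strict Implicit.
Unset Printing Implicit Defensive.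

Import Order.TTheory GRing.Theory Num.Theory.
Import numFieldNormedType.Exports.

Local Open Scope classical_set_scope.
Local Open Scope ring_scope.
Local Open Scope complex_scope.

(* MathComp-Analysis attaches the topology of the norm to the regular module
   R[i]^o only; the instances below make it, and the Borel sigma-algebra,
   available on R[i] itself. *)
#[warnings="-redundant-canonical-projection"]
HB.instance Definition _ (R : realType) := PseudoPointedMetric.copy R[i] R[i]^o.
#[warnings="-redundant-canonical-projection"]
HB.instance Definition _ (R : realType) := NormedModule.copy R[i] R[i]^o.
#[warnings="-redundant-canonical-projection"]
HB.instance Definition _ (R : realType) :=
  Measurable.copy R[i] (g_sigma_algebraType (@open R[i])).

(* The library norm `|z| lives in R[i]; this is the same number in R. *)
Definition cabs (R : realType) (z : R[i]) : R := complex.Re `|z|.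

Lemma cabsE (R : realType) (z : R[i]) : (cabs z)%:C = `|z|.
Proof. by rewrite /cabs normc_def. Qed.

Definition expi (R : realType) (t : R) : R[i] := cos t +i* sin t.

Definition cexp (R : realType) (z : R[i]) : R[i] :=
  (expR (complex.Re z))%:C * expi (complex.Im z).

Definition circle (R : realType) : set R[i] := [set z | `|z| = 1].
Arguments circle R : clear implicits.

Definition Cintegral d (T : measurableType d) (R : realType)
    (mu : {measure set T -> \bar R}) (A : set T) (f : T -> R[i]) : R[i] :=
  (\int[mu]_(x in A) complex.Re (f x)) +i* (\int[mu]_(x in A) complex.Im (f x)).

Definition msupport (R : realType) (mu : {measure set R[i] -> \bar R}) :
    set R[i] :=
  [set z | forall U : set R[i], open U -> U z -> (0 < mu U)%E].

Definition dotmu (R : realType) (mu : {measure set R[i] -> \bar R})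
    (f g : R[i] -> R[i]) : R[i] :=
  Cintegral mu (circle R) (fun z => (f z)^* * g z).

Definition normmu (R : realType) (mu : {measure set R[i] -> \bar R})
    (f : R[i] -> R[i]) : R :=
  Num.sqrt (complex.Re (dotmu mu f f)).

Definition monic_orthogonal (R : realType) (mu : {measure set R[i] -> \bar R})
    (n : nat) (P : {poly R[i]}) : Prop :=
  [/\ P \is monic, size P = n.+1
    & forall k, (k < n)%N ->
        dotmu mu (fun z => z ^+ k) (fun z => P.[z]) = 0].

(* The reversal in degree n, z^n * conj (P (1 / conj z)): see reversed_polyE. *)
Definition reversed_poly (R : realType) (n : nat) (P : {poly R[i]}) :
    {poly R[i]} :=
  \poly_(i < n.+1) (P`_(n - i))^*.

Lemma reversed_polyE (R : realType) (n : nat) (P : {poly R[i]}) (z : R[i]) :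
  (size P <= n.+1)%N -> z != 0 ->
  (reversed_poly n P).[z] = z ^+ n * (P.[1 / z^*])^*.
Proof.
move=> szP z0.
rewrite horner_poly (horner_coef_wide _ szP) rmorph_sum mulr_sumr.
rewrite (reindex_inj rev_ord_inj) /=; apply: eq_bigr => i _.
have lein : (i <= n)%N by rewrite -ltnS.
rewrite subSS subKn// rmorphM rmorphXn/= mulrCA; congr (_ * _).
rewrite rmorphM/= rmorph1 mul1r fmorphV/= conjCK.
by rewrite exprVn -expfB_cond// (negPf z0) add0n.
Qed.

(* phi_n^* = Phi_n^* / ||Phi_n|| *)
Definition reversed_orthonormal (R : realType)
    (mu : {measure set R[i] -> \bar R}) (n : nat) (P : {poly R[i]}) :
    {poly R[i]} :=
  (normmu mu (fun z => P.[z]))^-1%:C *: reversed_poly n P.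

Definition verblunsky (R : realType) (Phi : nat -> {poly R[i]})
    (alpha : nat -> R[i]) : Prop :=
  forall n, Phi n.+1 =
    'X * Phi n - (alpha n)^* *: reversed_poly n (Phi n).

(* The image of dtheta / 2pi on [0, 2pi[ under expi. *)
Definition arc_measure (R : realType) (A : set R[i]) : \bar R :=
  (((2 * pi)^-1)%R%:E *
   lebesgue_measure (`[0%R, (2 * pi)%R[ `&` expi (R:=R) @^-1` A))%E.

Definition singular_measure (R : realType)
    (nu : {measure set R[i] -> \bar R}) : Prop :=
  exists N : set R[i],
    [/\ measurable N, arc_measure N = 0%E & nu (~` N) = 0%E].

(* dmu = w(theta) dtheta / 2pi + dmu_s, with w a function of the angle. *)
Definition lebesgue_decomposition (R : realType)
    (mu : {measure set R[i] -> \bar R}) (w : R -> R)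
    (mus : {measure set R[i] -> \bar R}) : Prop :=
  [/\ measurable_fun `[0%R, (2 * pi)%R[ w,
      forall t, t \in `[0%R, (2 * pi)%R[ -> 0 <= w t,
      forall A : set R[i], measurable A ->
        mu A = (((2 * pi)^-1)%R%:E *
          \int[lebesgue_measure]_(t in `[0%R, (2 * pi)%R[ `&` expi (R:=R) @^-1` A)
            (w t)%:E + mus A)%E
    & singular_measure mus].

Definition pure_point (R : realType)
    (nu : {measure set R[i] -> \bar R}) : Prop :=
  forall A : set R[i], measurable A -> nu A = (\esum_(z in A) nu [set z])%E.

(* ln is 0 on nonpositive reals, which is harmless: w > 0 almost everywhere
   whenever log w is integrable. *)
Definition szego_fun (R : realType) (w : R -> R) (z : R[i]) : R[i] :=
  cexp ((4 * pi)^-1%:C *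
    Cintegral (@lebesgue_measure R) `[0%R, (2 * pi)%R]
      (fun t : R => (expi t + z) / (expi t - z) * (ln (w t))%:C)).

Definition radial_cvg (R : realType) (f : R[i] -> R[i]) (z : R[i]) : Prop :=
  cvg (f (r%:C * z) @[r --> (1%R : R)^'-]).

Definition radial_lim (R : realType) (f : R[i] -> R[i]) (z : R[i]) : R[i] :=
  lim (f (r%:C * z) @[r --> (1%R : R)^'-]).

(* Main.v *)
(* Write S_n for the reversed polynomial of Phi_n and put
     H_n = \sum_k zeta_k beta_(n,k) z Phi_n / (zeta_k - z).
   Summation by parts shows that the increments of S_n - H_n are bounded by
   |S_n| times a summable sequence, uniformly on the closed disc away from the
   zeta_k.  There S_n thus converges uniformly, with upper and lower bounds, to
   a function S continuous up to the circle.
   As alpha_n -> 0, the Fourier coefficients of |phi_n|^2 dmu tend to those of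
   dtheta / 2pi, so that mu = ||Phi_oo||^2 |S|^-2 dtheta / 2pi off the zeta_k;
   this gives w almost everywhere and locates mu_s.
   The weights W_n = ||Phi_n||^2 |S_n|^-2 have mean 1 and log-mean
   ln ||Phi_n||^2.  Fatou's lemma applied to e W_n - 1 - ln (e W_n) and the
   convergence of ||Phi_n|| give ln W_n -> ln w in L^1.  By the Schwarz formula
   D S = ||Phi_oo|| in the open disc, and the continuity of S up to the circle
   gives the radial limits of D. *)

Require Import Defs.
From HB Require Import structures.
From mathcomp Require Import all_boot all_order all_algebra.
From mathcomp Require Import all_classical all_reals all_analysis.
From mathcomp Require Import complex.
From mathcomp Require Import measurable_realfun.
From mathcomp Require Import ring lra.

Set Implicit Arguments.
Unset Strict Implicit.
Unset Printing Implicit Defensive.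

Import Order.TTheory GRing.Theory Num.Theory.
Import numFieldNormedType.Exports.

Local Open Scope classical_set_scope.
Local Open Scope ring_scope.
Local Open Scope complex_scope.

(** The obstacle is that [alpha] is only square summable: the recursion for S_n converges
    conditionally and cannot be bounded term by term. The shape of H_n comes from replacing
    Phi_(n+1) by z Phi_n and zeta_k beta_(n+1,k) by beta_(n,k): to this order its increment is that
    of S_n, and the errors left are summable. Since beta_(n,k) tends to 0, H_n is eventually at most
    half of S_n, so S_n - H_n controls S_n. Nothing is uniform near the zeta_k, and the W_n may lose
    mass there in the limit, so pointwise convergence says nothing about log-means. Two one-sided
    bounds replace domination: Fatou, with e sent to 0 to discard the lost mass, bounds the log-mean
    of the limit weight from below, and the mean of its quotient by W_n is at most 1 because mu
    dominates its own part off the zeta_k. Complex analysis is reduced to polynomials: S_n has no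
    zero in the closed disc, so 1/S_n is a uniform limit there of polynomials and also of
    exponentials of polynomials, and the mean value property and the Schwarz formula are computed on
    powers of z. *)

Local Notation "x ^*" := (Num.conj x) : complex_scope.

(** * Real-valued modulus and complex exponential *)

Section ComplexModulus.
Variable R : realType.
Implicit Types x y z : R[i].

Lemma cReD x y : complex.Re (x + y) = complex.Re x + complex.Re y.
Proof. by case: x; case: y. Qed.

Lemma cImD x y : complex.Im (x + y) = complex.Im x + complex.Im y.
Proof. by case: x; case: y. Qed.

Lemma cReN x : complex.Re (- x) = - complex.Re x.
Proof. by case: x. Qed.

Lemma cImN x : complex.Im (- x) = - complex.Im x.
Proof. by case: x. Qed.

Lemma cReB x y : complex.Re (x - y) = complex.Re x - complex.Re y.
Proof. by rewrite cReD cReN. Qed.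

Lemma cImB x y : complex.Im (x - y) = complex.Im x - complex.Im y.
Proof. by rewrite cImD cImN. Qed.

Lemma cReM x y : complex.Re (x * y) =
  complex.Re x * complex.Re y - complex.Im x * complex.Im y.
Proof. by case: x; case: y. Qed.

Lemma cImM x y : complex.Im (x * y) =
  complex.Re x * complex.Im y + complex.Im x * complex.Re y.
Proof. by case: x; case: y. Qed.

Lemma conjcE x : conjc x = x^*.
Proof. by []. Qed.

Lemma cReJ x : complex.Re x^* = complex.Re x.
Proof. by case: x. Qed.

Lemma cImJ x : complex.Im x^* = - complex.Im x.
Proof. by case: x. Qed.

Lemma cReMr (a : R) x : complex.Re (a%:C * x) = a * complex.Re x.
Proof. by rewrite cReM /= mul0r subr0. Qed.

Lemma cImMr (a : R) x : complex.Im (a%:C * x) = a * complex.Im x.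
Proof. by rewrite cImM /= mul0r addr0. Qed.

Lemma complexP x y :
  complex.Re x = complex.Re y -> complex.Im x = complex.Im y -> x = y.
Proof. by case: x; case: y => a b c d /= -> ->. Qed.

Lemma cabs_sqr z : cabs z ^+ 2 = complex.Re z ^+ 2 + complex.Im z ^+ 2.
Proof.
by apply: complexI; rewrite rmorphXn/= cabsE add_Re2_Im2.
Qed.

Lemma cabs_ge0 z : 0 <= cabs z.
Proof. by rewrite -ler0c cabsE normr_ge0. Qed.

Lemma cabs0 : cabs (0 : R[i]) = 0.
Proof. by apply: complexI; rewrite cabsE normr0. Qed.

Lemma cabs1 : cabs (1 : R[i]) = 1.
Proof. by apply: complexI; rewrite cabsE normr1. Qed.

Lemma cabs_eq0 z : (cabs z == 0) = (z == 0).
Proof. by rewrite -(inj_eq (@complexI _)) cabsE normr_eq0. Qed.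

Lemma cabs_gt0 z : (0 < cabs z) = (z != 0).
Proof. by rewrite lt_neqAle cabs_ge0 andbT eq_sym cabs_eq0. Qed.

Lemma cabsM x y : cabs (x * y) = cabs x * cabs y.
Proof. by apply: complexI; rewrite rmorphM/= !cabsE normrM. Qed.

Lemma cabsX x n : cabs (x ^+ n) = cabs x ^+ n.
Proof. by apply: complexI; rewrite rmorphXn/= !cabsE normrX. Qed.

Lemma cabsV x : cabs x^-1 = (cabs x)^-1.
Proof. by apply: complexI; rewrite fmorphV/= !cabsE normfV. Qed.

Lemma cabs_div x y : cabs (x / y) = cabs x / cabs y.
Proof. by rewrite cabsM cabsV. Qed.

Lemma cabsN x : cabs (- x) = cabs x.
Proof. by apply: complexI; rewrite !cabsE normrN. Qed.

Lemma cabsJ x : cabs x^* = cabs x.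
Proof. by apply: complexI; rewrite !cabsE normcJ. Qed.

Lemma cabsC (a : R) : cabs a%:C = `|a|.
Proof.
apply/eqP; rewrite -(eqrXn2 (n := 2)) ?cabs_ge0//.
by rewrite cabs_sqr /= expr0n addr0 real_normK ?num_real.
Qed.

Lemma ler_cabsD x y : cabs (x + y) <= cabs x + cabs y.
Proof. by rewrite -lecR rmorphD/= !cabsE ler_normD. Qed.

Lemma cabs_distC x y : cabs (x - y) = cabs (y - x).
Proof. by rewrite -opprB cabsN. Qed.

Lemma ler_cabsB x y : cabs (x - y) <= cabs x + cabs y.
Proof. by rewrite (le_trans (ler_cabsD _ _))// cabsN. Qed.

Lemma lerB_cabs x y : cabs x - cabs y <= cabs (x - y).
Proof. by rewrite lerBlDr -{1}(subrK y x) ler_cabsD. Qed.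

Lemma ler_cabs_dist z x y : cabs (x - y) <= cabs (x - z) + cabs (z - y).
Proof. by rewrite -{1}(subrK z x) -addrA ler_cabsD. Qed.

Lemma ler_cabs_sum I (r : seq I) (P : pred I) (F : I -> R[i]) :
  cabs (\sum_(i <- r | P i) F i) <= \sum_(i <- r | P i) cabs (F i).
Proof.
elim/big_rec2: _ => [|i a b _ h]; first by rewrite cabs0.
by rewrite (le_trans (ler_cabsD _ _))// lerD2l.
Qed.

Lemma cabs_Re z : `|complex.Re z| <= cabs z.
Proof. by rewrite -lecR cabsE normc_ge_Re. Qed.

Lemma cabs_Im z : `|complex.Im z| <= cabs z.
Proof.
rewrite -(@ler_pXn2r _ 2)// ?nnegrE ?cabs_ge0// cabs_sqr.
by rewrite real_normK ?num_real// lerDr sqr_ge0.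
Qed.

Lemma cabs_ReIm z : cabs z <= `|complex.Re z| + `|complex.Im z|.
Proof.
rewrite -(@ler_pXn2r _ 2)// ?nnegrE ?cabs_ge0 ?addr_ge0// cabs_sqr.
rewrite sqrrD !real_normK ?num_real// lerD2r lerDl.
by rewrite mulrn_wge0// mulr_ge0.
Qed.

Lemma mulcJ z : z * z^* = (cabs z ^+ 2)%:C.
Proof. by rewrite -sqr_normc rmorphXn/= cabsE. Qed.

Lemma circleP z : circle R z <-> cabs z = 1.
Proof.
rewrite /circle /=; split=> h; last by rewrite -cabsE h.
by apply: complexI; rewrite cabsE h.
Qed.

Lemma circleV z : circle R z -> z^* = z^-1.
Proof.
move=> /circleP z1; have z0 : z != 0 by rewrite -cabs_gt0 z1.
by apply: (mulfI z0); rewrite mulfV// mulcJ z1 expr1n.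
Qed.

Lemma cabs_expi t : cabs (expi t : R[i]) = 1.
Proof.
apply/eqP; rewrite -(eqrXn2 (n := 2)) ?cabs_ge0//.
by rewrite cabs_sqr /expi/= expr1n cos2Dsin2.
Qed.

Lemma circle_expi t : circle R (expi t).
Proof. exact/circleP/cabs_expi. Qed.

Lemma expi0 : expi (0 : R) = 1.
Proof. by rewrite /expi cos0 sin0. Qed.

Lemma expiD s t : expi (s + t) = expi s * expi t :> R[i].
Proof.
rewrite /expi cosD sinD; apply: complexP; first by rewrite cReM.
by rewrite cImM /= addrC.
Qed.

Lemma expiX t n : expi t ^+ n = expi (t *+ n) :> R[i].
Proof.
elim: n => [|n IH]; first by rewrite expr0 mulr0n expi0.
by rewrite exprS IH mulrS expiD.
Qed.

Lemma expi_neq0 t : expi t != 0 :> R[i].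
Proof. by rewrite -cabs_gt0 cabs_expi. Qed.

Lemma expiV t : (expi t)^-1 = (expi t)^* :> R[i].
Proof. by rewrite (circleV (circle_expi t)). Qed.

Lemma cexpD x y : cexp (x + y) = cexp x * cexp y.
Proof.
by rewrite /cexp cReD cImD expRD expiD rmorphM/= mulrACA.
Qed.

Lemma cexp0 : cexp (0 : R[i]) = 1.
Proof. by rewrite /cexp /= expR0 expi0 mul1r. Qed.

Lemma cexpC (a : R) : cexp a%:C = (expR a)%:C.
Proof. by rewrite /cexp /= expi0 mulr1. Qed.

Lemma cabs_cexp z : cabs (cexp z) = expR (complex.Re z).
Proof. by rewrite /cexp cabsM cabs_expi mulr1 cabsC ger0_norm ?expR_ge0. Qed.

Lemma cexp_sum I (r : seq I) (P : pred I) (F : I -> R[i]) :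
  cexp (\sum_(i <- r | P i) F i) = \prod_(i <- r | P i) cexp (F i).
Proof. by elim/big_rec2: _ => [|i a b _ h]; rewrite ?cexp0// cexpD h. Qed.

End ComplexModulus.

(** * Tails of nonnegative series *)

Section SummableTails.
Variable R : realType.
Implicit Types (s t : nat -> R).

(** A one-sided Cauchy criterion. For the nonnegative series at hand it amounts to convergence, and
    it passes to finite sums and multiples with no limit being named. *)
Definition small_tails t := forall e : R, 0 < e ->
  exists N, forall m n, (N <= m)%N -> \sum_(m <= j < n) t j <= e.

Lemma cvg_small_tails t : cvgn (series t) -> small_tails t.
Proof.
move=> /cvg_cauchy /cauchy_seriesP ct e e0.
have [[A B] [[N1 _ h1] [N2 _ h2]] hAB] := ct _ e0.
exists (maxn N1 N2) => m n; rewrite geq_max => /andP[m1 m2].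
have [nm|mn] := leqP n m; first by rewrite big_geq// ltW.
have := hAB (m, n) (conj (h1 _ m1) (h2 _ (leq_trans m2 (ltnW mn)))).
by move=> /= /ltW; apply: le_trans; exact: ler_norm.
Qed.

Lemma small_tailsD s t :
  small_tails s -> small_tails t -> small_tails (fun n => s n + t n).
Proof.
move=> hs ht e e0; have e2 : 0 < e / 2 by rewrite divr_gt0.
have [N1 h1] := hs _ e2; have [N2 h2] := ht _ e2.
exists (maxn N1 N2) => m n; rewrite geq_max => /andP[m1 m2].
by rewrite big_split/= [leRHS]splitr lerD// ?h1 ?h2.
Qed.

Lemma small_tailsM s (c : R) :
  0 <= c -> small_tails s -> small_tails (fun n => c * s n).
Proof.
move=> c0 hs e e0.
(* Dividing by [c + 1] instead of [c] covers [c = 0]. *)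
have c1 : 0 < c + 1 by rewrite ltr_wpDl.
have [N h] := hs (e / (c + 1)) (divr_gt0 e0 c1).
exists N => m n /(h m n) => {}h; rewrite -mulr_sumr.
apply: (le_trans (ler_wpM2l c0 h)).
rewrite mulrCA ger_pMr// ler_pdivrMr// mul1r lerDl//.
Qed.

Lemma small_tails_sum (I : finType) (s : I -> nat -> R) :
  (forall i, small_tails (s i)) -> small_tails (fun n => \sum_i s i n).
Proof.
move=> hs; suff h : forall r : seq I, small_tails (fun n => \sum_(i <- r) s i n).
  exact: h.
elim=> [|i r IH] e e0.
  exists 0%N => m n _; under eq_bigr do rewrite big_nil.
  by rewrite big1// ltW.
have [N h] := small_tailsD (hs i) IH e0.
exists N => m n /(h m n); apply: le_trans.
by under eq_bigr do rewrite big_cons.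
Qed.

Lemma small_tails_term t : (forall n, 0 <= t n) -> small_tails t ->
  forall e, 0 < e -> exists N, forall n, (N <= n)%N -> t n <= e.
Proof.
move=> t0 ht e e0; have [N h] := ht _ e0.
by exists N => n Nn; have := h n n.+1 Nn; rewrite big_nat1.
Qed.

(** A discrete Gronwall bootstrap: while the drift from [Q N] is at most [2 |Q N|] times a sum below
    1/4, [|Q n|] stays below [2 |Q N|], and this bounds the next increment by [2 |Q N| t n]. *)
Lemma small_drift (Q : nat -> R[i]) t N :
  (forall n, 0 <= t n) ->
  (forall n, (N <= n)%N -> cabs (Q n.+1 - Q n) <= cabs (Q n) * t n) ->
  (forall n, \sum_(N <= j < n) t j <= 4^-1) ->
  forall m n, (N <= m <= n)%N ->
    cabs (Q n - Q m) <= 2 * cabs (Q N) * \sum_(m <= j < n) t j.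
Proof.
move=> t0 dQ st.
have bnd n : (N <= n)%N ->
    cabs (Q n - Q N) <= 2 * cabs (Q N) * \sum_(N <= j < n) t j ->
    cabs (Q n) <= 2 * cabs (Q N).
  move=> Nn h; have := lerB_cabs (Q n) (Q N); have := st n.
  have := cabs_ge0 (Q N); nra.
have step m n : (m <= n)%N -> (N <= n)%N -> cabs (Q n) <= 2 * cabs (Q N) ->
    cabs (Q n - Q m) <= 2 * cabs (Q N) * \sum_(m <= j < n) t j ->
    cabs (Q n.+1 - Q m) <= 2 * cabs (Q N) * \sum_(m <= j < n.+1) t j.
  move=> mn Nn hb h; rewrite big_nat_recr//= mulrDr.
  apply: (le_trans (ler_cabs_dist (Q n) _ _)); rewrite addrC lerD//.
  by apply: (le_trans (dQ n Nn)); rewrite ler_wpM2r.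
have all n : (N <= n)%N -> cabs (Q n) <= 2 * cabs (Q N).
  move=> Nn; apply: (bnd) => //; rewrite -(subnK Nn).
  elim: (n - N)%N => [|k IH].
    by rewrite add0n subrr cabs0 big_geq// mulr0.
  by rewrite addSn; apply: (step); rewrite ?leq_addl// bnd// leq_addl.
move=> m n /andP[Nm mn]; rewrite -(subnK mn).
elim: (n - m)%N => [|k IH]; first by rewrite add0n subrr cabs0 big_geq// mulr0.
by rewrite addSn; apply: (step); rewrite ?leq_addl ?all// (leq_trans Nm) ?leq_addl.
Qed.

End SummableTails.

(** * The Szego recursion under generalized bounded variation *)

Section SzegoRecursion.
Variables (R : realType) (alpha : nat -> R[i]) (F S : nat -> R[i] -> R[i]).
Hypotheses (F0 : forall z, F 0 z = 1) (S0 : forall z, S 0 z = 1)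
  (FS : forall n z, F n.+1 z = z * F n z - (alpha n)^* * S n z)
  (SS : forall n z, S n.+1 z = S n z - alpha n * (z * F n z))
  (alpha1 : forall n, cabs (alpha n) < 1).

(** With [f = z F], one step of the Szego recursion preserves the indefinite form [|s|^2 - |f|^2] up
    to the factor [1 - |a|^2]. *)
Lemma mobius_cabs (a s f : R[i]) :
  cabs (s - a * f) ^+ 2 - cabs (f - a^* * s) ^+ 2 =
  (1 - cabs a ^+ 2) * (cabs s ^+ 2 - cabs f ^+ 2).
Proof.
rewrite !cabs_sqr !(cReB, cImB, cReM, cImM, cReJ, cImJ).
ring.
Qed.

(** By [mobius_cabs] the sign of [|S|^2 - |z F|^2] is inherited by the next pair, and multiplying
    [F] by [z] in the closed disc only helps. *)
Lemma star_dominates n z : cabs z <= 1 -> cabs (F n z) <= cabs (S n z).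
Proof.
move=> z1; rewrite -(@ler_pXn2r _ 2)// ?nnegrE ?cabs_ge0// -subr_ge0.
elim: n => [|n IH]; first by rewrite F0 S0 subrr.
rewrite FS SS mobius_cabs mulr_ge0//.
  by rewrite subr_ge0 expr_le1// ?cabs_ge0// ltW.
rewrite subr_ge0 in IH; rewrite subr_ge0; apply: le_trans IH.
rewrite ler_pXn2r ?nnegrE ?cabs_ge0// cabsM.
by rewrite ler_piMl ?cabs_ge0.
Qed.

Lemma star_lower n z : cabs z <= 1 ->
  cabs (S n z) * (1 - cabs (alpha n)) <= cabs (S n.+1 z).
Proof.
move=> z1; rewrite SS mulrBr mulr1; apply: le_trans (lerB_cabs _ _).
rewrite lerB// !cabsM mulrC.
apply: ler_pM; rewrite ?cabs_ge0 ?mulr_ge0 ?cabs_ge0//.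
apply: le_trans (star_dominates n z1); rewrite ler_piMl ?cabs_ge0//.
Qed.

Lemma star_upper n z : cabs z <= 1 -> cabs (S n.+1 z) <= 2 * cabs (S n z).
Proof.
move=> z1; rewrite SS; apply: le_trans (ler_cabsB _ _) _.
rewrite mulr_natl mulr2n lerD2l !cabsM.
apply: le_trans (star_dominates n z1).
rewrite mulrA ler_piMl ?cabs_ge0// mulr_ile1 ?cabs_ge0// ltW//.
Qed.

Lemma star_neq0 n z : cabs z <= 1 -> S n z != 0.
Proof.
move=> z1; rewrite -cabs_gt0; elim: n => [|n IH].
  by rewrite S0 cabs1.
by apply: lt_le_trans (star_lower n z1); rewrite mulr_gt0// subr_gt0.
Qed.

Lemma star_le_exp n z : cabs z <= 1 -> cabs (S n z) <= 2 ^+ n.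
Proof.
move=> z1; elim: n => [|n IH]; first by rewrite S0 cabs1.
by rewrite exprS (le_trans (star_upper n z1))// ler_wpM2l.
Qed.

Lemma star_ge_prod n z : cabs z <= 1 ->
  \prod_(j < n) (1 - cabs (alpha j)) <= cabs (S n z).
Proof.
move=> z1; elim: n => [|n IH]; first by rewrite big_ord0 S0 cabs1.
rewrite big_ord_recr/= (le_trans _ (star_lower n z1))//.
by rewrite ler_wpM2r// subr_ge0 ltW.
Qed.

Variables (p : nat) (zeta : 'I_p -> R[i]) (beta : nat -> 'I_p -> R[i]).
Hypotheses (zeta1 : forall k, cabs (zeta k) = 1)
  (alphaE : forall n, alpha n = \sum_(k < p) beta n k)
  (eps_sum : forall k,
    cvgn (series (fun n => cabs (zeta k * beta n.+1 k - beta n k))))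
  (beta_sum : forall k, cvgn (series (fun n => cabs (beta n k) ^+ 2))).

(** One set serves both the interior and the circle: uniform estimates on it make the limit
    continuous up to the circle, as the radial limits require. *)
Definition punctured_disc (d : R) : set R[i] :=
  [set z | cabs z <= 1 /\ forall k, d <= cabs (z - zeta k)].

Let eps n k := zeta k * beta n.+1 k - beta n k.
Let b n := \sum_(k < p) cabs (beta n k).
(** The two parts match the two terms of [Q_step]: [2 |eps|] because [|z F n.+1|] is at most
    [2 |S n|], and the squares because they dominate [|beta n k| |alpha n|]. *)
Let t n := \sum_(k < p) (2 * cabs (eps n k) +
  \sum_(j < p) (cabs (beta n k) ^+ 2 + cabs (beta n j) ^+ 2)).
Let H n z := \sum_(k < p) zeta k * beta n k * (z * F n z) / (zeta k - z).
(* Summation by parts: subtracting [H] from [S] turns the conditionally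
   convergent product into one with absolutely summable increments. *)
Let Q n z := S n z - H n z.

Lemma t_ge0 n : 0 <= t n.
Proof.
apply: sumr_ge0 => k _; rewrite addr_ge0 ?mulr_ge0 ?cabs_ge0//.
by apply: sumr_ge0 => j _; rewrite addr_ge0 ?sqr_ge0.
Qed.

Lemma b_ge0 n : 0 <= b n.
Proof. by apply: sumr_ge0 => k _; rewrite cabs_ge0. Qed.

Lemma t_small : small_tails t.
Proof.
apply: small_tails_sum => k; apply: small_tailsD.
  by apply: small_tailsM => //; apply: cvg_small_tails; exact: eps_sum.
apply: small_tails_sum => j.
by apply: small_tailsD; apply: cvg_small_tails; exact: beta_sum.
Qed.

Lemma b_small e : 0 < e -> exists N, forall n, (N <= n)%N -> b n <= e.
Proof.
move=> e0; have p1 : 0 < p.+1%:R :> R by rewrite ltr0n.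
(* Each of the [p] moduli will be at most [e / (p + 1)]; the successor avoids a division by zero. *)
have e1 : 0 < (e / p.+1%:R) ^+ 2 by rewrite exprn_gt0// divr_gt0.
have st : small_tails (fun n => \sum_(k < p) cabs (beta n k) ^+ 2).
  by apply: small_tails_sum => k; apply: cvg_small_tails; exact: beta_sum.
have [n|N h] := small_tails_term _ st e1.
  by apply: sumr_ge0 => k _; exact: sqr_ge0.
exists N => n /h {}h.
have bk k : cabs (beta n k) <= e / p.+1%:R.
  rewrite -(@ler_pXn2r _ 2)// ?nnegrE ?cabs_ge0 ?divr_ge0 ?(ltW e0)//.
  apply: le_trans h; rewrite (bigD1 k)//= lerDl.
  by apply: sumr_ge0 => j _; exact: sqr_ge0.
apply: (@le_trans _ _ (\sum_(k < p) e / p.+1%:R)); first exact: ler_sum.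
rewrite sumr_const card_ord -[_ *+ p]mulr_natr -mulrA ger_pMr// mulrC.
by rewrite ler_pdivrMr// mul1r ler_nat.
Qed.

(** If [F n.+1] were [z F n] and [zeta k * beta n.+1 k] were [beta n k], the increment of [H] would
    be the sum of [beta n k * z F n * (z - zeta k) / (zeta k - z)], that is [- alpha n * z F n], the
    increment of [S]. What remains are the two defects. *)
Lemma Q_step n z : (forall k, z != zeta k) ->
  Q n.+1 z - Q n z = - \sum_(k < p)
   (eps n k * (z * F n.+1 z) - beta n k * (z * (alpha n)^* * S n z)) /
     (zeta k - z).
Proof.
move=> zk.
have E1 : Q n.+1 z - Q n z = - (alpha n * (z * F n z)) - (H n.+1 z - H n z).
  by rewrite /Q SS; ring.
rewrite E1 /H {1}alphaE mulr_suml -!sumrB -!sumrN -big_split/=.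
apply: eq_bigr => k _; rewrite /eps FS.
have : zeta k - z != 0 by rewrite subr_eq0 eq_sym.
by move: (zeta k) => c c0; field.
Qed.

Lemma H_bound d n z : 0 < d -> punctured_disc d z ->
  cabs (H n z) <= cabs (S n z) * (b n / d).
Proof.
move=> d0 [z1 zd]; rewrite /H; apply: le_trans (ler_cabs_sum _ _ _) _.
rewrite /b mulr_suml mulr_sumr; apply: ler_sum => k _.
rewrite !cabsM zeta1 mul1r cabsV -mulrA [leRHS]mulrCA.
rewrite ler_wpM2l ?cabs_ge0//; apply: ler_pM.
- by rewrite mulr_ge0 ?cabs_ge0.
- by rewrite invr_ge0 cabs_ge0.
- apply: le_trans (star_dominates n z1).
  by rewrite ler_piMl ?cabs_ge0.
- by rewrite lef_pV2 ?posrE// cabs_distC ?zd// (lt_le_trans d0 (zd k)).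
Qed.

Lemma Q_bound d n z : 0 < d -> punctured_disc d z ->
  cabs (Q n.+1 z - Q n z) <= cabs (S n z) * (t n / d).
Proof.
move=> d0 [z1 zd]; rewrite Q_step; last first.
  by move=> k; rewrite -subr_eq0 -cabs_gt0 (lt_le_trans d0).
rewrite cabsN; apply: le_trans (ler_cabs_sum _ _ _) _.
rewrite /t mulr_suml mulr_sumr; apply: ler_sum => k _.
rewrite cabsM cabsV [leRHS]mulrA; apply: ler_pM; rewrite ?cabs_ge0//.
- by rewrite invr_ge0 cabs_ge0.
- have hF : cabs (z * F n.+1 z) <= 2 * cabs (S n z).
    rewrite cabsM; apply: le_trans (star_upper n z1).
    apply: le_trans (star_dominates n.+1 z1).
    by rewrite ler_piMl ?cabs_ge0.
  have ha : cabs (beta n k) * cabs (alpha n) <=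
      \sum_(j < p) (cabs (beta n k) ^+ 2 + cabs (beta n j) ^+ 2).
    rewrite alphaE.
    apply: (le_trans (ler_wpM2l (cabs_ge0 _) (ler_cabs_sum _ _ _))).
    rewrite mulr_sumr; apply: ler_sum => j _.
    have := cabs_ge0 (beta n k); have := cabs_ge0 (beta n j).
    by move: (cabs _) (cabs _) => u v *; nra.
  apply: le_trans (ler_cabsB _ _) _; rewrite mulrDr lerD//.
    rewrite cabsM mulrC mulrA [_ * 2]mulrC.
    by rewrite ler_wpM2r ?cabs_ge0.
  have -> : cabs (beta n k * (z * (alpha n)^* * S n z)) =
      cabs z * (cabs (S n z) * (cabs (beta n k) * cabs (alpha n))).
    by rewrite !cabsM cabsJ; ring.
  apply: (@le_trans _ _ (cabs (S n z) * (cabs (beta n k) * cabs (alpha n)))).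
    by rewrite ler_piMl// !mulr_ge0 ?cabs_ge0.
  by rewrite ler_wpM2l ?cabs_ge0.
- by rewrite lef_pV2 ?posrE// cabs_distC ?zd// (lt_le_trans d0 (zd k)).
Qed.

(** Once [b n <= d / 2], [H] is at most half of [S], so [S] and [Q] agree up to a factor 2. The
    factor 2 before [t j / d] pays for replacing [S] by [Q] in [Q_bound], which puts [Q] within
    reach of [small_drift]. *)
Lemma star_regime d : 0 < d -> exists N,
  (forall n, \sum_(N <= j < n) (2 * (t j / d)) <= 4^-1) /\
  forall n z, (N <= n)%N -> punctured_disc d z ->
    cabs (S n z) <= 2 * cabs (Q n z) /\ cabs (Q n z) <= 2 * cabs (S n z).
Proof.
move=> d0; have d2 : 0 < d / 2 by rewrite divr_gt0.
have [N1 h1] := b_small d2.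
have st : small_tails (fun j => 2 * (t j / d)).
  apply: small_tailsM => //.
  under eq_fun do rewrite mulrC.
  apply: small_tailsM; first by rewrite invr_ge0 ltW.
  exact: t_small.
have [|N2 h2] := st 4^-1; first by rewrite invr_gt0.
exists (maxn N1 N2); split=> [n|n z].
  by apply: h2; rewrite leq_maxr.
rewrite geq_max => /andP[n1 n2] zd.
have hH := H_bound n d0 zd.
have hb : b n / d <= 2^-1.
  by rewrite ler_pdivrMr// mulrC; exact: h1.
have hS := cabs_ge0 (S n z).
have hH2 : cabs (H n z) <= cabs (S n z) * 2^-1.
  by apply: le_trans hH _; rewrite ler_wpM2l.
have u1 := lerB_cabs (S n z) (H n z).
have u2 := ler_cabsB (S n z) (H n z).
by rewrite -/(Q n z) in u1 u2; lra.
Qed.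

Lemma star_bounds d : 0 < d -> exists m M, [/\ 0 < m, 0 < M
  & forall n z, punctured_disc d z -> m <= cabs (S n z) <= M].
Proof.
move=> d0; have [N [h1 h2]] := star_regime d0.
have c1 j : 0 < 1 - cabs (alpha j) by rewrite subr_gt0.
set c := \prod_(j < N) (1 - cabs (alpha j)).
have c0 : 0 < c by rewrite /c; apply: prodr_gt0 => j _.
have e0 : 0 < 2 ^+ N :> R by rewrite exprn_gt0.
(* Beyond [N] the chain from [S n] to [Q n] to [Q N] to [S N] loses at most a factor 2 at each link,
   hence 8. Up to [N], the crude bounds [c] and [2 ^+ N] suffice. *)
exists (c / 8), (8 * 2 ^+ N); split; rewrite ?divr_gt0 ?mulr_gt0//.
move=> n z zd; have z1 := zd.1.
have [nN|Nn] := leqP n N.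
  apply/andP; split.
    have : c <= \prod_(j < n) (1 - cabs (alpha j)).
      rewrite /c -(big_mkord xpredT (fun j => 1 - cabs (alpha j))).
      rewrite (big_cat_nat (n := n))//= big_mkord ler_piMr//.
        by apply: prodr_ge0 => j _; exact/ltW.
      by apply: prodr_ile1 => j _; rewrite ltW//= gerBl cabs_ge0.
    by have := star_ge_prod n z1; lra.
  have : 2 ^+ n <= 2 ^+ N :> R by rewrite ler_weXn2l// ler1n.
  by have := star_le_exp n z1; lra.
have [N1 N2] := h2 N z (leqnn _) zd.
have [n1 n2] := h2 n z (ltnW Nn) zd.
have hQ : cabs (Q n z - Q N z) <=
    2 * cabs (Q N z) * \sum_(N <= j < n) (2 * (t j / d)).
  apply: (@small_drift _ (Q^~ z)) => [j|j Nj|//|].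
  - by rewrite mulr_ge0// divr_ge0 ?t_ge0// ltW.
  - apply: le_trans (Q_bound _ d0 zd) _; rewrite [leRHS]mulrA.
    have [? _] := h2 j z Nj zd.
    by rewrite ler_wpM2r ?divr_ge0 ?t_ge0 ?(ltW d0)// mulrC.
  - by rewrite leqnn ltnW.
have hh : cabs (Q n z - Q N z) <= cabs (Q N z) / 2.
  apply: (le_trans hQ); have := h1 n; have := cabs_ge0 (Q N z).
  move: (cabs _) (\sum_(_ <= _ < _) _) => u v *; nra.
have u1 := lerB_cabs (Q n z) (Q N z).
have u2 := lerB_cabs (Q N z) (Q n z); rewrite cabs_distC in u2.
have := star_ge_prod N z1; have := star_le_exp N z1; rewrite -/c.
by move=> *; apply/andP; split; lra.
Qed.

Lemma star_cauchy d : 0 < d -> forall e, 0 < e -> exists N,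
  forall m n z, (N <= m)%N -> (N <= n)%N -> punctured_disc d z ->
  cabs (S n z - S m z) <= e.
Proof.
move=> d0 e e0; have [N0 [h1 h2]] := star_regime d0.
have [c [M [_ M0 hM]]] := star_bounds d0.
have st : small_tails (fun j => 2 * (t j / d)).
  apply: small_tailsM => //.
  under eq_fun do rewrite mulrC.
  apply: small_tailsM; first by rewrite invr_ge0 ltW.
  exact: t_small.
(* As [2 |Q N0| <= 4 M], this tail lets [Q] move by at most [e / 2]; the next choice makes each of
   the two [H] terms at most [e / 4]. *)
have [|N1 k1] := st (e / (16 * M)); first by rewrite divr_gt0// mulr_gt0.
have [|N2 k2] := @b_small (e * d / (4 * M)).
  by rewrite divr_gt0 ?mulr_gt0.
exists (maxn N0 (maxn N1 N2)).
suff h m n z : (maxn N0 (maxn N1 N2) <= m)%N -> (m <= n)%N ->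
    punctured_disc d z -> cabs (S n z - S m z) <= e.
  move=> m n z Nm Nn zd; have [mn|/ltnW nm] := leqP m n; first exact: h.
  by rewrite cabs_distC; exact: h.
rewrite !geq_max => /and3P[m0 m1 m2] mn zd.
have hH j : (N2 <= j)%N -> cabs (H j z) <= e / 4.
  move=> /k2 bj; apply: le_trans (H_bound j d0 zd) _.
  have /andP[_ Sj] := hM j z zd.
  apply: (@le_trans _ _ (M * (b j / d))).
    by rewrite ler_wpM2r// divr_ge0 ?b_ge0// ltW.
  apply: (@le_trans _ _ (M * (e * d / (4 * M) / d))).
    by rewrite ler_pM2l// ler_pM2r ?invr_gt0.
  by rewrite le_eqVlt; apply/orP; left; apply/eqP; field; rewrite !gt_eqF.
have -> : S n z - S m z = (Q n z - Q m z) + (H n z - H m z).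
  by rewrite /Q; ring.
apply: le_trans (ler_cabsD _ _) _.
have := ler_cabsB (H n z) (H m z).
have := hH n (leq_trans m2 mn); have := hH m m2.
suff : cabs (Q n z - Q m z) <= e / 2 by lra.
have hQ : cabs (Q n z - Q m z) <=
    2 * cabs (Q N0 z) * \sum_(m <= j < n) (2 * (t j / d)).
  apply: (@small_drift _ (Q^~ z)) => [j|j Nj|//|].
  - by rewrite mulr_ge0// divr_ge0 ?t_ge0// ltW.
  - apply: le_trans (Q_bound _ d0 zd) _; rewrite [leRHS]mulrA.
    have [? _] := h2 j z Nj zd.
    by rewrite ler_wpM2r ?divr_ge0 ?t_ge0 ?(ltW d0)// mulrC.
  - by rewrite m0.
apply: (le_trans hQ).
have [_ QN] := h2 N0 z (leqnn _) zd; have /andP[_ SN] := hM N0 z zd.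
apply: (@le_trans _ _ (4 * M * (2 * (e / (16 * M))))).
  apply: ler_pM; rewrite ?mulr_ge0 ?cabs_ge0//.
  - by apply: sumr_ge0 => j _; rewrite mulr_ge0// divr_ge0 ?t_ge0// ltW.
  - by lra.
  - have := k1 m n m1; have : 0 < e / (16 * M) by rewrite divr_gt0// mulr_gt0.
    by lra.
by rewrite le_eqVlt; apply/orP; left; apply/eqP; field; rewrite !gt_eqF.
Qed.

End SzegoRecursion.

(** * Topology and Borel sets of the complex plane *)

Section ComplexTopology.
Variable R : realType.

(** The balls of [R[i]] have radii in [R[i]]; the order there makes positive radii real, so that
    neighbourhoods can be described with real ones. *)
Lemma posC_cabs (e : R[i]) : 0 < e -> exists2 r : R, 0 < r & e = r%:C.
Proof.
move=> e0; exists (complex.Re e).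
  by move: e0; rewrite ltcE => /andP[].
by move: e0; rewrite ltcE /= => /andP[/eqP h _]; apply: complexP.
Qed.

Lemma nbhs_cabsP (z : R[i]) (A : set R[i]) :
  nbhs z A <-> exists2 e : R, 0 < e & forall w, cabs (w - z) < e -> A w.
Proof.
split=> [/nbhs_ballP[e /= e0 h]|[e e0 h]].
  have [r r0 er] := posC_cabs e0; exists r => // w wz; apply: h.
  by rewrite /ball/= er -cabsE ltcR cabs_distC.
apply/nbhs_ballP; exists e%:C => /=; first by rewrite ltcR.
move=> w; rewrite /ball/= -cabsE ltcR => wz.
by apply: h; rewrite cabs_distC.
Qed.

Lemma open_cabsP (A : set R[i]) :
  open A <-> forall z, A z -> exists2 e : R, 0 < e & forall w, cabs (w - z) < e -> A w.
Proof.
rewrite openE; split=> h z Az; first exact/nbhs_cabsP/h.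
exact/nbhs_cabsP/h.
Qed.

Lemma cvg_cabsP (T : Type) (F : set_system T) {FF : Filter F}
    (f : T -> R[i]) (l : R[i]) :
  f @ F --> l <->
  forall e : R, 0 < e -> \forall x \near F, cabs (f x - l) < e.
Proof.
split=> [h e e0|h A].
  have := h [set w | cabs (w - l) < e]; rewrite nbhs_filterE; apply.
  by apply/nbhs_cabsP; exists e.
move=> /nbhs_cabsP[e e0 eA]; have := h e e0.
by apply: filterS => x; exact: eA.
Qed.

Lemma continuous_cabs_dist (f : R[i] -> R) :
  (forall z w, `|f z - f w| <= cabs (z - w)) -> continuous f.
Proof.
move=> h z; apply/(@cvgrPdist_lt _ _ _ (nbhs z) (nbhs_filter z)) => e e0.
apply/(@nbhs_cabsP z).
by exists e => // w wz; apply: le_lt_trans (h _ _) _; rewrite cabs_distC.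
Qed.

Lemma continuous_cRe : continuous (@complex.Re R).
Proof.
by apply: continuous_cabs_dist => z w; rewrite -cReB cabs_Re.
Qed.

Lemma continuous_cIm : continuous (@complex.Im R).
Proof.
by apply: continuous_cabs_dist => z w; rewrite -cImB cabs_Im.
Qed.

Lemma continuous_cabs : continuous (@cabs R).
Proof.
apply: continuous_cabs_dist => z w; rewrite ler_norml lerB_cabs andbT.
by rewrite lerNl opprB cabs_distC lerB_cabs.
Qed.

Lemma cvg_complex (T : Type) (F : set_system T) {FF : Filter F}
    (f : T -> R[i]) (l : R[i]) :
  complex.Re (f x) @[x --> F] --> complex.Re l ->
  complex.Im (f x) @[x --> F] --> complex.Im l ->
  f @ F --> l.
Proof.
move=> /cvgrPdist_lt hR /cvgrPdist_lt hI; apply/cvg_cabsP => e e0.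
have e2 : 0 < e / 2 by rewrite divr_gt0.
near=> x; apply: le_lt_trans (cabs_ReIm _) _; rewrite cReB cImB (splitr e).
rewrite ltrD//; rewrite distrC; near: x; [exact: hR|exact: hI].
Unshelve. all: by end_near. Qed.

Lemma continuous_expi : continuous (@expi R).
Proof.
by move=> t; apply: cvg_complex => /=; [exact: continuous_cos|exact: continuous_sin].
Qed.

Lemma measurable_continuous_complex (f : R[i] -> R) :
  continuous f -> measurable_fun setT f.
Proof.
move=> cf; apply: (@measurability _ _ (R[i]) (measurableTypeR R) _ _ _ (RGenOpens.measurableE R)) => _ [_ [a [b ->] <-]].
rewrite setTI; apply: sub_sigma_algebra => /=.
by apply: open_comp => [z _|]; [exact: cf|exact: interval_open].
Qed.

Lemma open_measurable_complex (A : set R[i]) : open A -> measurable A.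
Proof. by move=> oA; apply: sub_sigma_algebra. Qed.

Lemma closed_measurable_complex (A : set R[i]) : closed A -> measurable A.
Proof.
by rewrite -openC => oA; rewrite -[A]setCK; apply: measurableC; exact: open_measurable_complex.
Qed.

Lemma closed_set1_complex (z : R[i]) : closed [set z].
Proof.
rewrite -openC; apply/open_cabsP => w /= /eqP wz.
exists (cabs (w - z)); first by rewrite cabs_gt0 subr_eq0.
by move=> u h /= uz; move: h; rewrite uz cabs_distC ltxx.
Qed.

Lemma measurable_set1_complex (z : R[i]) : measurable [set z].
Proof. by apply: closed_measurable_complex; exact: closed_set1_complex. Qed.

Lemma closed_circle : closed (circle R).
Proof.
rewrite -openC; apply/open_cabsP => w /= wz.
have w1 : cabs w != 1 by apply/eqP => h; apply: wz; apply/circleP.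
exists `|cabs w - 1|; first by rewrite normr_gt0 subr_eq0.
move=> u h /circleP u1; move: h; rewrite ltNge => /negP; apply.
rewrite -u1 ler_norml; have := lerB_cabs u w; have := lerB_cabs w u.
by rewrite [cabs (w - u)]cabs_distC; lra.
Qed.

Lemma measurable_circle : measurable (circle R).
Proof. by apply: closed_measurable_complex; exact: closed_circle. Qed.

Lemma measurable_expi : measurable_fun setT (@expi R).
Proof.
apply: (@measurability _ _ _ _ _ _ (@open R[i])) => // _ [A oA <-].
rewrite setTI; apply: open_measurable.
by apply: open_comp => // t _; exact: continuous_expi.
Qed.

End ComplexTopology.

(** * Complex-valued integration by real and imaginary parts *)

Section ComplexIntegral.
Context d (T : measurableType d) (R : realType).
Variables (mu : {measure set T -> \bar R}) (A : set T).
Hypothesis mA : measurable A.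
Implicit Types f g : T -> R[i].

Definition Cintegrable f :=
  mu.-integrable A (EFin \o (fun x => complex.Re (f x))) /\
  mu.-integrable A (EFin \o (fun x => complex.Im (f x))).

Definition Cmeasurable f :=
  measurable_fun A (fun x => complex.Re (f x)) /\
  measurable_fun A (fun x => complex.Im (f x)).

Lemma eq_Cintegral f g : {in A, f =1 g} ->
  Cintegral mu A f = Cintegral mu A g.
Proof.
by move=> fg; rewrite /Cintegral; congr (_ +i* _); apply: eq_Rintegral => x xA; rewrite fg.
Qed.

Lemma CintegrableD f g : Cintegrable f -> Cintegrable g ->
  Cintegrable (fun x => f x + g x).
Proof.
move=> [f1 f2] [g1 g2]; split.
  have := integrableD mA f1 g1; apply: eq_integrable => // x _ /=.
  by rewrite cReD EFinD.
have := integrableD mA f2 g2; apply: eq_integrable => // x _ /=.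
by rewrite cImD EFinD.
Qed.

Lemma CintegralD f g : Cintegrable f -> Cintegrable g ->
  Cintegral mu A (fun x => f x + g x) = Cintegral mu A f + Cintegral mu A g.
Proof.
move=> [f1 f2] [g1 g2]; apply: complexP => /=; rewrite -RintegralD//;
  by apply: eq_Rintegral => x _; rewrite ?cReD ?cImD.
Qed.

Lemma integrableZlR (k : R) (h : T -> R) : mu.-integrable A (EFin \o h) ->
  mu.-integrable A (EFin \o (fun x => k * h x)).
Proof. by move=> hh; exact: (integrableZl mA k hh). Qed.

Lemma integrableDR (h k : T -> R) : mu.-integrable A (EFin \o h) ->
  mu.-integrable A (EFin \o k) -> mu.-integrable A (EFin \o (fun x => h x + k x)).
Proof. by move=> hh kk; exact: (integrableD mA hh kk). Qed.

Lemma integrableBR (h k : T -> R) : mu.-integrable A (EFin \o h) ->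
  mu.-integrable A (EFin \o k) -> mu.-integrable A (EFin \o (fun x => h x - k x)).
Proof. by move=> hh kk; exact: (integrableB mA hh kk). Qed.

Lemma CintegrableZ (c : R[i]) f : Cintegrable f -> Cintegrable (fun x => c * f x).
Proof.
move=> [f1 f2]; split.
  have := integrableBR (integrableZlR (complex.Re c) f1) (integrableZlR (complex.Im c) f2).
  by apply: eq_integrable => // x _ /=; rewrite cReM.
have := integrableDR (integrableZlR (complex.Re c) f2) (integrableZlR (complex.Im c) f1).
by apply: eq_integrable => // x _ /=; rewrite cImM.
Qed.

Lemma CintegralZ (c : R[i]) f : Cintegrable f ->
  Cintegral mu A (fun x => c * f x) = c * Cintegral mu A f.
Proof.
move=> [f1 f2]; apply: complexP; rewrite ?cReM ?cImM /= -!RintegralZl//.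
  rewrite -RintegralB//; try exact: integrableZlR.
  by apply: eq_Rintegral => x _; rewrite cReM.
rewrite -RintegralD//; try exact: integrableZlR.
by apply: eq_Rintegral => x _; rewrite cImM.
Qed.

Lemma CintegralB f g : Cintegrable f -> Cintegrable g ->
  Cintegral mu A (fun x => f x - g x) = Cintegral mu A f - Cintegral mu A g.
Proof.
move=> hf hg; rewrite -[in RHS]mulN1r -CintegralZ// -CintegralD//; last exact: CintegrableZ.
by apply: eq_Cintegral => x _; rewrite mulN1r.
Qed.

Lemma Cintegrable0 : Cintegrable (fun=> 0).
Proof. by split; exact: integrable0. Qed.

Lemma Cintegral0 : Cintegral mu A (fun=> 0) = 0.
Proof. by rewrite /Cintegral /= /Rintegral !integral0. Qed.

Lemma Cintegrable_sum I (r : seq I) (F : I -> T -> R[i]) :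
  (forall i, Cintegrable (F i)) -> Cintegrable (fun x => \sum_(i <- r) F i x).
Proof.
move=> hF; elim: r => [|i r IH].
  by under eq_fun do rewrite big_nil; exact: Cintegrable0.
by under eq_fun do rewrite big_cons; exact: CintegrableD.
Qed.

Lemma Cintegral_sum I (r : seq I) (F : I -> T -> R[i]) :
  (forall i, Cintegrable (F i)) ->
  Cintegral mu A (fun x => \sum_(i <- r) F i x) =
  \sum_(i <- r) Cintegral mu A (F i).
Proof.
move=> hF; elim: r => [|i r IH].
  by under eq_Cintegral do rewrite big_nil; rewrite big_nil Cintegral0.
under eq_Cintegral do rewrite big_cons.
by rewrite CintegralD ?IH ?big_cons//; exact: Cintegrable_sum.
Qed.

Lemma CintegralJ f : Cintegrable f ->
  Cintegral mu A (fun x => (f x)^*) = (Cintegral mu A f)^*.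
Proof.
move=> [f1 f2]; apply: complexP; rewrite ?cReJ ?cImJ /=.
  by apply: eq_Rintegral => x _; rewrite cReJ.
rewrite -mulN1r -RintegralZl//; apply: eq_Rintegral => x _.
by rewrite cImJ mulN1r.
Qed.

Lemma Cintegral_le f (g : T -> R) : Cintegrable f ->
  mu.-integrable A (EFin \o g) -> (forall x, A x -> cabs (f x) <= g x) ->
  cabs (Cintegral mu A f) <= \int[mu]_(x in A) g x.
Proof.
move=> hf hg fg; set I := Cintegral mu A f.
have [->|I0] := eqVneq I 0.
  by rewrite cabs0; apply: Rintegral_ge0 => x /fg; apply: le_trans; exact: cabs_ge0.
have aI : 0 < cabs I by rewrite cabs_gt0.
(* Rotation by this unimodular number makes the integral real and nonnegative, which reduces the
   bound to one on real parts. *)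
pose c := (cabs I)^-1%:C * I^*.
have cI : c * I = (cabs I)%:C.
  rewrite /c -mulrA [I^* * I]mulrC mulcJ -rmorphM/= expr2 mulKf// gt_eqF//.
have c1 : cabs c = 1.
  by rewrite /c cabsM cabsC cabsJ ger0_norm ?invr_ge0 ?cabs_ge0// mulVf// gt_eqF.
have -> : cabs I = complex.Re (Cintegral mu A (fun x => c * f x)).
  by rewrite CintegralZ// -/I cI.
rewrite /=; apply: le_Rintegral => //; first exact: (CintegrableZ c hf).1.
move=> x Ax; apply: le_trans (fg x Ax); rewrite -[leRHS]mul1r -c1 -cabsM.
by apply: le_trans (cabs_Re _); exact: ler_norm.
Qed.

Lemma CmeasurableD f g : Cmeasurable f -> Cmeasurable g ->
  Cmeasurable (fun x => f x + g x).
Proof.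
move=> [f1 f2] [g1 g2]; split.
  by under eq_fun do rewrite cReD; exact: measurable_funD.
by under eq_fun do rewrite cImD; exact: measurable_funD.
Qed.

Lemma CmeasurableM f g : Cmeasurable f -> Cmeasurable g ->
  Cmeasurable (fun x => f x * g x).
Proof.
move=> [f1 f2] [g1 g2]; split.
  by under eq_fun do rewrite cReM; apply: measurable_funB; exact: measurable_funM.
by under eq_fun do rewrite cImM; apply: measurable_funD; exact: measurable_funM.
Qed.

Lemma CmeasurableJ f : Cmeasurable f -> Cmeasurable (fun x => (f x)^*).
Proof.
move=> [f1 f2]; split; first by under eq_fun do rewrite cReJ.
by under eq_fun do rewrite cImJ; exact: measurable_funN.
Qed.

Lemma Cmeasurable_cst (c : R[i]) : Cmeasurable (fun=> c).
Proof. by split; exact: measurable_cst. Qed.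

Lemma CmeasurableX f n : Cmeasurable f -> Cmeasurable (fun x => f x ^+ n).
Proof.
move=> hf; elim: n => [|n IH].
  by under eq_fun do rewrite expr0; exact: Cmeasurable_cst.
by under eq_fun do rewrite exprS; exact: CmeasurableM.
Qed.

Lemma Cmeasurable_horner (P : {poly R[i]}) f : Cmeasurable f ->
  Cmeasurable (fun x => P.[f x]).
Proof.
move=> hf; elim/poly_ind: P => [|P c IH].
  by under eq_fun do rewrite horner0; exact: Cmeasurable_cst.
under eq_fun do rewrite hornerMXaddC.
by apply: CmeasurableD; [exact: CmeasurableM|exact: Cmeasurable_cst].
Qed.

Lemma measurable_cabs2 f : Cmeasurable f -> measurable_fun A (fun x => cabs (f x) ^+ 2).
Proof.
move=> [f1 f2]; under eq_fun do rewrite cabs_sqr.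
by apply: measurable_funD; exact: measurable_funX.
Qed.

Lemma integrable_bounded (h : T -> R) (M : R) : (mu A < +oo)%E ->
  measurable_fun A h -> (forall x, A x -> `|h x| <= M) ->
  mu.-integrable A (EFin \o h).
Proof.
move=> fA mh hM; apply: measurable_bounded_integrable => //.
exists M; split; first by rewrite num_real.
by move=> N MN x Ax /=; apply: le_trans (hM x Ax) (ltW MN).
Qed.

Lemma Cintegrable_bounded f (M : R) : (mu A < +oo)%E -> Cmeasurable f ->
  (forall x, A x -> cabs (f x) <= M) -> Cintegrable f.
Proof.
move=> fA [f1 f2] fM; split; apply: (integrable_bounded (M := M)) => // x Ax.
  exact: le_trans (cabs_Re _) (fM x Ax).
exact: le_trans (cabs_Im _) (fM x Ax).
Qed.

End ComplexIntegral.

(** * Polynomials and bounded functions on the circle *)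

Section CircleFunctions.
Variable R : realType.
Implicit Types f g : R[i] -> R[i].

Definition circle_bounded f := Cmeasurable (circle R) f /\
  exists M : R, forall z, circle R z -> cabs (f z) <= M.

Lemma circle_boundedM f g : circle_bounded f -> circle_bounded g ->
  circle_bounded (fun z => f z * g z).
Proof.
move=> [mf [M hM]] [mg [N hN]]; split; first exact: CmeasurableM.
exists (M * N) => z zc; rewrite cabsM.
by apply: ler_pM; rewrite ?cabs_ge0 ?hM ?hN.
Qed.

Lemma circle_boundedJ f : circle_bounded f -> circle_bounded (fun z => (f z)^*).
Proof.
move=> [mf [M hM]]; split; first exact: CmeasurableJ.
by exists M => z zc; rewrite cabsJ hM.
Qed.

Lemma Cmeasurable_id (A : set R[i]) : Cmeasurable A (@id R[i]).
Proof.
split; apply: measurable_funTS; apply: measurable_continuous_complex.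
  exact: continuous_cRe.
exact: continuous_cIm.
Qed.

Lemma cabs_horner_le (P : {poly R[i]}) z : cabs z <= 1 ->
  cabs P.[z] <= \sum_(i < size P) cabs P`_i.
Proof.
move=> z1; rewrite horner_coef; apply: le_trans (ler_cabs_sum _ _ _) _.
apply: ler_sum => i _; rewrite cabsM cabsX ler_piMr ?cabs_ge0//.
by rewrite exprn_ile1 ?cabs_ge0.
Qed.

Lemma circle_bounded_horner (P : {poly R[i]}) : circle_bounded (fun z => P.[z]).
Proof.
split; first exact: Cmeasurable_horner (Cmeasurable_id _).
exists (\sum_(i < size P) cabs P`_i) => z /circleP z1.
by rewrite cabs_horner_le// z1.
Qed.

Lemma circle_boundedX i : circle_bounded (fun z => z ^+ i).
Proof.
split; first exact: CmeasurableX (Cmeasurable_id _).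
by exists 1 => z /circleP z1; rewrite cabsX z1 expr1n.
Qed.

Lemma horner_lipschitz (P : {poly R[i]}) (r : R) : exists2 L : R, 0 < L &
  forall z w, cabs z <= r -> cabs w <= r ->
    cabs (P.[z] - P.[w]) <= L * cabs (z - w).
Proof.
(* The sup bound [M] joins the induction because the Lipschitz constant of a product involves it. *)
suff [L [M [L0 M0 h]]] : exists L M : R, [/\ 0 < L, 0 < M &
    forall z w, cabs z <= r -> cabs w <= r ->
      cabs (P.[z] - P.[w]) <= L * cabs (z - w) /\ cabs P.[w] <= M].
  by exists L => // z w zr wr; have [] := h z w zr wr.
elim/poly_ind: P => [|P c [L [M [L0 M0 IH]]]].
  exists 1, 1; split=> // z w _ _.
  by rewrite !horner0 subrr cabs0 mul1r cabs_ge0.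
exists (L * (`|r| + 1) + M), (M * (`|r| + 1) + cabs c).
have r1 : 0 < `|r| + 1 by rewrite ltr_wpDl.
split.
- by rewrite addr_gt0// mulr_gt0.
- by rewrite ltr_pwDl ?mulr_gt0// cabs_ge0.
move=> z w zr wr; have [h1 h2] := IH z w zr wr.
have rr := ler_norm r; rewrite !hornerMXaddC; split.
  have -> : P.[z] * z + c - (P.[w] * w + c) = (P.[z] - P.[w]) * z + P.[w] * (z - w).
    by ring.
  apply: le_trans (ler_cabsD _ _) _; rewrite !cabsM mulrDl lerD//.
    rewrite mulrAC; apply: ler_pM; rewrite ?cabs_ge0//.
    by lra.
  by rewrite ler_wpM2r ?cabs_ge0.
apply: le_trans (ler_cabsD _ _) _; rewrite lerD2r cabsM.
by apply: ler_pM; rewrite ?cabs_ge0//; lra.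
Qed.

Lemma open_horner_neq0 (P : {poly R[i]}) : open [set z | P.[z] != 0].
Proof.
apply/open_cabsP => z /= Pz.
have [L L0 hL] := horner_lipschitz P (cabs z + 1).
have Pz0 : 0 < cabs P.[z] by rewrite cabs_gt0.
exists (Num.min 1 (cabs P.[z] / L)); first by rewrite lt_min ltr01 divr_gt0.
move=> w; rewrite lt_min => /andP[w1 w2]; apply/negP => /eqP Pw.
have := hL z w; rewrite Pw subr0 cabs_distC => h.
have : cabs P.[z] <= L * cabs (w - z).
  apply: h; first by rewrite lerDl.
  by have := lerB_cabs w z; lra.
by rewrite leNgt mulrC -ltr_pdivlMr// w2.
Qed.

Lemma finite_roots (P : {poly R[i]}) : P != 0 -> finite_set [set z | P.[z] = 0].
Proof.
move=> P0; have [rs Prs] := closed_field_poly_normal P.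
apply: (@sub_finite_set _ _ [set` rs]); last exact: finite_seq.
move=> z /= Pz; have : root P z by apply/eqP.
by rewrite Prs rootZ ?lead_coef_eq0// root_prod_XsubC.
Qed.

Lemma reversed_circle n (P : {poly R[i]}) z : (size P <= n.+1)%N -> circle R z ->
  (reversed_poly n P).[z] = z ^+ n * P.[z]^*.
Proof.
move=> sP zc; have z1 := (circleP z).1 zc.
have z0 : z != 0 by rewrite -cabs_gt0 z1.
by rewrite reversed_polyE// (circleV zc) div1r invrK.
Qed.

Lemma size_reversed n (P : {poly R[i]}) : (size (reversed_poly n P) <= n.+1)%N.
Proof. exact: size_poly. Qed.

Lemma reversed_polyS n (P : {poly R[i]}) :
  reversed_poly n.+1 ('X * P) = reversed_poly n P.
Proof.
apply/polyP => i; rewrite !coef_poly coefXM ltnS !conjcE.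
have [->|ni] := eqVneq i n.+1.
  by rewrite subnn ltnn leqnn eqxx rmorph0.
rewrite leq_eqVlt (negPf ni) /= ltnS; case: ifP => // ile.
by rewrite subSn.
Qed.

Lemma reversed_polyK n (P : {poly R[i]}) c : (size P <= n.+1)%N ->
  reversed_poly n.+1 (c *: reversed_poly n P) = c^* *: ('X * P).
Proof.
move=> sP; apply/polyP => i; rewrite coef_poly !coefZ coefXM !coef_poly !conjcE.
case: i => [|i] /=; first by rewrite subn0 ltnn mulr0 conjC0 mulr0.
rewrite !ltnS subSS; case: ifP => ile.
  by rewrite leq_subr subKn// rmorphM/= conjCK.
rewrite [P`_i]nth_default ?mulr0//.
by rewrite (leq_trans sP)// ltnNge ile.
Qed.

Lemma reversed_polyB n (P Q : {poly R[i]}) :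
  reversed_poly n (P - Q) = reversed_poly n P - reversed_poly n Q.
Proof.
apply/polyP => i; rewrite coefB !coef_poly !conjcE; case: ifP => _; last by rewrite subr0.
by rewrite coefB rmorphB.
Qed.

End CircleFunctions.

(** * Orthogonal polynomials on the circle *)

Section OrthogonalPolynomials.
Variables (R : realType) (mu : probability R[i] R) (Phi : nat -> {poly R[i]})
  (alpha : nat -> R[i]).
Hypotheses (muC : mu (circle R) = 1%E)
  (suppC : infinite_set (msupport mu))
  (orth : forall n, monic_orthogonal mu n (Phi n))
  (szego : verblunsky Phi alpha).

Let C := circle R.
Let mC : measurable C := @measurable_circle R.
Let finC : (mu C < +oo)%E.
Proof. by rewrite muC ltry. Qed.
Let Phis n := reversed_poly n (Phi n).

Lemma size_Phi n : size (Phi n) = n.+1.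
Proof. by have [] := orth n. Qed.

Lemma Phi0 : Phi 0 = 1.
Proof.
have [/monicP m s _] := orth 0.
by rewrite (@size1_polyC _ (Phi 0)) ?s//; move: m; rewrite lead_coefE s => ->.
Qed.

Lemma Phi_rec n z : (Phi n.+1).[z] = z * (Phi n).[z] - (alpha n)^* * (Phis n).[z].
Proof. by rewrite szego hornerD hornerN hornerZ hornerM hornerX. Qed.

Lemma Phis_rec n z : (Phis n.+1).[z] = (Phis n).[z] - alpha n * (z * (Phi n).[z]).
Proof.
rewrite /Phis szego reversed_polyB reversed_polyS reversed_polyK ?size_Phi//.
by rewrite conjCK hornerD hornerN hornerZ hornerM hornerX.
Qed.

Lemma Phi0E z : (Phi 0).[z] = 1.
Proof. by rewrite Phi0 hornerC. Qed.

Lemma Phis0E z : (Phis 0).[z] = 1.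
Proof.
by rewrite /Phis /reversed_poly horner_poly big_ord1 Phi0 subn0 coefC eqxx conjcE rmorph1 mul1r expr0.
Qed.

Lemma circle_bounded_int f : circle_bounded f -> Cintegrable mu C f.
Proof. by move=> [mf [M hM]]; apply: (Cintegrable_bounded mC finC mf hM). Qed.

Lemma poly_int (P Q : {poly R[i]}) : Cintegrable mu C (fun z => P.[z]^* * Q.[z]).
Proof.
apply/circle_bounded_int/circle_boundedM; last exact: circle_bounded_horner.
exact/circle_boundedJ/circle_bounded_horner.
Qed.

Lemma orth_poly n (P : {poly R[i]}) : (size P <= n)%N ->
  dotmu mu (fun z => P.[z]) (fun z => (Phi n).[z]) = 0.
Proof.
move=> sP; have [_ _ o] := orth n.
rewrite /dotmu (@eq_Cintegral _ _ _ _ _ _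
  (fun z : R[i] => \sum_(i < n) (P`_i)^* * ((z ^+ i)^* * (Phi n).[z]))).
  rewrite Cintegral_sum//.
    rewrite big1// => i _; rewrite CintegralZ//.
      by have := o i (ltn_ord i); rewrite /dotmu => ->; rewrite mulr0.
    by have := poly_int 'X^i (Phi n); under eq_fun do rewrite hornerXn.
  move=> i; apply: CintegrableZ => //.
  by have := poly_int 'X^i (Phi n); under eq_fun do rewrite hornerXn.
move=> z _; rewrite (horner_coef_wide _ sP) rmorph_sum mulr_suml.
by apply: eq_bigr => i _; rewrite rmorphM mulrA.
Qed.

Definition nu n : R := \int[mu]_(z in C) (cabs (Phi n).[z] ^+ 2).

Lemma int_cabs2 (P : {poly R[i]}) : mu.-integrable C (EFin \o (fun z => cabs P.[z] ^+ 2)).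
Proof.
have [+ _] := poly_int P P; apply: eq_integrable => // z _ /=.
by rewrite mulrC mulcJ.
Qed.

Lemma dotmu_self (P : {poly R[i]}) : dotmu mu (fun z => P.[z]) (fun z => P.[z]) =
  (\int[mu]_(z in C) (cabs P.[z] ^+ 2))%:C.
Proof.
apply: complexP => /=; first by apply: eq_Rintegral => z _; rewrite mulrC mulcJ.
rewrite (@eq_Rintegral _ _ _ _ _ (fun=> 0)); last by move=> z _; rewrite mulrC mulcJ.
by rewrite /Rintegral integral0.
Qed.

Lemma nu_dot n : dotmu mu (fun z => (Phi n).[z]) (fun z => (Phi n).[z]) = (nu n)%:C.
Proof. exact: dotmu_self. Qed.

Lemma normmu_nu n : normmu mu (fun z => (Phi n).[z]) = Num.sqrt (nu n).
Proof. by rewrite /normmu nu_dot. Qed.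

Lemma cabs_Phis_circle n z : circle R z -> cabs (Phis n).[z] = cabs (Phi n).[z].
Proof.
move=> zc; rewrite /Phis reversed_circle ?size_Phi// cabsM cabsX cabsJ.
by rewrite ((circleP z).1 zc) expr1n mul1r.
Qed.

(** Pythagoras in [z Phi_n = Phi_(n+1) + conj(alpha_n) Phi_n^*]: the two terms on the right are
    orthogonal because [Phi_n^*] has degree at most [n], and on the circle [|Phi_n^*| = |Phi_n|]. *)
Lemma nu_rec n : nu n.+1 = (1 - cabs (alpha n) ^+ 2) * nu n.
Proof.
have cross : complex.Re (alpha n * dotmu mu (fun z => (Phis n).[z]) (fun z => (Phi n.+1).[z])) = 0.
  by rewrite orth_poly ?mulr0// size_reversed.
have E : nu n = nu n.+1 + cabs (alpha n) ^+ 2 * nu n.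
  rewrite /nu -[in RHS]RintegralZl//; last exact: int_cabs2.
  rewrite -RintegralD//; first last.
  - by apply: (integrableZlR mC); exact: int_cabs2.
  - exact: int_cabs2.
  (* Adding twice the vanishing cross term turns the claim into a pointwise identity under a single
     integral. *)
  rewrite -[RHS]addr0 -[X in _ + X](mulr0 2) -cross /dotmu.
  rewrite -CintegralZ//; last exact: poly_int.
  rewrite /= -RintegralZl//; last first.
    exact: (CintegrableZ mC (alpha n) (poly_int (Phis n) (Phi n.+1))).1.
  rewrite -RintegralD//; first last.
  - apply: (integrableZlR mC).
    exact: (CintegrableZ mC (alpha n) (poly_int (Phis n) (Phi n.+1))).1.
  - apply: (integrableDR mC); first exact: int_cabs2.
    by apply: (integrableZlR mC); exact: int_cabs2.
  apply: eq_Rintegral => z; rewrite inE => zc.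
  have e1 := cabs_Phis_circle n zc.
  have e2 : cabs (Phi n).[z] =
      cabs ((Phi n.+1).[z] + (alpha n)^* * (Phis n).[z]).
    by rewrite Phi_rec subrK cabsM ((circleP z).1 zc) mul1r.
  rewrite [in LHS]e2 -e1.
  rewrite !cabs_sqr !(cReD, cImD, cReM, cImM, cReJ, cImJ).
  by move: (complex.Re _) (complex.Im _) (complex.Re _) (complex.Im _)
      (complex.Re _) (complex.Im _) => *; ring.
by rewrite mulrBl mul1r {1}E addrK.
Qed.

Lemma nu0 : nu 0 = 1.
Proof.
rewrite /nu (@eq_Rintegral _ _ _ _ _ (fun=> 1)).
  transitivity (1 * fine (mu C)); first exact: Rintegral_cst.
  by rewrite /C muC mulr1.
by move=> z _; rewrite Phi0E cabs1 expr1n.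
Qed.

(** A zero norm would make [Phi n] vanish almost everywhere, confining the support of [mu] to its
    finitely many roots. *)
Lemma nu_gt0 n : 0 < nu n.
Proof.
have n0 : 0 <= nu n by apply: Rintegral_ge0 => z _; exact: sqr_ge0.
rewrite lt_neqAle n0 andbT eq_sym; apply/eqP => h0.
pose g0 z := cabs (Phi n).[z] ^+ 2.
have mf : measurable_fun C (EFin \o g0).
  exact: measurable_int (int_cabs2 (Phi n)).
have PhiN0 : Phi n != 0 by rewrite -size_poly_eq0 size_Phi.
apply: suppC; apply: sub_finite_set (finite_roots PhiN0) => z supz /=.
apply/eqP/negP => /negP nz.
have := supz _ (@open_horner_neq0 _ (Phi n)) nz; apply/negP; rewrite -leNgt.
set U := [set z | _].
have mU : measurable U by apply: open_measurable_complex; exact: open_horner_neq0.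
have CU : mu (C `&` U) = 0%E.
  have mCU := measurableI _ _ mC mU; apply/(negligibleP mu mCU).
  have : (\int[mu]_(x in C) `|(EFin \o g0) x| = 0)%E.
    under eq_integral do rewrite /= ger0_norm ?sqr_ge0//.
    rewrite -[LHS]fineK; last exact: integrable_fin_num (int_cabs2 (Phi n)).
    by congr EFin.
  move=> /(ae_eq_integral_abs mu mC mf); apply: negligibleS.
  move=> w [Cw Uw] /= /(_ Cw) [] /eqP.
  by rewrite sqrf_eq0 cabs_eq0 (negPf Uw).
have nC : mu (~` C) = 0%E by rewrite probability_setC// muC subee.
have mCU := measurableI _ _ mC mU; have mnC := measurableC mC.
apply: (@le_trans _ _ (mu (C `&` U) + mu (~` C))%E); last by rewrite CU nC adde0.
apply: le_trans _ (measureU2 mu mCU mnC).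
apply: le_measure; rewrite ?inE//; first exact: measurableU.
by move=> w Uw; have [Cw|Cw] := pselect (C w); [left|right].
Qed.

Lemma alpha_lt1 n : cabs (alpha n) < 1.
Proof.
have := nu_gt0 n.+1; rewrite nu_rec pmulr_lgt0 ?nu_gt0// subr_gt0.
by rewrite expr_lt1 ?cabs_ge0.
Qed.

Lemma nu_le1 n : nu n <= 1.
Proof.
elim: n => [|n IH]; first by rewrite nu0.
by rewrite nu_rec mulr_ile1 ?(ltW (nu_gt0 _))// ?subr_ge0 ?gerBl ?sqr_ge0// expr_le1 ?cabs_ge0 ?ltW ?alpha_lt1.
Qed.

Lemma nu_nincr : nonincreasing_seq nu.
Proof.
apply/nonincreasing_seqP => n; rewrite nu_rec ler_piMl ?(ltW (nu_gt0 _))//.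
by rewrite gerBl sqr_ge0.
Qed.

(** The sequence decreases, and positivity of the limit is that of an infinite product: past [N],
    [nu] loses at most the fraction given by the tail of the squares, kept below 1/2. *)
Lemma nu_cvg : cvgn (series (fun n => cabs (alpha n) ^+ 2)) ->
  exists2 l : R, 0 < l & nu n @[n --> \oo] --> l.
Proof.
move=> /cvg_small_tails/(_ 2^-1)[|N hN]; first by rewrite invr_gt0.
have lb n : nu N * 2^-1 <= nu (n + N).
  have h : nu N * (1 - \sum_(N <= j < n + N) cabs (alpha j) ^+ 2) <= nu (n + N).
    elim: n => [|n IH]; first by rewrite add0n big_geq// subr0 mulr1.
    rewrite addSn nu_rec big_nat_recr ?leq_addl//=.
    have : nu (n + N) <= nu N by apply: nu_nincr; exact: leq_addl.
    move=> /(ler_wpM2l (sqr_ge0 (cabs (alpha (n + N))))).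
    move: IH; set s := \sum_(_ <= _ < _) _; set c := _ ^+ 2.
    by move=> *; lra.
  apply: le_trans h; rewrite ler_wpM2l ?(ltW (nu_gt0 _))//.
  by have := hN N (n + N)%N (leqnn _); lra.
have lbn n : nu N * 2^-1 <= nu n.
  apply: le_trans (lb n) _; apply: nu_nincr; exact: leq_addr.
have cv : cvgn nu.
  apply: nonincreasing_is_cvgn; first exact: nu_nincr.
  by exists (nu N * 2^-1) => _ [n _ <-].
exists (limn nu) => //; apply: (@lt_le_trans _ _ (nu N * 2^-1)).
  by rewrite mulr_gt0 ?nu_gt0 ?invr_gt0.
by apply: limr_ge => //; near=> n; exact: lbn.
Unshelve. all: by end_near. Qed.

Lemma shift_defect n k z : z ^+ k * (Phi n).[z] = (Phi (n + k)).[z] +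
  \sum_(j < k) (alpha (n + j))^* * (z ^+ (k - j.+1) * (Phis (n + j)).[z]).
Proof.
elim: k => [|k IH]; first by rewrite big_ord0 expr0 mul1r addn0 addr0.
rewrite exprS -mulrA IH mulrDr big_ord_recr/= subnn expr0 mul1r addnS Phi_rec.
rewrite mulr_sumr addrA addrAC subrK; congr (_ + _).
apply: eq_bigr => j _; rewrite !mulrA [z * _]mulrC -!mulrA; congr (_ * _).
by rewrite mulrA -exprS subSS -subSn.
Qed.

(* [z^k Phi_n] differs from [Phi_(n+k)], which is orthogonal to [Phi_n], by
   terms of size [alpha]. *)
Lemma moment_bound n k : (0 < k)%N ->
  cabs (Cintegral mu C (fun z => z ^+ k * (cabs (Phi n).[z] ^+ 2)%:C)) <=
  \sum_(j < k) cabs (alpha (n + j)).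
Proof.
move=> k0.
have bnd j i : circle_bounded (fun z => (Phi n).[z]^* * (z ^+ i * (Phis (n + j)).[z])).
  apply: circle_boundedM; first exact/circle_boundedJ/circle_bounded_horner.
  apply: circle_boundedM; last exact: circle_bounded_horner.
  exact: circle_boundedX.
rewrite (@eq_Cintegral _ _ _ _ _ _ (fun z : R[i] => (Phi n).[z]^* * (Phi (n + k)).[z] +
  \sum_(j < k) (alpha (n + j))^* * ((Phi n).[z]^* * (z ^+ (k - j.+1) * (Phis (n + j)).[z])))); last first.
  move=> z _; rewrite -mulcJ mulrA shift_defect mulrDl mulrC; congr (_ + _).
  by rewrite mulr_suml; apply: eq_bigr => j _; rewrite -mulrA; congr (_ * _); rewrite mulrC.
rewrite CintegralD//; last 2 first.
- exact: poly_int.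
- by apply: Cintegrable_sum => // j; apply: CintegrableZ => //; exact: circle_bounded_int.
have := @orth_poly (n + k) (Phi n); rewrite /dotmu => ->; last first.
  by rewrite size_Phi -addn1 leq_add2l.
rewrite add0r Cintegral_sum//; last first.
  by move=> j; apply: CintegrableZ => //; exact: circle_bounded_int.
apply: le_trans (ler_cabs_sum _ _ _) _; apply: ler_sum => j _.
rewrite CintegralZ//; last exact: circle_bounded_int.
rewrite cabsM cabsJ ler_piMr ?cabs_ge0//.
(* By the arithmetic-geometric mean inequality each mixed integral is at most the average of two
   values of [nu], hence at most 1. *)
pose g z := 2^-1 * (cabs (Phi n).[z] ^+ 2 + cabs (Phi (n + j)).[z] ^+ 2).
have ig : mu.-integrable C (EFin \o g).
  by apply: (integrableZlR mC); apply: (integrableDR mC); exact: int_cabs2.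
apply: le_trans (@Cintegral_le _ _ _ mu C mC _ g _ ig _) _.
- exact: circle_bounded_int.
- move=> z zc; rewrite !cabsM cabsX ((circleP z).1 zc) expr1n mul1r cabsJ.
  rewrite cabs_Phis_circle// /g.
  by move: (cabs _) (cabs _) => a b; have := sqr_ge0 (a - b); nra.
rewrite /g RintegralZl//; last by apply: (integrableDR mC); exact: int_cabs2.
rewrite RintegralD//; [|exact: int_cabs2..].
by have := nu_le1 n; have := nu_le1 (n + j); rewrite /nu; lra.
Qed.

End OrthogonalPolynomials.

(** * Angular means and the Schwarz formula *)

Section AngularMean.
Variable R : realType.
Notation leb := (@lebesgue_measure R).
Notation arcI := (`[0%R, (2 * pi)%R]%classic : set R).

Lemma twopi_gt0 : 0 < 2 * pi :> R.
Proof. by rewrite mulr_gt0// pi_gt0. Qed.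

Lemma leb_arcI : leb arcI = (2 * pi)%:E.
Proof. by rewrite lebesgue_measure_itv/= lte_fin twopi_gt0 sube0. Qed.

Lemma leb_arcI_fin : (leb arcI < +oo)%E.
Proof. by rewrite leb_arcI ltry. Qed.

Lemma measurable_arcI : @measurable _ (measurableTypeR R) arcI.
Proof. exact: measurable_itv. Qed.

Definition amean (g : R -> R[i]) : R[i] :=
  ((2 * pi)^-1)%:C * Cintegral leb arcI g.

Definition angular_int (g : R -> R[i]) := Cintegrable leb arcI g.

(* [measurableTypeR R] is the structure carrying [lebesgue_measure]; it is only
   convertible to the one inferred for [R]. *)
Definition angular_meas (g : R -> R[i]) :=
  @Cmeasurable _ (measurableTypeR R) R arcI g.

Lemma amean_eq f g : (forall t, f t = g t) -> amean f = amean g.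
Proof. by move=> fg; rewrite /amean; congr (_ * _); apply: eq_Cintegral => t _; exact: fg. Qed.

Lemma ameanD f g : angular_int f -> angular_int g ->
  amean (fun t => f t + g t) = amean f + amean g.
Proof. by move=> hf hg; rewrite /amean CintegralD// ?mulrDr//; exact: measurable_arcI. Qed.

Lemma ameanZ c f : angular_int f -> amean (fun t => c * f t) = c * amean f.
Proof. by move=> hf; rewrite /amean CintegralZ// 1?mulrCA//; exact: measurable_arcI. Qed.

Lemma ameanJ f : angular_int f -> amean (fun t => (f t)^*) = (amean f)^*.
Proof.
move=> hf; rewrite /amean CintegralJ//.
by apply: complexP; rewrite !(cReJ, cImJ, cReMr, cImMr) // mulrN.
Qed.

Lemma amean_sum I (r : seq I) (F : I -> R -> R[i]) :
  (forall i, angular_int (F i)) ->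
  amean (fun t => \sum_(i <- r) F i t) = \sum_(i <- r) amean (F i).
Proof.
by move=> hF; rewrite /amean Cintegral_sum// ?mulr_sumr//; exact: measurable_arcI.
Qed.

Lemma angular_intD f g : angular_int f -> angular_int g ->
  angular_int (fun t => f t + g t).
Proof. by apply: CintegrableD; exact: measurable_arcI. Qed.

Lemma angular_intZ c f : angular_int f -> angular_int (fun t => c * f t).
Proof. by apply: CintegrableZ; exact: measurable_arcI. Qed.

Lemma angular_bounded_int (f : R -> R[i]) (M : R) :
  angular_meas f -> (forall t, cabs (f t) <= M) -> angular_int f.
Proof.
move=> mf fM; apply: (Cintegrable_bounded measurable_arcI leb_arcI_fin mf).
by move=> t _; exact: fM.
Qed.

Lemma amean_bound (f : R -> R[i]) (M : R) :
  angular_int f -> (forall t, cabs (f t) <= M) -> cabs (amean f) <= M.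
Proof.
move=> hf fM; rewrite /amean cabsM cabsC ger0_norm ?invr_ge0 ?(ltW twopi_gt0)//.
rewrite ler_pdivrMl ?twopi_gt0// [leRHS]mulrC.
apply: le_trans (@Cintegral_le _ _ _ leb arcI measurable_arcI _ (fun=> M) hf _ _) _.
- by apply: (integrable_bounded measurable_arcI leb_arcI_fin (M := `|M|)) => //.
- by move=> t _; exact: fM.
- have E : fine (leb arcI) = 2 * pi by rewrite leb_arcI.
  by rewrite Rintegral_cst//; move: E; rewrite /= => ->.
Qed.

Lemma angular_meas_expi : angular_meas (@expi R).
Proof.
split; apply: measurable_funTS.
  exact: (continuous_measurable_fun (@continuous_cos R)).
exact: (continuous_measurable_fun (@continuous_sin R)).
Qed.

Lemma Rint_cos_sin (k : nat) : (0 < k)%N ->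
  \int[leb]_(t in arcI) cos (t *+ k) = 0 /\ \int[leb]_(t in arcI) sin (t *+ k) = 0.
Proof.
move=> k0; have k1 : k%:R != 0 :> R by rewrite pnatr_eq0 -lt0n.
have dZ (c a t : R) (f : R -> R) : is_derive t 1 f a ->
    is_derive t 1 (fun x => c * f x) (c * a).
  by move=> df; exact: (@is_deriveZ R R R f c t 1 a df).
have dk (t : R) : is_derive t 1 (fun x : R => k%:R * x) k%:R.
  by have := dZ k%:R 1 t id (is_derive_id t 1); rewrite mulr1.
have ck : continuous (fun x : R => k%:R * x).
  by move=> x; apply: cvgM; [exact: cvg_cst|exact: cvg_id].
have ds (t : R) : is_derive t 1 (fun x : R => k%:R^-1 * sin (k%:R * x)) (cos (k%:R * t)).
  have := dZ k%:R^-1 _ _ _ (is_derive1_comp (is_derive_sin (k%:R * t)) (dk t)).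
  by rewrite mulrCA mulVf// mulr1.
have dc (t : R) : is_derive t 1 (fun x : R => - k%:R^-1 * cos (k%:R * x)) (sin (k%:R * t)).
  have := dZ (- k%:R^-1) _ _ _ (is_derive1_comp (is_derive_cos (k%:R * t)) (dk t)).
  by rewrite mulrCA [- _^-1 * _]mulNr mulVf// mulrNN mulr1.
have cont (F : R -> R) (f : R -> R) (dF : forall t : R, is_derive t 1 F (f t)) :
    continuous F.
  by move=> t; apply: differentiable_continuous; apply/derivable1_diffP;
    have := dF t; case.
have key (F f : R -> R) : (forall t : R, is_derive t 1 F (f t)) -> continuous f ->
    \int[leb]_(t in arcI) f t = F (2 * pi) - F 0.
  move=> dF cf; rewrite /Rintegral (@continuous_FTC2 _ f F)//.
  - exact: twopi_gt0.
  - by apply: continuous_subspaceT.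
  - have cF := cont _ _ dF; split.
    + by move=> t _; have := dF t; case.
    + exact: cvg_at_right_filter (cF 0).
    + exact: cvg_at_left_filter (cF (2 * pi)).
  - by move=> t _; rewrite derive1E; have := dF t; case.
have e2 : k%:R * (2 * pi) = (pi *+ 2) *+ k :> R by rewrite mulr_natl [2 * pi]mulr_natl.
have e3s : sin ((pi *+ 2) *+ k) = 0 :> R.
  by have := @periodicn _ _ _ _ (@sinD2pi R) k 0; rewrite add0r sin0.
have e3c : cos ((pi *+ 2) *+ k) = 1 :> R.
  by have := @periodicn _ _ _ _ (@cosD2pi R) k 0; rewrite add0r cos0.
split.
  under eq_Rintegral do rewrite -mulr_natl.
  rewrite (key _ _ ds); last first.
    by move=> t; apply: continuous_comp; [exact: ck|exact: continuous_cos].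
  by rewrite e2 mulr0 sin0 mulr0 subr0 e3s mulr0.
under eq_Rintegral do rewrite -mulr_natl.
rewrite (key _ _ dc); last first.
  by move=> t; apply: continuous_comp; [exact: ck|exact: continuous_sin].
by rewrite e2 mulr0 cos0 e3c subrr.
Qed.

End AngularMean.

Lemma measurable_fun_inv_gt0 d (T : measurableType d) (R : realType) (D : set T)
    (f : T -> R) : measurable D -> measurable_fun D f ->
  (forall x, D x -> 0 < f x) -> measurable_fun D (fun x => (f x)^-1).
Proof.
move=> mD mf f0; apply: (@eq_measurable_fun _ _ _ _ _ (fun x => f x `^ (-1))).
  by move=> x; rewrite inE => /f0/ltW h; rewrite powR_inv1.
exact: measurableT_comp (measurable_powR _) mf.
Qed.

Section AngularFunctions.
Variable R : realType.
Notation leb := (@lebesgue_measure R).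
Notation arcI := (`[0%R, (2 * pi)%R]%classic : set R).

Definition angular_bounded (f : R -> R[i]) :=
  angular_meas f /\ exists M : R, forall t, cabs (f t) <= M.

Lemma angular_bounded_angular_int f : angular_bounded f -> angular_int f.
Proof. by move=> [mf [M hM]]; exact: angular_bounded_int mf hM. Qed.

Lemma angular_boundedM f g : angular_bounded f -> angular_bounded g ->
  angular_bounded (fun t => f t * g t).
Proof.
move=> [mf [M hM]] [mg [N hN]]; split; first exact: CmeasurableM.
by exists (M * N) => t; rewrite cabsM ler_pM ?cabs_ge0.
Qed.

Lemma angular_boundedD f g : angular_bounded f -> angular_bounded g ->
  angular_bounded (fun t => f t + g t).
Proof.
move=> [mf [M hM]] [mg [N hN]]; split; first exact: CmeasurableD.
by exists (M + N) => t; rewrite (le_trans (ler_cabsD _ _))// lerD.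
Qed.

Lemma angular_boundedJ f : angular_bounded f -> angular_bounded (fun t => (f t)^*).
Proof.
move=> [mf [M hM]]; split; first exact: CmeasurableJ.
by exists M => t; rewrite cabsJ.
Qed.

Lemma angular_bounded_cst c : angular_bounded (fun=> c).
Proof. by split; [exact: Cmeasurable_cst|exists (cabs c)]. Qed.

Lemma angular_boundedX n : angular_bounded (fun t => expi t ^+ n).
Proof.
split; first exact: CmeasurableX (angular_meas_expi R).
by exists 1 => t; rewrite cabsX cabs_expi expr1n.
Qed.

Lemma angular_bounded_horner (P : {poly R[i]}) :
  angular_bounded (fun t => P.[expi t]).
Proof.
split; first exact: Cmeasurable_horner (angular_meas_expi R).
exists (\sum_(i < size P) cabs P`_i) => t.
by apply: cabs_horner_le; rewrite cabs_expi.
Qed.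

Lemma expi_sub_neq0 (z : R[i]) t : cabs z < 1 -> expi t - z != 0.
Proof.
move=> z1; rewrite subr_eq0; apply/eqP => h.
by move: z1; rewrite -h cabs_expi ltxx.
Qed.

Lemma expi_sub_ge (z : R[i]) t : 1 - cabs z <= cabs (expi t - z).
Proof. by rewrite -(cabs_expi t) lerB_cabs. Qed.

Lemma angular_bounded_cauchy (z : R[i]) : cabs z < 1 ->
  angular_bounded (fun t => (expi t - z)^-1).
Proof.
move=> z1; have mf : angular_meas (fun t => expi t - z).
  by apply: CmeasurableD; [exact: angular_meas_expi|exact: Cmeasurable_cst].
have mJ := CmeasurableJ mf.
have mi : @measurable_fun _ _ (measurableTypeR R) R arcI (fun t => (cabs (expi t - z) ^+ 2)^-1).
  apply: measurable_fun_inv_gt0; first exact: measurable_arcI.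
    exact: measurable_cabs2.
  by move=> t _; rewrite exprn_gt0// cabs_gt0 expi_sub_neq0.
split.
  have : angular_meas (fun t => (expi t - z)^* * ((cabs (expi t - z) ^+ 2)^-1)%:C).
    by apply: CmeasurableM mJ _; split => //; exact: measurable_cst.
  suff -> : (fun t => (expi t - z)^* * ((cabs (expi t - z) ^+ 2)^-1)%:C) =
            (fun t => (expi t - z)^-1) by [].
  apply/funext => t; have h := expi_sub_neq0 t z1.
  have hJ : (expi t - z)^* != 0 by rewrite -cabs_eq0 cabsJ cabs_eq0.
  rewrite fmorphV /= -mulcJ; move: (expi t - z) h hJ => x h hJ.
  by rewrite invfM mulrCA mulfV ?mulr1.
exists (1 - cabs z)^-1 => t; rewrite cabsV lef_pV2 ?posrE ?subr_gt0//.
  exact: expi_sub_ge.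
by rewrite (lt_le_trans _ (expi_sub_ge _ _))// subr_gt0.
Qed.

Lemma amean_cst (c : R[i]) : amean (fun=> c) = c.
Proof.
have E : fine (leb arcI) = 2 * pi by rewrite leb_arcI.
rewrite /amean /Cintegral /= !Rintegral_cst//; [|exact: measurable_arcI..].
move: E; rewrite /= => ->; have p0 := twopi_gt0 R.
by apply: complexP; rewrite ?cReMr ?cImMr /= mulrCA mulVf ?mulr1// gt_eqF.
Qed.

Lemma amean_expiX k : amean (fun t => expi t ^+ k : R[i]) = (k == 0)%:R.
Proof.
case: k => [|k]; first by rewrite -[RHS]amean_cst.
have [hc hs] := Rint_cos_sin R (ltn0Sn k).
rewrite /amean (_ : Cintegral _ _ _ = 0) ?mulr0//.
apply: complexP => /=; [rewrite -[RHS]hc|rewrite -[RHS]hs];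
  by apply: eq_Rintegral => t _; rewrite expiX.
Qed.

Variable z : R[i].
Hypothesis z1 : cabs z < 1.

(** These are the moments of the Cauchy kernel. The identity [e / (e - z) = 1 + z / (e - z)] gives
    them one-step recurrences, which take the place of residues. *)
Let J k := amean (fun t => expi t ^+ k / (expi t - z)).
Let J' k := amean (fun t => (expi t ^+ k)^* / (expi t - z)).

Let bJ k : angular_bounded (fun t => expi t ^+ k / (expi t - z)).
Proof.
by apply: angular_boundedM; [exact: angular_boundedX|exact: angular_bounded_cauchy].
Qed.

Let bJ' k : angular_bounded (fun t => (expi t ^+ k)^* / (expi t - z)).
Proof.
apply: angular_boundedM; last exact: angular_bounded_cauchy.
exact/angular_boundedJ/angular_boundedX.
Qed.

Let JS k : J k.+1 = (k == 0)%:R + z * J k.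
Proof.
rewrite -amean_expiX -ameanZ; last exact: angular_bounded_angular_int.
rewrite -ameanD; first last.
- exact/angular_intZ/angular_bounded_angular_int.
- exact/angular_bounded_angular_int/angular_boundedX.
apply: amean_eq => t; have h := expi_sub_neq0 t z1.
by rewrite exprS; move: (expi t) h => e h; field.
Qed.

Let J'S k : J' k = z * J' k.+1.
Proof.
have h0 : amean (fun t => (expi t ^+ k.+1)^* : R[i]) = 0.
  rewrite ameanJ; last exact/angular_bounded_angular_int/angular_boundedX.
  by rewrite amean_expiX rmorph0.
transitivity (amean (fun t => (expi t ^+ k.+1)^* : R[i]) + z * J' k.+1).
  2: by rewrite h0 add0r.
rewrite -ameanZ; last exact: angular_bounded_angular_int.
rewrite -ameanD; first last.
- exact/angular_intZ/angular_bounded_angular_int.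
- exact/angular_bounded_angular_int/angular_boundedJ/angular_boundedX.
apply: amean_eq => t; have h := expi_sub_neq0 t z1.
rewrite exprS rmorphM /= -expiV; have e0 := expi_neq0 t.
by move: (expi t) ((_ ^+ k)^*) h e0 => e c h e0; field; rewrite h e0.
Qed.

(** Iterating [J'S] gives [J' k = z ^+ m * J' (k + m)] for every [m]; the [J'] are bounded uniformly
    and [|z| < 1]. *)
Let J'0 k : J' k = 0.
Proof.
have [M hM] : exists M : R, forall m, cabs (J' m) <= M.
  exists (1 - cabs z)^-1 => m; apply: amean_bound.
    exact: angular_bounded_angular_int.
  move=> t; rewrite cabsM cabsJ cabsX cabs_expi expr1n mul1r.
  rewrite cabsV lef_pV2 ?posrE ?subr_gt0//; first exact: expi_sub_ge.
  by rewrite (lt_le_trans _ (expi_sub_ge _ _))// subr_gt0.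
have M0 : 0 <= M := le_trans (cabs_ge0 _) (hM 0).
have it m : J' k = z ^+ m * J' (k + m)%N.
  elim: m => [|m ->]; first by rewrite expr0 mul1r addn0.
  by rewrite J'S exprSr -mulrA addnS.
have bd m : cabs (J' k) <= cabs z ^+ m * M.
  by rewrite (it m) cabsM cabsX ler_wpM2l ?exprn_ge0 ?cabs_ge0.
apply/eqP; rewrite -cabs_eq0 eq_le cabs_ge0 andbT.
have cv : cabs z ^+ m * M @[m --> \oo] --> 0 * M.
  by apply: cvgM; [apply: cvg_expr; rewrite ger0_norm ?cabs_ge0|exact: cvg_cst].
rewrite -[leRHS](mul0r M) -(cvg_lim _ cv)//.
by apply: limr_ge; [exact: cvgP cv|exact: nearW].
Qed.

Let JE k : J k.+1 = z ^+ k.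
Proof.
have J0 : J 0 = 0.
  by rewrite -(J'0 0); apply: amean_eq => t; rewrite !expr0 rmorph1.
elim: k => [|k IH]; first by rewrite JS J0 mulr0 addr0 expr0.
by rewrite JS IH add0r exprS.
Qed.

Definition szego_kernel t := (expi t + z) / (expi t - z).

Lemma szego_kernelE t : szego_kernel t = 1 + 2 * z * (expi t - z)^-1.
Proof.
by rewrite /szego_kernel; have := expi_sub_neq0 t z1; move: (expi t) => e h; field.
Qed.

Lemma angular_bounded_kernel : angular_bounded szego_kernel.
Proof.
have -> : szego_kernel = fun t => 1 + 2 * z * (expi t - z)^-1.
  by apply/funext => t; rewrite szego_kernelE.
apply: angular_boundedD; first exact: angular_bounded_cst.
by apply: angular_boundedM; [exact: angular_bounded_cst|exact: angular_bounded_cauchy].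
Qed.

Lemma kernel_expiX k : amean (fun t => szego_kernel t * expi t ^+ k) =
  if k is 0 then 1 else 2 * z ^+ k.
Proof.
have -> : amean (fun t => szego_kernel t * expi t ^+ k) = (k == 0)%:R + 2 * z * J k.
  rewrite -amean_expiX -ameanZ; last exact: angular_bounded_angular_int.
  rewrite -ameanD; first last.
  - exact/angular_intZ/angular_bounded_angular_int.
  - exact/angular_bounded_angular_int/angular_boundedX.
  by apply: amean_eq => t; rewrite szego_kernelE mulrDl mul1r -!mulrA [_^-1 * _]mulrC.
case: k => [|k]; last by rewrite JE add0r exprS mulrA.
have -> : J 0 = J' 0 by apply: amean_eq => t; rewrite !expr0 rmorph1.
by rewrite J'0 mulr0 addr0.
Qed.

Lemma kernel_expiXJ k : amean (fun t => szego_kernel t * (expi t ^+ k)^*) =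
  (k == 0)%:R.
Proof.
transitivity ((k == 0)%:R + 2 * z * J' k); last by rewrite J'0 mulr0 addr0.
have -> : (k == 0)%:R = amean (fun t => (expi t ^+ k)^* : R[i]).
  rewrite ameanJ; last exact/angular_bounded_angular_int/angular_boundedX.
  by rewrite amean_expiX rmorph_nat.
rewrite -ameanZ; last exact: angular_bounded_angular_int.
rewrite -ameanD; first last.
- exact/angular_intZ/angular_bounded_angular_int.
- exact/angular_bounded_angular_int/angular_boundedJ/angular_boundedX.
by apply: amean_eq => t; rewrite szego_kernelE mulrDl mul1r -!mulrA [_^-1 * _]mulrC.
Qed.

Lemma schwarz_formula (P : {poly R[i]}) : complex.Im P`_0 = 0 ->
  amean (fun t => szego_kernel t * (complex.Re P.[expi t])%:C) = P.[z].
Proof.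
move=> P0.
have bk k : angular_int (fun t => szego_kernel t * expi t ^+ k).
  apply/angular_bounded_angular_int/angular_boundedM; first exact: angular_bounded_kernel.
  exact: angular_boundedX.
have bk' k : angular_int (fun t => szego_kernel t * (expi t ^+ k)^*).
  apply/angular_bounded_angular_int/angular_boundedM; first exact: angular_bounded_kernel.
  exact/angular_boundedJ/angular_boundedX.
rewrite (@amean_eq _ _ (fun t => \sum_(k < size P) (P`_k / 2 * (szego_kernel t * expi t ^+ k) +
   (P`_k)^* / 2 * (szego_kernel t * (expi t ^+ k)^*)))); last first.
  move=> t; have -> : (complex.Re P.[expi t])%:C = (P.[expi t] + P.[expi t]^*) / 2.
    exact: ReJ_add.
  rewrite horner_coef rmorph_sum -big_split/= mulr_suml mulr_sumr.
  by apply: eq_bigr => k _; rewrite rmorphM /=; field.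
rewrite amean_sum; last first.
  by move=> k; apply: angular_intD; exact: angular_intZ.
rewrite horner_coef; apply: eq_bigr => k _.
rewrite ameanD; [|exact: angular_intZ..].
rewrite !ameanZ// kernel_expiX kernel_expiXJ.
case: k => [[|k] ki] /=; last by field.
have -> : (P`_0)^* = P`_0.
  by apply: complexP; rewrite ?cReJ ?cImJ// P0 oppr0.
by rewrite expr0 mulr1; field.
Qed.

End AngularFunctions.

(** * Polynomial logarithms on the closed disc *)

Section ExponentialEstimates.
Variable R : realType.
Implicit Types (a b : R) (y z : R[i]).

Lemma mvt_from0 (f df : R -> R) (b K : R) :
  (forall x : R, is_derive x 1 f (df x)) ->
  (forall x, `|x| <= `|b| -> `|df x| <= K) -> `|f b - f 0| <= K * `|b|.
Proof.
move=> hf hK.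
have cf : continuous f.
  by move=> t; apply: differentiable_continuous; apply/derivable1_diffP;
    have := hf t; case.
have [b0|b0|->] := ltgtP b 0; last by rewrite subrr !normr0 mulr0.
- have [|c] := @MVT R f df b 0 b0 (fun x _ => hf x).
    exact: continuous_subspaceT.
  rewrite in_itv/= => /andP[bc c0] E; rewrite distrC E sub0r normrM normrN.
  rewrite ler_wpM2r// hK// !ltr0_norm// lerN2 ltW//.
- have [|c] := @MVT R f df 0 b b0 (fun x _ => hf x).
    exact: continuous_subspaceT.
  rewrite in_itv/= => /andP[c0 cb] E; rewrite E subr0 normrM.
  by rewrite ler_wpM2r// hK// !gtr0_norm// ltW.
Qed.

Lemma sin_bound b : `|sin b| <= `|b|.
Proof.
have := @mvt_from0 sin cos b 1 (@is_derive_sin R).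
rewrite sin0 subr0 mul1r; apply=> x _.
by rewrite ler_norml cos_geN1 cos_le1.
Qed.

Lemma cos_bound b : `|cos b - 1| <= b ^+ 2.
Proof.
have := @mvt_from0 cos (fun x => - sin x) b `|b| (@is_derive_cos R).
rewrite cos0 -expr2 real_normK ?num_real//; apply=> x xb.
by rewrite normrN; exact: le_trans (sin_bound x) xb.
Qed.

Lemma sin_sub_bound b : `|sin b - b| <= b ^+ 2 * `|b|.
Proof.
have hd (x : R) : is_derive x 1 (fun t => sin t - t) (cos x - 1).
  exact: (is_deriveB (is_derive_sin x) (is_derive_id x 1)).
have := @mvt_from0 _ _ b (b ^+ 2) hd; rewrite sin0 subr0 subr0; apply=> x xb.
apply: le_trans (cos_bound x) _.
by rewrite -[leLHS]real_normK ?num_real// -[leRHS]real_normK ?num_real// ler_pXn2r ?nnegrE.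
Qed.

(** The inequality [1 + x <= exp x] at [- a] gives [exp a * (1 - a) <= 1], a quadratic upper bound
    as long as [1 - a >= 1/2]. *)
Lemma expR_bound a : `|a| <= 2^-1 -> `|expR a - 1 - a| <= 2 * a ^+ 2.
Proof.
rewrite ler_norml => /andP[a1 a2].
have h1 := expR_ge1Dx a; have h2 := expR_ge1Dx (- a).
have h3 : expR a * expR (- a) = 1 by rewrite -expRD subrr expR0.
have h4 := expR_gt0 a; have := sqr_ge0 a.
rewrite expr2 => h5; rewrite ger0_norm; last by lra.
have : expR a * (1 - a) <= expR a * expR (- a) by rewrite ler_pM2l.
rewrite h3.
nra.
Qed.

Lemma cexp_bound y : cabs y <= 2^-1 -> cabs (cexp y - 1 - y) <= 4 * cabs y ^+ 2.
Proof.
move=> y1; rewrite cabs_sqr.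
have ya := le_trans (cabs_Re y) y1; have yb := le_trans (cabs_Im y) y1.
apply: le_trans (cabs_ReIm _) _; rewrite !cReB !cImB /cexp cReMr cImMr /= subr0.
move: (complex.Re y) (complex.Im y) ya yb => a b ya yb.
have ha := expR_bound ya; have hs := sin_bound b; have hc := cos_bound b.
have hd := sin_sub_bound b.
have e2 : expR a <= 2.
  by move: ha ya; rewrite !ler_norml => /andP[_ h] /andP[k l]; nra.
have e0 := expR_gt0 a.
have e1 : `|expR a - 1| <= 2 * `|a|.
  have -> : expR a - 1 = (expR a - 1 - a) + a by ring.
  apply: le_trans (ler_normD _ _) _.
  have : a ^+ 2 = `|a| ^+ 2 by rewrite real_normK ?num_real.
  by have := normr_ge0 a; move: ha ya; move: `|_| `|a| => u v *; nra.
have -> : expR a * cos b - 1 - a = (expR a - 1 - a) + expR a * (cos b - 1) by ring.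
have -> : expR a * sin b - b = (expR a - 1) * sin b + (sin b - b) by ring.
have := ler_normD (expR a - 1 - a) (expR a * (cos b - 1)).
have := ler_normD ((expR a - 1) * sin b) (sin b - b).
rewrite !normrM (ger0_norm (ltW e0)).
have k1 : expR a * `|cos b - 1| <= 2 * b ^+ 2.
  by apply: ler_pM => //; exact: ltW.
have k2 : `|expR a - 1| * `|sin b| <= 2 * `|a| * `|b| by apply: ler_pM.
have k3 : b ^+ 2 * `|b| <= b ^+ 2 / 2 by rewrite ler_wpM2l ?sqr_ge0.
have k4 : 2 * `|a| * `|b| <= a ^+ 2 + b ^+ 2.
  rewrite -[a ^+ 2]real_normK ?num_real// -[b ^+ 2]real_normK ?num_real//.
  by have := sqr_ge0 (`|a| - `|b|); nra.
by have := sqr_ge0 a; have := sqr_ge0 b; lra.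
Qed.

Lemma cexp_sub1_bound y : cabs y <= 2^-1 -> cabs (cexp y - 1) <= 3 * cabs y.
Proof.
move=> y1; have := cexp_bound y1.
have := ler_cabsD (cexp y - 1 - y) y; rewrite subrK.
by have := cabs_ge0 y; nra.
Qed.

(** First-order terms cancel in [exp y * (1 - y)]; the quadratic error is what allows many such
    factors to be multiplied. *)
Lemma cexp_mul_bound y : cabs y <= 2^-1 ->
  cabs (cexp y * (1 - y) - 1) <= 7 * cabs y ^+ 2.
Proof.
move=> y1; have h := cexp_bound y1.
have -> : cexp y * (1 - y) - 1 = (cexp y - 1 - y) * (1 - y) - y * y by ring.
apply: le_trans (ler_cabsB _ _) _; rewrite !cabsM.
have k : cabs (1 - y) <= 3 / 2 by have := ler_cabsB 1 y; rewrite cabs1; lra.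
have : cabs (cexp y - 1 - y) * cabs (1 - y) <= (4 * cabs y ^+ 2) * (3 / 2).
  by apply: ler_pM; rewrite ?cabs_ge0.
by rewrite -expr2; lra.
Qed.

Lemma mul_near1 (x y : R[i]) (s t : R) : cabs (x - 1) <= s -> cabs (y - 1) <= t ->
  cabs (x * y - 1) <= s + t + s * t.
Proof.
move=> xs yt.
have -> : x * y - 1 = (x - 1) + (y - 1) + (x - 1) * (y - 1) by ring.
apply: le_trans (ler_cabsD _ _) _; rewrite cabsM lerD//.
  by apply: le_trans (ler_cabsD _ _) _; exact: lerD.
by apply: ler_pM; rewrite ?cabs_ge0.
Qed.

Lemma prod_near1 (u : nat -> R[i]) (M : nat) (s : R) : 2 * (M%:R * s) <= 1 ->
  (forall m, cabs (u m - 1) <= s) ->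
  cabs (\prod_(m < M) u m - 1) <= 2 * (M%:R * s).
Proof.
move=> hs hu; have s0 := le_trans (cabs_ge0 _) (hu 0).
elim: M hs => [|M IH] hs.
  by rewrite big_ord0 subrr cabs0 mul0r mulr0.
move: hs; rewrite -natr1 => hs; rewrite big_ord_recr/=.
have Ms : 0 <= M%:R * s by rewrite mulr_ge0.
have h : 2 * (M%:R * s) <= 1 by move: hs; nra.
by have := mul_near1 (IH h) (hu M); have := ler_wpM2r s0 h; lra.
Qed.

End ExponentialEstimates.

Section DiscApproximation.
Variable R : realType.
Implicit Types (f g : R[i] -> R[i]).

(** Membership in the disc algebra, up to values outside the closed disc. Uniform approximation by
    polynomials stands in for analyticity. *)
Definition disc_approx g := forall e : R, 0 < e ->
  exists P : {poly R[i]}, forall z, cabs z <= 1 -> cabs (g z - P.[z]) <= e.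

Lemma disc_approx_poly (P : {poly R[i]}) : disc_approx (fun z => P.[z]).
Proof. by move=> e e0; exists P => z _; rewrite subrr cabs0 ltW. Qed.

Lemma eq_disc_approx f g : f =1 g -> disc_approx f -> disc_approx g.
Proof. by move=> /funext ->. Qed.

Lemma disc_approx_cst (c : R[i]) : disc_approx (fun=> c).
Proof. by move=> e e0; exists c%:P => z _; rewrite hornerC subrr cabs0 ltW. Qed.

Lemma disc_approx_bounded g : disc_approx g ->
  exists2 M : R, 0 < M & forall z, cabs z <= 1 -> cabs (g z) <= M.
Proof.
move=> /(_ 1 ltr01)[P hP]; exists (1 + \sum_(i < size P) cabs P`_i).
  by rewrite ltr_pwDl// sumr_ge0// => i _; exact: cabs_ge0.
move=> z z1; rewrite -[g z](subrK P.[z]); apply: le_trans (ler_cabsD _ _) _.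
by rewrite lerD ?hP// cabs_horner_le.
Qed.

Lemma disc_approxD f g : disc_approx f -> disc_approx g ->
  disc_approx (fun z => f z + g z).
Proof.
move=> hf hg e e0; have e2 : 0 < e / 2 by rewrite divr_gt0.
have [P hP] := hf _ e2; have [Q hQ] := hg _ e2; exists (P + Q) => z z1.
rewrite hornerD opprD addrACA (splitr e).
by apply: le_trans (ler_cabsD _ _) _; rewrite lerD ?hP ?hQ.
Qed.

Lemma disc_approxM f g : disc_approx f -> disc_approx g ->
  disc_approx (fun z => f z * g z).
Proof.
move=> hf hg e e0.
have [M M0 hM] := disc_approx_bounded hf.
have [|Q hQ] := hg (e / 2 / M); first by rewrite !divr_gt0.
have [N N0 hN] := disc_approx_bounded (disc_approx_poly Q).
have [|P hP] := hf (e / 2 / N); first by rewrite !divr_gt0.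
exists (P * Q) => z z1; rewrite hornerM.
have -> : f z * g z - P.[z] * Q.[z] = f z * (g z - Q.[z]) + (f z - P.[z]) * Q.[z] by ring.
apply: le_trans (ler_cabsD _ _) _; rewrite !cabsM (splitr e) lerD//.
  apply: (@le_trans _ _ (M * (e / 2 / M))).
    by apply: ler_pM; rewrite ?cabs_ge0 ?hM ?hQ.
  by rewrite mulrCA mulfV ?mulr1// gt_eqF.
apply: (@le_trans _ _ (e / 2 / N * N)).
  by apply: ler_pM; rewrite ?cabs_ge0 ?hP ?hN.
by rewrite mulfVK// gt_eqF.
Qed.

Lemma disc_approx_sum I (r : seq I) (F : I -> R[i] -> R[i]) :
  (forall i, disc_approx (F i)) -> disc_approx (fun z => \sum_(i <- r) F i z).
Proof.
move=> hF; elim: r => [|i r IH].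
  by under eq_fun do rewrite big_nil; exact: disc_approx_cst.
by under eq_fun do rewrite big_cons; exact: disc_approxD.
Qed.

Lemma sub1_ge (b z : R[i]) : cabs z <= 1 -> 1 - cabs b <= cabs (1 - b * z).
Proof.
move=> z1; apply: le_trans (lerB_cabs _ _); rewrite cabs1 lerB// cabsM.
by rewrite ler_piMr ?cabs_ge0.
Qed.

Lemma sub1_neq0 (b z : R[i]) : cabs b < 1 -> cabs z <= 1 -> 1 - b * z != 0.
Proof.
move=> b1 z1; rewrite -cabs_gt0; apply: lt_le_trans (sub1_ge b z1).
by rewrite subr_gt0.
Qed.

Lemma disc_approx_geo (b : R[i]) : cabs b < 1 ->
  disc_approx (fun z => (1 - b * z)^-1).
Proof.
move=> b1 e e0; have b0 := cabs_ge0 b; have d0 : 0 < 1 - cabs b by rewrite subr_gt0.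
have [N hN] : exists N, cabs b ^+ N <= e * (1 - cabs b).
  have : cabs b ^+ n @[n --> \oo] --> 0.
    by apply: cvg_expr; rewrite ger0_norm.
  move=> /cvgrPdist_le/(_ _ (mulr_gt0 e0 d0))[N _ h].
  exists N; have := h N (leqnn _); rewrite sub0r normrN.
  by rewrite ger0_norm ?exprn_ge0.
exists (\sum_(i < N) (b *: 'X) ^+ i) => z z1.
have nz := sub1_neq0 b1 z1.
have E : (1 - b * z) * (\sum_(i < N) (b *: 'X) ^+ i).[z] = 1 - (b * z) ^+ N.
  rewrite horner_sum; under eq_bigr do rewrite horner_exp hornerZ hornerX.
  have -> : 1 - (b * z) ^+ N = - ((b * z) ^+ N - 1) by ring.
  by rewrite subrX1; ring.
have -> : (1 - b * z)^-1 - (\sum_(i < N) (b *: 'X) ^+ i).[z] = (b * z) ^+ N / (1 - b * z).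
  apply: (mulfI nz); rewrite mulrBr mulfV// E [RHS]mulrC mulfVK//; by ring.
rewrite cabs_div cabsX cabsM ler_pdivrMr ?cabs_gt0//.
apply: (@le_trans _ _ (cabs b ^+ N)).
  by rewrite lerXn2r ?nnegrE ?mulr_ge0 ?cabs_ge0// ler_piMr.
apply: le_trans hN _; rewrite ler_wpM2l ?(ltW e0)//; exact: sub1_ge.
Qed.

Lemma disc_approx_at0 g : disc_approx g -> forall e : R, 0 < e ->
  exists P : {poly R[i]}, P.[0] = g 0 /\
    forall z, cabs z <= 1 -> cabs (g z - P.[z]) <= e.
Proof.
move=> hg e e0; have [|P hP] := hg (e / 2); first by rewrite divr_gt0.
exists (P + (g 0 - P.[0])%:P); split.
  by rewrite hornerD hornerC addrC subrK.
move=> z z1; rewrite hornerD hornerC.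
have -> : g z - (P.[z] + (g 0 - P.[0])) = (g z - P.[z]) - (g 0 - P.[0]) by ring.
apply: le_trans (ler_cabsB _ _) _; rewrite (splitr e) lerD ?hP//.
by rewrite cabs0.
Qed.

(* [1 - b z] is the product over [m < M] of the factors [1 - y_m], with
   [y_m = (b / M) z / (1 - (m b / M) z)] of size [O (1 / M)], so that
   [exp (\sum_m y_m) (1 - b z) = 1 + O (1 / M)]. *)
Lemma log_factor (b : R[i]) : cabs b < 1 -> forall e : R, 0 < e ->
  exists q : {poly R[i]}, q.[0] = 0 /\ forall z, cabs z <= 1 ->
    cabs (cexp q.[z] * (1 - b * z) - 1) <= e.
Proof.
move=> b1 e e0; set d := 1 - cabs b.
have d0 : 0 < d by rewrite subr_gt0.
(* Every [y_m] will be at most [(M d)^-1], one factor is then off by [7 (M d)^-2], and [prod_near1]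
   doubles the sum of the [M] errors. Each summand of [A] below secures one of the three
   inequalities. *)
have [M [M0 Md Me M1]] : exists M : nat, [/\ (0 < M)%N, 2^-1 >= (M%:R * d)^-1 ,
   2 * (M%:R * (7 * (M%:R * d)^-1 ^+ 2)) <= e / 4 &
   2 * (M%:R * (7 * (M%:R * d)^-1 ^+ 2)) <= 1].
  pose A := 2 / d + 14 / d ^+ 2 * (4 / e) + 14 / d ^+ 2.
  have h1 : 0 < 2 / d by rewrite divr_gt0.
  have h2 : 0 < 14 / d ^+ 2 by rewrite divr_gt0// exprn_gt0.
  have h3 : 0 < 14 / d ^+ 2 * (4 / e) by rewrite mulr_gt0// divr_gt0.
  have A0 : 0 <= A by rewrite /A; lra.
  have [M AM] : exists M : nat, A < M%:R.
    by exists (Num.bound A); have := archi_boundP A0.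
  have M0 : 0 < M%:R :> R by apply: le_lt_trans A0 AM.
  have E : 2 * (M%:R * (7 * (M%:R * d)^-1 ^+ 2)) = (14 / d ^+ 2) / M%:R.
    by field; rewrite !gt_eqF.
  exists M; split; first by rewrite -(ltr0n R).
  - rewrite lef_pV2 ?posrE ?mulr_gt0// -ler_pdivrMr//.
    by rewrite /A in AM; lra.
  - rewrite E ler_pdivrMr// [leRHS]mulrC -ler_pdivrMr ?divr_gt0// invf_div.
    by rewrite /A in AM; lra.
  - by rewrite E ler_pdivrMr// mul1r; rewrite /A in AM; lra.
have MR : M%:R != 0 :> R[i] by rewrite pnatr_eq0 -lt0n.
have M0R : 0 < M%:R :> R by rewrite ltr0n.
pose c m := (m%:R / M%:R) * b.
have cM m : (m <= M)%N -> cabs (c m) <= cabs b.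
  move=> mM; rewrite /c cabsM ler_piMl ?cabs_ge0// cabs_div.
  have cn k : cabs (k%:R : R[i]) = k%:R.
    by rewrite -(rmorph_nat (real_complex R)) cabsC ger0_norm.
  by rewrite !cn ler_pdivrMr// mul1r ler_nat.
(* [prod_near1] wants its bound for every index, whereas [c m] need not stay in the disc beyond [M];
   the default 0 gives the neutral factor 1. *)
pose y m z := if (m <= M)%N then b / M%:R * z / (1 - c m * z) else 0.
have cb m : (m <= M)%N -> cabs (c m) < 1 by move=> /cM h; exact: le_lt_trans b1.
have cMR : cabs (M%:R : R[i]) = M%:R.
  by rewrite -(rmorph_nat (real_complex R)) cabsC ger0_norm.
have yb m z : cabs z <= 1 -> cabs (y m z) <= (M%:R * d)^-1.
  move=> z1; rewrite /y; case: ifP => mM; last first.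
    by rewrite cabs0 invr_ge0 mulr_ge0// ltW.
  rewrite invfM !cabsM !cabsV cMR; apply: ler_pM.
  - by rewrite !mulr_ge0 ?cabs_ge0// invr_ge0.
  - by rewrite invr_ge0 cabs_ge0.
  - rewrite mulrAC ler_piMl ?invr_ge0// mulr_ile1 ?cabs_ge0//; exact: ltW.
  - rewrite lef_pV2 ?posrE//; last by rewrite cabs_gt0 sub1_neq0 ?cb.
    apply: le_trans (sub1_ge _ z1); rewrite lerB//; exact: cM.
(* Telescoping: [1 - y m z] is the quotient of [1 - c m.+1 * z] by [1 - c m * z]. *)
have prodE z k : cabs z <= 1 -> (k <= M)%N ->
    \prod_(m < k) (1 - y m z) = 1 - c k * z.
  move=> z1; elim: k => [|k IH] kM.
    by rewrite big_ord0 /c mul0r mul0r mul0r subr0.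
  rewrite big_ord_recr/= IH ?(ltnW kM)// /y (ltnW kM).
  have h := sub1_neq0 (cb _ (ltnW kM)) z1.
  move: h; rewrite /c -natr1; move: (M%:R : R[i]) MR (k%:R : R[i]) => N N0 K h.
  have h' : N - K * b * z != 0.
    have -> : N - K * b * z = N * (1 - K / N * b * z) by field.
    exact: mulf_neq0.
  by field; rewrite N0 ?h'.
pose g z := \sum_(m < M) y m z.
have gE z : cabs z <= 1 ->
    cexp (g z) * (1 - b * z) = \prod_(m < M) (cexp (y m z) * (1 - y m z)).
  move=> z1; rewrite big_split/= prodE// /g cexp_sum; congr (_ * (1 - _ * _)).
  by rewrite /c divff// mul1r.
have g0 : g 0 = 0.
  rewrite /g big1// => m _; rewrite /y; case: ifP => // _.
  by rewrite mulr0 mul0r.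
have ag : disc_approx g.
  apply: disc_approx_sum => m e' e'0.
  have [P hP] : exists P : {poly R[i]}, forall z, cabs z <= 1 ->
     cabs (b / M%:R * z / (1 - c m * z) - P.[z]) <= e'.
    have := disc_approxM (disc_approx_poly ((b / M%:R) *: 'X)) (disc_approx_geo (cb m (ltnW (ltn_ord m)))).
    move=> /(_ _ e'0)[P hP]; exists P => z z1; have := hP z z1.
    by rewrite hornerZ hornerX.
  by exists P => z z1; rewrite /y (ltnW (ltn_ord m)) hP.
(* Replacing [g] by [q] costs a factor within [3 e'] of 1, that is [e / 4]; the bound 1/12 absorbs
   the cross term with the other error [e / 4]. *)
pose e' := Num.min (e / 12) (12^-1).
have e'0 : 0 < e' by rewrite lt_min divr_gt0//= invr_gt0.
have [q [q0 hq]] := disc_approx_at0 ag e'0.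
exists q; split; first by rewrite q0.
move=> z z1; have h1 : cabs (\prod_(m < M) (cexp (y m z) * (1 - y m z)) - 1) <= e / 4.
  apply: le_trans Me.
  apply: (@prod_near1 _ (fun m => cexp (y m z) * (1 - y m z))) => // m.
  have ym := yb m z z1.
  apply: le_trans (cexp_mul_bound (le_trans ym Md)) _.
  rewrite ler_wpM2l// lerXn2r ?nnegrE ?cabs_ge0//.
  by rewrite invr_ge0 mulr_ge0// ltW.
have h2 : cabs (cexp (q.[z] - g z) - 1) <= 3 * e'.
  have h := hq z z1; rewrite cabs_distC in h.
  have e12 : e' <= 12^-1 by rewrite ge_min lexx orbT.
  apply: le_trans (cexp_sub1_bound _) _; first by lra.
  by rewrite ler_wpM2l.
have -> : cexp q.[z] * (1 - b * z) = cexp (q.[z] - g z) * (cexp (g z) * (1 - b * z)).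
  by rewrite mulrA -cexpD subrK.
rewrite gE//; apply: le_trans (mul_near1 h2 h1) _.
have : e' <= e / 12 by rewrite ge_min lexx.
have : e' <= 12^-1 by rewrite ge_min lexx orbT.
by nra.
Qed.

Lemma log_prod (bs : seq R[i]) : all (fun b => cabs b < 1) bs ->
  forall e : R, 0 < e ->
  exists q : {poly R[i]}, q.[0] = 0 /\ forall z, cabs z <= 1 ->
    cabs (cexp q.[z] * (\prod_(b <- bs) (1 - b * z)) - 1) <= e.
Proof.
elim: bs => [|b bs IH] /= => [_|/andP[b1 bs1]] e e0.
  exists 0; split; first by rewrite horner0.
  by move=> z _; rewrite horner0 cexp0 big_nil mul1r subrr cabs0 ltW.
pose e' := Num.min (e / 3) 1.
have e'0 : 0 < e' by rewrite lt_min divr_gt0/=.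
have [q1 [q10 h1]] := log_factor b1 e'0; have [q2 [q20 h2]] := IH bs1 _ e'0.
exists (q1 + q2); split; first by rewrite hornerD q10 q20 addr0.
move=> z z1; rewrite hornerD cexpD big_cons mulrACA.
apply: le_trans (mul_near1 (h1 z z1) (h2 z z1)) _.
have : e' <= e / 3 by rewrite ge_min lexx.
have : e' <= 1 by rewrite ge_min lexx orbT.
by nra.
Qed.

(** The roots lie outside the closed disc and the [b] are their inverses; the normalization at 0
    absorbs the leading coefficient. *)
Lemma nonvanishing_factor (P : {poly R[i]}) : P.[0] = 1 ->
  (forall z, cabs z <= 1 -> P.[z] != 0) ->
  exists2 bs : seq R[i], all (fun b => cabs b < 1) bs &
    forall z, P.[z] = \prod_(b <- bs) (1 - b * z).
Proof.
move=> P0 Pn; have [rs Prs] := closed_field_poly_normal P.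
have rout r : r \in rs -> 1 < cabs r.
  move=> rr; rewrite ltNge; apply/negP => /Pn /eqP; apply.
  rewrite Prs hornerZ; apply/eqP; rewrite mulf_eq0; apply/orP; right.
  by rewrite -/(root _ _) root_prod_XsubC.
exists [seq r^-1 | r <- rs].
  apply/allP => _ /mapP[r rr ->]; rewrite cabsV invf_lt1 ?rout//.
  by apply: lt_trans (rout r rr).
have E z : P.[z] = lead_coef P * \prod_(r <- rs) (z - r).
  by rewrite {1}Prs hornerZ horner_prod; congr (_ * _); apply: eq_bigr => r _; rewrite hornerXsubC.
move=> z; rewrite big_map -[RHS]mul1r -{1}P0 !E -mulrA; congr (_ * _).
rewrite -big_split/= big_seq [RHS]big_seq; apply: eq_bigr => r rr.
have : r != 0 by rewrite -cabs_gt0; apply: lt_trans (rout r rr).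
by move=> r0; field.
Qed.

(** [q] approximates the branch of [- log P] vanishing at 0, and no branch of the logarithm has to
    be constructed. *)
Lemma log_poly (P : {poly R[i]}) : P.[0] = 1 ->
  (forall z, cabs z <= 1 -> P.[z] != 0) -> forall e : R, 0 < e ->
  exists q : {poly R[i]}, q.[0] = 0 /\ forall z, cabs z <= 1 ->
    cabs (cexp q.[z] * P.[z] - 1) <= e.
Proof.
move=> P0 Pn e e0; have [bs bs1 E] := nonvanishing_factor P0 Pn.
have [q [q0 hq]] := log_prod bs1 e0.
by exists q; split=> // z z1; rewrite E; exact: hq.
Qed.

Lemma disc_approx_inv (P : {poly R[i]}) : P.[0] = 1 ->
  (forall z, cabs z <= 1 -> P.[z] != 0) -> disc_approx (fun z => P.[z]^-1).
Proof.
move=> P0 Pn; have [bs bs1 E] := nonvanishing_factor P0 Pn.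
suff h : disc_approx (fun z => (\prod_(b <- bs) (1 - b * z))^-1).
  by apply: eq_disc_approx h => z; rewrite E.
elim: bs bs1 {E} => [|b bs IH] /= => [_|/andP[b1 bs1]].
  by apply: eq_disc_approx (disc_approx_cst 1) => z; rewrite big_nil invr1.
apply: eq_disc_approx (disc_approxM (disc_approx_geo b1) (IH bs1)) => z.
by rewrite big_cons invfM.
Qed.

Lemma amean_horner (P : {poly R[i]}) : amean (fun t => P.[expi t]) = P.[0].
Proof.
have bX k : angular_int (fun t => expi t ^+ k : R[i]).
  exact/angular_bounded_angular_int/angular_boundedX.
rewrite (@amean_eq _ _ (fun t => \sum_(k < size P) P`_k * expi t ^+ k)); last first.
  by move=> t; rewrite horner_coef.
rewrite amean_sum; last by move=> k; exact: angular_intZ.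
rewrite horner_coef; apply: eq_bigr => k _.
by rewrite ameanZ// amean_expiX expr0n.
Qed.

(** The mean value property is exact for polynomials, power by power, and survives uniform
    approximation. *)
Lemma amean_disc_approx g : disc_approx g -> angular_int (fun t => g (expi t)) ->
  amean (fun t => g (expi t)) = g 0.
Proof.
move=> hg ig; apply/eqP; rewrite -subr_eq0 -cabs_eq0 eq_le cabs_ge0 andbT.
apply/ler_addgt0Pr => e e0; rewrite add0r.
have [P [P0 hP]] := disc_approx_at0 hg e0.
rewrite -P0 -amean_horner.
have iP : angular_int (fun t => P.[expi t]).
  exact/angular_bounded_angular_int/angular_bounded_horner.
have -> : amean (fun t => g (expi t)) - amean (fun t => P.[expi t]) =
   amean (fun t => g (expi t) + -1 * P.[expi t]).
  by rewrite ameanD ?ameanZ ?mulN1r//; exact: angular_intZ.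
apply: amean_bound; first by apply: angular_intD => //; exact: angular_intZ.
by move=> t; rewrite mulN1r hP// cabs_expi.
Qed.

End DiscApproximation.

(** * Bernstein-Szego weights *)

Section RealMean.
Variable R : realType.
Notation leb := (@lebesgue_measure R).
Notation arcI := (`[0%R, (2 * pi)%R]%classic : set R).

Definition rmean (f : R -> R) : R := (2 * pi)^-1 * \int[leb]_(t in arcI) f t.

Definition rint (f : R -> R) := leb.-integrable arcI (EFin \o f).

Lemma rmean_Re (f : R -> R[i]) : rmean (fun t => complex.Re (f t)) = complex.Re (amean f).
Proof. by rewrite /amean cReMr. Qed.

Lemma rmean_real (f : R -> R) : amean (fun t => (f t)%:C) = (rmean f)%:C.
Proof.
apply: complexP; first by rewrite -rmean_Re.
by rewrite /amean cImMr /= /Rintegral integral0 mulr0.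
Qed.

Lemma eq_rmean f g : f =1 g -> rmean f = rmean g.
Proof. by move=> fg; rewrite /rmean; congr (_ * _); apply: eq_Rintegral => t _. Qed.

Lemma rintD f g : rint f -> rint g -> rint (fun t => f t + g t).
Proof. by move=> hf hg; exact: (integrableDR (@measurable_arcI R) hf hg). Qed.

Lemma rintB f g : rint f -> rint g -> rint (fun t => f t - g t).
Proof. by move=> hf hg; exact: (integrableBR (@measurable_arcI R) hf hg). Qed.

Lemma rintZ c f : rint f -> rint (fun t => c * f t).
Proof. by move=> hf; exact: (integrableZlR (@measurable_arcI R) c hf). Qed.

Lemma rint_cst c : rint (fun=> c).
Proof.
rewrite /rint; apply: (integrable_bounded (@measurable_arcI R) _ _ (M := `|c|)) => //.
exact: leb_arcI_fin.
Qed.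

Lemma rmeanD f g : rint f -> rint g -> rmean (fun t => f t + g t) = rmean f + rmean g.
Proof. by move=> hf hg; rewrite /rmean (RintegralD (@measurable_arcI R) hf hg) mulrDr. Qed.

Lemma rmeanB f g : rint f -> rint g -> rmean (fun t => f t - g t) = rmean f - rmean g.
Proof. by move=> hf hg; rewrite /rmean (RintegralB (@measurable_arcI R) hf hg) mulrBr. Qed.

Lemma rmeanZ c f : rint f -> rmean (fun t => c * f t) = c * rmean f.
Proof. by move=> hf; rewrite /rmean (RintegralZl c (@measurable_arcI R) hf) mulrCA. Qed.

Lemma rmean_cst c : rmean (fun=> c) = c.
Proof. by apply: complexI; rewrite -rmean_real amean_cst. Qed.

Lemma le_rmean f g : rint f -> rint g -> (forall t, f t <= g t) -> rmean f <= rmean g.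
Proof.
move=> hf hg fg; rewrite /rmean ler_wpM2l ?invr_ge0 ?(ltW (twopi_gt0 R))//.
exact: (le_Rintegral (@measurable_arcI R) hf hg).
Qed.

Lemma rmean_norm_le f g : rint f -> rint g -> (forall t, `|f t| <= g t) ->
  `|rmean f| <= rmean g.
Proof.
move=> hf hg fg; rewrite ler_norml; apply/andP; split.
  have -> : - rmean g = rmean (fun t => -1 * g t) by rewrite rmeanZ// mulN1r.
  apply: le_rmean => //; first exact: rintZ.
  by move=> t; have := fg t; rewrite ler_norml mulN1r => /andP[].
apply: le_rmean => // t.
by have := fg t; rewrite ler_norml => /andP[].
Qed.

Lemma rmean_dist f g e : rint f -> rint g -> (forall t, `|f t - g t| <= e) ->
  `|rmean f - rmean g| <= e.
Proof.
move=> hf hg fg; rewrite -rmeanB// -[leRHS]rmean_cst.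
by apply: rmean_norm_le; [exact: rintB|exact: rint_cst|].
Qed.

Lemma rint_bounded f M : @measurable_fun _ _ (measurableTypeR R) R arcI f ->
  (forall t, `|f t| <= M) -> rint f.
Proof.
move=> mf fM; rewrite /rint; apply: (integrable_bounded (@measurable_arcI R) _ mf (M := M)).
  exact: leb_arcI_fin.
by move=> t _; exact: fM.
Qed.

Lemma rmean_Re_horner (P : {poly R[i]}) :
  rint (fun t => complex.Re P.[expi t]) /\
  rmean (fun t => complex.Re P.[expi t]) = complex.Re P.[0].
Proof.
split; last by rewrite rmean_Re amean_horner.
by have [] := angular_bounded_angular_int (angular_bounded_horner P).
Qed.

Lemma ln_sub1 (x : R) : 0 < x -> ln x <= x - 1.
Proof. by move=> x0; rewrite -{1}(subrK 1 x) addrC le_ln1Dx//; lra. Qed.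

Lemma ln_near1 (x e : R) : 0 <= e <= 2^-1 -> `|x - 1| <= e -> `|ln x| <= 2 * e.
Proof.
move=> /andP[e0 e1]; rewrite ler_norml => /andP[x1 x2].
have x0 : 0 < x by lra.
have h1 := ln_sub1 x0.
rewrite ler_norml; apply/andP; split; last by lra.
have : ln x^-1 <= x^-1 - 1 by apply: ln_sub1; rewrite invr_gt0.
rewrite lnV ?posrE//; have : x^-1 <= 1 + 2 * e; last by lra.
rewrite -[x^-1]mul1r ler_pdivrMr//; nra.
Qed.

End RealMean.

Section SecondKind.
Variables (R : realType) (F S : nat -> {poly R[i]}) (alpha : nat -> R[i]) (nu : nat -> R).
Hypotheses (F0 : forall z, (F 0).[z] = 1) (S0 : forall z, (S 0).[z] = 1)
  (FS : forall n z, (F n.+1).[z] = z * (F n).[z] - (alpha n)^* * (S n).[z])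
  (SS : forall n z, (S n.+1).[z] = (S n).[z] - alpha n * (z * (F n).[z]))
  (alpha1 : forall n, cabs (alpha n) < 1)
  (nu0 : nu 0 = 1) (nuS : forall n, nu n.+1 = (1 - cabs (alpha n) ^+ 2) * nu n).
Notation arcI := (`[0%R, (2 * pi)%R]%classic : set R).

Lemma nu_pos n : 0 < nu n.
Proof.
elim: n => [|n IH]; first by rewrite nu0.
by rewrite nuS mulr_gt0// subr_gt0 expr_lt1 ?cabs_ge0.
Qed.

Lemma S_neq0 n z : cabs z <= 1 -> (S n).[z] != 0.
Proof. exact: (@star_neq0 R alpha (fun n z => (F n).[z]) (fun n z => (S n).[z])). Qed.

Lemma S_at0 n : (S n).[0] = 1.
Proof. by elim: n => [|n IH]; rewrite ?S0// SS mul0r mulr0 subr0. Qed.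

(** The second-kind polynomial and its reversal, that is the Szego recursion with [- alpha] for
    [alpha]. *)
Fixpoint second_kind n : {poly R[i]} * {poly R[i]} :=
  if n is m.+1 then
    let: (A, B) := second_kind m in
    ('X * A + (alpha m)^* *: B, B + alpha m *: ('X * A))
  else (1, 1).

Lemma second_kindS n z :
  (second_kind n.+1).1.[z] = z * (second_kind n).1.[z] + (alpha n)^* * (second_kind n).2.[z] /\
  (second_kind n.+1).2.[z] = (second_kind n).2.[z] + alpha n * (z * (second_kind n).1.[z]).
Proof.
by rewrite /=; case: (second_kind n) => A B /=; rewrite !hornerE.
Qed.

Lemma reversed_pairs n z : circle R z ->
  (F n).[z] = z ^+ n * (S n).[z]^* /\
  (second_kind n).1.[z] = z ^+ n * (second_kind n).2.[z]^*.
Proof.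
move=> zc; have zz : z * z^* = 1 by rewrite mulcJ ((circleP z).1 zc) expr1n.
elim: n => [|n [IH1 IH2]].
  by rewrite F0 S0 /= !hornerC rmorph1 expr0 mul1r.
have [-> ->] := second_kindS n z; rewrite FS SS.
have J1 : (F n).[z]^* = z^* ^+ n * (S n).[z] by rewrite IH1 rmorphM rmorphXn /= conjCK.
have J2 : (second_kind n).1.[z]^* = z^* ^+ n * (second_kind n).2.[z].
  by rewrite IH2 rmorphM rmorphXn /= conjCK.
have cM (a b : R[i]) : (a * b)^* = a^* * b^* by exact: rmorphM.
have cB (a b : R[i]) : (a - b)^* = a^* - b^* by exact: rmorphB.
have cD (a b : R[i]) : (a + b)^* = a^* + b^* by exact: rmorphD.
rewrite cB cD !cM J1 J2 IH1 IH2.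
have zn : z ^+ n * z^* ^+ n = 1 by rewrite -exprMn zz expr1n.
rewrite exprS; split.
  transitivity (z * z ^+ n * (S n).[z]^* - (alpha n)^* * (S n).[z] * (z * z^*) * (z ^+ n * z^* ^+ n)); last by ring.
  by rewrite zz zn; ring.
transitivity (z * z ^+ n * (second_kind n).2.[z]^* + (alpha n)^* * (second_kind n).2.[z] * (z * z^*) * (z ^+ n * z^* ^+ n)); last by ring.
by rewrite zz zn; ring.
Qed.

(** Up to sign this is the Wronskian of two solutions of one recursion, the second being
    [second_kind] with its second entry negated. Each step multiplies it by the determinant
    [z (1 - |alpha n|^2)]. *)
Lemma second_kind_wronskian n z :
  (second_kind n).2.[z] * (F n).[z] + (second_kind n).1.[z] * (S n).[z] =
  2 * z ^+ n * (nu n)%:C.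
Proof.
elim: n => [|n IH]; first by rewrite /= F0 S0 !hornerC nu0 expr0 !mulr1.
have [-> ->] := second_kindS n z; rewrite FS SS.
have -> : (nu n.+1)%:C = (1 - alpha n * (alpha n)^*) * (nu n)%:C.
  by rewrite nuS mulcJ rmorphM rmorphB.
have -> : 2 * z ^+ n.+1 * ((1 - alpha n * (alpha n)^*) * (nu n)%:C) =
  (1 - alpha n * (alpha n)^*) * z * (2 * z ^+ n * (nu n)%:C).
  by rewrite exprS; ring.
by rewrite -IH; ring.
Qed.

Definition weight n t : R := nu n / cabs (S n).[expi t] ^+ 2.

Lemma weight_gt0 n t : 0 < weight n t.
Proof.
by rewrite divr_gt0 ?nu_pos// exprn_gt0// cabs_gt0 S_neq0// cabs_expi.
Qed.

(* The weight is the real part of the quotient of the second kind and first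
   kind reversed polynomials, which is analytic with value 1 at 0. *)
Lemma weight_Re n t :
  weight n t = complex.Re ((second_kind n).2.[expi t] * (S n).[expi t]^-1).
Proof.
have zc := circle_expi t; have [E1 E2] := reversed_pairs n zc.
have := second_kind_wronskian n (expi t); rewrite E1 E2.
have sn0 : (S n).[expi t] != 0 by rewrite S_neq0// cabs_expi.
have en0 : expi t ^+ n != 0 :> R[i] by rewrite expf_neq0// expi_neq0.
have n0 : cabs (S n).[expi t] ^+ 2 != 0 by rewrite sqrf_eq0 cabs_eq0.
set B := (second_kind n).2.[_]; set s := (S n).[_] in sn0 n0 *.
move=> H.
have H2 : B * s^* + B^* * s = 2 * (nu n)%:C.
  apply: (mulfI en0); transitivity (2 * expi t ^+ n * (nu n)%:C); last by ring.
  by rewrite -H; ring.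
have -> : B * s^-1 = ((cabs s ^+ 2)^-1)%:C * (B * s^*).
  have sJ : s^* != 0 by rewrite -cabs_eq0 cabsJ cabs_eq0.
  by rewrite fmorphV /= -mulcJ invfM; move: sn0 sJ; move: s^* => u *; field; apply/andP.
rewrite cReMr /weight -/s mulrC; congr (_ * _).
have := congr1 (@complex.Re R) H2.
by rewrite cReD !cReM !cReJ !cImJ /=; lra.
Qed.

Let quotient_bounded n :
  angular_bounded (fun t => (second_kind n).2.[expi t] * (S n).[expi t]^-1).
Proof.
have ap : disc_approx (fun z => (second_kind n).2.[z] * (S n).[z]^-1).
  apply: disc_approxM; first exact: disc_approx_poly.
  by apply: disc_approx_inv; [exact: S_at0|exact: S_neq0].
have [M _ hM] := disc_approx_bounded ap; split; last first.
  by exists M => t; rewrite hM// cabs_expi.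
have hS : angular_meas (fun t => (S n).[expi t]).
  exact/Cmeasurable_horner/angular_meas_expi.
apply: CmeasurableM; first exact/Cmeasurable_horner/angular_meas_expi.
have : angular_meas (fun t => (S n).[expi t]^* * ((cabs (S n).[expi t] ^+ 2)^-1)%:C).
  apply: CmeasurableM (CmeasurableJ hS) _; split => //=.
  apply: measurable_fun_inv_gt0; first exact: measurable_arcI.
    exact: measurable_cabs2.
  by move=> t _; rewrite exprn_gt0// cabs_gt0 S_neq0// cabs_expi.
suff -> : (fun t => (S n).[expi t]^* * ((cabs (S n).[expi t] ^+ 2)^-1)%:C) =
          (fun t => (S n).[expi t]^-1) by [].
apply/funext => t; have h : (S n).[expi t] != 0 by rewrite S_neq0// cabs_expi.
have hJ : (S n).[expi t]^* != 0 by rewrite -cabs_eq0 cabsJ cabs_eq0.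
rewrite fmorphV /= -mulcJ; move: ((S n).[_]) h hJ => x h hJ.
by rewrite invfM mulrCA mulfV ?mulr1.
Qed.

Lemma weight_int n : rint (weight n).
Proof.
have [+ _] := angular_bounded_angular_int (quotient_bounded n).
by apply: eq_integrable; [exact: measurable_arcI|move=> t _ /=; rewrite weight_Re].
Qed.

Lemma weight_mean n : rmean (weight n) = 1.
Proof.
rewrite (eq_rmean (weight_Re n)) rmean_Re.
have ap : disc_approx (fun z => (second_kind n).2.[z] * (S n).[z]^-1).
  apply: disc_approxM; first exact: disc_approx_poly.
  by apply: disc_approx_inv; [exact: S_at0|exact: S_neq0].
rewrite (amean_disc_approx ap); last exact/angular_bounded_angular_int/quotient_bounded.
have E : (second_kind n).2.[0] = 1.
  elim: n {ap} => [|n IH]; first by rewrite /= hornerC.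
  by have [_ ->] := second_kindS n 0; rewrite mul0r mulr0 addr0.
by rewrite E S_at0 invr1 mulr1.
Qed.

Lemma log_weight_approx n e : 0 < e <= 4^-1 -> exists q : {poly R[i]},
  [/\ q.[0] = 0, forall z, cabs z <= 1 -> cabs (cexp q.[z] * (S n).[z] - 1) <= e
    & forall t, `|ln (weight n t) - (ln (nu n) + 2 * complex.Re q.[expi t])| <= 4 * e].
Proof.
move=> /andP[e0 e1]; have [q [q0 hq]] := log_poly (S_at0 n) (S_neq0 n) e0.
exists q; split=> // t; have t1 : cabs (expi t : R[i]) <= 1 by rewrite cabs_expi.
set X := cexp q.[expi t] * (S n).[expi t].
have X1 : `|cabs X - 1| <= e.
  have := hq _ t1; rewrite -/X => h; apply: le_trans h.
  have := lerB_cabs X 1; have := lerB_cabs 1 X; rewrite cabs1 [cabs (1 - X)]cabs_distC.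
  by move=> *; rewrite ler_norml; apply/andP; split; lra.
have hl : `|ln (cabs X)| <= 2 * e by apply: ln_near1 => //; apply/andP; split; lra.
have s0 : 0 < cabs (S n).[expi t] by rewrite cabs_gt0 S_neq0.
have E : ln (cabs X) = complex.Re q.[expi t] + ln (cabs (S n).[expi t]).
  by rewrite /X cabsM cabs_cexp lnM ?posrE ?expR_gt0// expRK.
have -> : ln (weight n t) - (ln (nu n) + 2 * complex.Re q.[expi t]) = - (2 * ln (cabs X)).
  rewrite /weight lnM ?posrE ?invr_gt0 ?exprn_gt0 ?nu_pos//.
  by rewrite lnV ?posrE ?exprn_gt0// lnXn// E; ring.
by rewrite normrN normrM ger0_norm//; lra.
Qed.

Lemma measurable_weight n : @measurable_fun _ _ (measurableTypeR R) R arcI (weight n).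
Proof. by have /integrableP[/measurable_EFinP] := weight_int n. Qed.

Lemma log_weight_int n : rint (fun t => ln (weight n t)).
Proof.
have he : 0 < (4^-1 : R) <= 4^-1 by rewrite invr_gt0 ltr0n lexx.
have [q [_ _ h]] := log_weight_approx n he.
have [M _ hM] := disc_approx_bounded (disc_approx_poly q).
apply: (@rint_bounded _ _ (1 + (`|ln (nu n)| + 2 * M))).
  exact: (measurableT_comp (@measurable_ln R) (measurable_weight n)).
move=> t; rewrite -[ln _](subrK (ln (nu n) + 2 * complex.Re q.[expi t])).
apply: le_trans (ler_normD _ _) _; rewrite lerD//.
  by apply: le_trans (h t) _; lra.
apply: le_trans (ler_normD _ _) _; rewrite lerD2l normrM ger0_norm// ler_wpM2l//.
by apply: le_trans (cabs_Re _) _; rewrite hM// cabs_expi.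
Qed.

(** Jensen's formula for a polynomial with no zero in the disc: [ln (weight n)] is uniformly close
    to [ln (nu n) + 2 Re q], and [Re q] has mean [Re q(0) = 0]. *)
Lemma log_weight_mean n : rmean (fun t => ln (weight n t)) = ln (nu n).
Proof.
apply/eqP; rewrite -subr_eq0 -normr_eq0 eq_le normr_ge0 andbT.
apply/ler_addgt0Pr => e0 e00; rewrite add0r.
pose e := Num.min (e0 / 4) 4^-1.
have he : 0 < e <= 4^-1.
  by rewrite /e lt_min divr_gt0//= invr_gt0 ltr0n/= ge_min lexx orbT.
have [q [q0 _ h]] := log_weight_approx n he.
have [iq mq] := rmean_Re_horner q.
have i2 : rint (fun t => ln (nu n) + 2 * complex.Re q.[expi t]).
  by apply: rintD; [exact: rint_cst|exact: rintZ].
have -> : ln (nu n) = rmean (fun t => ln (nu n) + 2 * complex.Re q.[expi t]).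
  by rewrite rmeanD ?rmean_cst ?rmeanZ ?mq ?q0 ?mulr0 ?addr0//; [exact: rint_cst|exact: rintZ].
apply: rmean_dist => // [|t]; first exact: log_weight_int.
apply: le_trans (h t) _; have : e <= e0 / 4 by rewrite /e ge_min lexx.
by lra.
Qed.

End SecondKind.

(** * Weak limits of the orthonormal measures *)

Section CircleLipschitz.
Variable R : realType.
Implicit Types f g : R[i] -> R.
Notation arcI := (`[0%R, (2 * pi)%R]%classic : set R).

(** A class of test functions that contains the squared moduli of polynomials and is stable under
    products and under inverses bounded away from 0. The Lipschitz constant is what gives Poisson
    means a uniform rate. *)
Definition circle_lipschitz f := measurable_fun (circle R) f /\
  exists L M : R, [/\ 0 < L, 0 < M, forall z, circle R z -> `|f z| <= M
    & forall z w, circle R z -> circle R w -> `|f z - f w| <= L * cabs (z - w)].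

Lemma circle_lipschitzM f g : circle_lipschitz f -> circle_lipschitz g ->
  circle_lipschitz (fun z => f z * g z).
Proof.
move=> [mf [L [M [L0 M0 hM hL]]]] [mg [L' [M' [L'0 M'0 hM' hL']]]].
split; first exact: measurable_funM.
exists (M * L' + L * M'), (M * M'); split; rewrite ?addr_gt0 ?mulr_gt0//.
  by move=> z zc; rewrite normrM ler_pM ?hM ?hM'.
move=> z w zc wc.
have -> : f z * g z - f w * g w = f z * (g z - g w) + (f z - f w) * g w by ring.
apply: le_trans (ler_normD _ _) _; rewrite !normrM mulrDl lerD//.
  by rewrite -mulrA; apply: ler_pM => //; [exact: hM|exact: hL'].
by rewrite mulrAC; apply: ler_pM => //; [exact: hL|exact: hM'].
Qed.

Lemma circle_lipschitz_cabs2 (P : {poly R[i]}) :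
  circle_lipschitz (fun z => cabs P.[z] ^+ 2).
Proof.
split.
  by apply: measurable_cabs2; exact: Cmeasurable_horner (Cmeasurable_id _).
have [L L0 hL] := horner_lipschitz P 1.
pose M := 1 + \sum_(i < size P) cabs P`_i.
have M0 : 0 < M by rewrite ltr_pwDl// sumr_ge0// => i _; exact: cabs_ge0.
have hM z : circle R z -> cabs P.[z] <= M.
  move=> /circleP z1; apply: (le_trans (cabs_horner_le P _)); first by rewrite z1.
  by rewrite lerDr.
exists (2 * M * L), (M ^+ 2); split; rewrite ?exprn_gt0 ?mulr_gt0//.
  move=> z /hM h; rewrite ger0_norm ?sqr_ge0//.
  by rewrite ler_pXn2r ?nnegrE ?cabs_ge0 ?(ltW M0).
move=> z w zc wc; rewrite subr_sqr normrM mulrC -mulrA ler_pM//.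
  rewrite ger0_norm ?addr_ge0 ?cabs_ge0// mulr_natl mulr2n.
  by rewrite lerD ?hM.
apply: le_trans (hL z w _ _); rewrite ?((circleP _).1 zc) ?((circleP _).1 wc)//.
rewrite ler_norml lerB_cabs andbT lerNl opprB cabs_distC.
exact: lerB_cabs.
Qed.

Lemma circle_lipschitzV f (m : R) : 0 < m -> circle_lipschitz f ->
  (forall z, circle R z -> m <= f z) -> circle_lipschitz (fun z => (f z)^-1).
Proof.
move=> m0 [mf [L [M [L0 M0 hM hL]]]] hm; split.
  apply: measurable_fun_inv_gt0 => //; first exact: measurable_circle.
  by move=> z /hm; exact: lt_le_trans.
exists (L / m ^+ 2), m^-1; split; rewrite ?divr_gt0 ?invr_gt0 ?exprn_gt0//.
  move=> z /hm h; have fz := lt_le_trans m0 h.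
  by rewrite ger0_norm ?invr_ge0 ?(ltW fz)// lef_pV2 ?posrE.
move=> z w zc wc; have fz := lt_le_trans m0 (hm z zc).
have fw := lt_le_trans m0 (hm w wc).
have -> : (f z)^-1 - (f w)^-1 = (f w - f z) * ((f z)^-1 * (f w)^-1).
  by field; rewrite !gt_eqF.
rewrite normrM mulrAC; apply: ler_pM => //.
  by rewrite distrC; exact: hL.
rewrite ger0_norm ?mulr_ge0 ?invr_ge0 ?(ltW fz) ?(ltW fw)// expr2 invfM.
by apply: ler_pM; rewrite ?invr_ge0 ?(ltW fz) ?(ltW fw)// lef_pV2 ?posrE ?hm.
Qed.

Lemma circle_lipschitz_measurable_expi f : circle_lipschitz f ->
  @measurable_fun _ _ (measurableTypeR R) R setT (fun t => f (expi t)).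
Proof.
move=> [_ [L [M [L0 M0 hM hL]]]].
apply: continuous_measurable_fun => t; apply/cvgrPdist_lt => e e0.
have := @continuous_expi R t; move/cvg_cabsP => /(_ (e / L) (divr_gt0 e0 L0)).
apply: filterS => s; rewrite ltr_pdivlMr// mulrC cabs_distC; apply: le_lt_trans.
by apply: hL; exact: circle_expi.
Qed.

Lemma circle_lipschitz_rint f : circle_lipschitz f -> rint (fun t => f (expi t)).
Proof.
move=> hf; have mf := circle_lipschitz_measurable_expi hf.
have [_ [L [M [L0 M0 hM hL]]]] := hf.
apply: (@rint_bounded _ _ M); first exact: measurable_funTS.
by move=> t; apply: hM; exact: circle_expi.
Qed.

(** The real part of the Szego kernel is the Poisson kernel; the product form serves the absorption
    of [|expi t - w|^2] in [poisson_approx]. *)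
Lemma kernel_Re (w : R[i]) t : cabs w < 1 ->
  complex.Re (szego_kernel w t) * cabs (expi t - w) ^+ 2 = 1 - cabs w ^+ 2.
Proof.
move=> w1; have h := expi_sub_neq0 t w1.
have n0 : cabs (expi t - w) ^+ 2 != 0 by rewrite sqrf_eq0 cabs_eq0.
have -> : szego_kernel w t =
    ((cabs (expi t - w) ^+ 2)^-1)%:C * ((expi t + w) * (expi t - w)^*).
  rewrite /szego_kernel fmorphV /= -mulcJ.
  have hJ : (expi t - w)^* != 0 by rewrite -cabs_eq0 cabsJ cabs_eq0.
  rewrite invfM; move: (expi t - w) h hJ => x h hJ; move: (x^*) hJ => y hy.
  by field; apply/andP.
rewrite cReMr mulrC mulrA mulfV// mul1r.
have := cabs_expi t; move/(congr1 (fun x => x ^+ 2)); rewrite expr1n !cabs_sqr => e1.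
by rewrite cReM !cReJ !cImJ !cReD !cImD !cReN !cImN; lra.
Qed.

Lemma kernel_Re_ge0 (w : R[i]) t : cabs w < 1 -> 0 <= complex.Re (szego_kernel w t).
Proof.
move=> w1; have h : 0 < cabs (expi t - w) ^+ 2.
  by rewrite exprn_gt0// cabs_gt0 expi_sub_neq0.
rewrite -(pmulr_lge0 _ h) kernel_Re// subr_ge0 expr_le1 ?cabs_ge0//.
exact: ltW.
Qed.

Lemma kernel_Re_mean (w : R[i]) : cabs w < 1 ->
  rint (fun t => complex.Re (szego_kernel w t)) /\
  rmean (fun t => complex.Re (szego_kernel w t)) = 1.
Proof.
move=> w1; split.
  by have [] := angular_bounded_angular_int (angular_bounded_kernel w1).
rewrite rmean_Re; have := kernel_expiX w1 0.
rewrite (_ : amean _ = amean (szego_kernel w)) => [->//|].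
by apply: amean_eq => t; rewrite expr0 mulr1.
Qed.

(* Abel means converge uniformly: with [s = 1 - r] and [e = eta],
   [P_r |e^it - z| <= (eta + s^2 / (2 eta)) P_r + (1 - r^2) / (2 eta)]. *)
Lemma poisson_approx f L eta s z :
  (forall z w, circle R z -> circle R w -> `|f z - f w| <= L * cabs (z - w)) ->
  rint (fun t => complex.Re (szego_kernel ((1 - s)%:C * z) t) * f (expi t)) ->
  0 < L -> 0 < eta -> 0 < s < 1 -> circle R z ->
  `|rmean (fun t => complex.Re (szego_kernel ((1 - s)%:C * z) t) * f (expi t)) - f z| <=
    L * (eta + s / eta).
Proof.
move=> hL iPf L0 eta0 /andP[s0 s1] zc; have z1 := (circleP z).1 zc.
set w := (1 - s)%:C * z in iPf *.
have cw : cabs w = 1 - s by rewrite /w cabsM cabsC z1 mulr1 ger0_norm//; lra.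
have w1 : cabs w < 1 by lra.
have [iP mP] := kernel_Re_mean w1.
set K := fun t => complex.Re (szego_kernel w t).
have hK t : K t * `|f (expi t) - f z| <=
    L * (eta + s ^+ 2 / (2 * eta)) * K t + L * ((1 - (1 - s) ^+ 2) / (2 * eta)).
  have K0 : 0 <= K t by exact: kernel_Re_ge0.
  have KE : K t * cabs (expi t - w) ^+ 2 = 1 - (1 - s) ^+ 2 by rewrite kernel_Re// cw.
  set a := cabs (expi t - w) in KE.
  have a0 : 0 <= a := cabs_ge0 _.
  have d1 : cabs (expi t - z) <= a + s.
    apply: le_trans (ler_cabs_dist w _ _) _; rewrite lerD2l.
    have -> : w - z = (- s)%:C * z by rewrite /w rmorphB rmorphN rmorph1; ring.
    by rewrite cabsM z1 mulr1 cabsC normrN ger0_norm// ltW.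
  (* The arithmetic-geometric mean inequality with weight [eta], for [a] and for [s]: it trades [a]
     for [a^2], which the Poisson kernel cancels. *)
  have d2 : a + s <= eta + s ^+ 2 / (2 * eta) + a ^+ 2 / (2 * eta).
    rewrite -subr_ge0.
    have -> : eta + s ^+ 2 / (2 * eta) + a ^+ 2 / (2 * eta) - (a + s) =
      ((a - eta) ^+ 2 + (s - eta) ^+ 2) / (2 * eta).
      by field; rewrite gt_eqF.
    by rewrite divr_ge0 ?addr_ge0 ?sqr_ge0// mulr_ge0// ltW.
  apply: (@le_trans _ _ (K t * (L * (eta + s ^+ 2 / (2 * eta) + a ^+ 2 / (2 * eta))))).
    rewrite ler_wpM2l//; apply: le_trans (hL _ _ (circle_expi t) zc) _.
    by rewrite ler_pM2l//; exact: le_trans d1 d2.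
  rewrite -KE le_eqVlt; apply/orP; left; apply/eqP.
  by field; rewrite gt_eqF.
have iK2 : rint (fun t => L * (eta + s ^+ 2 / (2 * eta)) * K t +
     L * ((1 - (1 - s) ^+ 2) / (2 * eta))).
  by apply: rintD; [exact: rintZ|exact: rint_cst].
(* The squares of [s] cancel: [s^2 + (1 - (1 - s)^2) = 2 s]. *)
have mK2 : rmean (fun t => L * (eta + s ^+ 2 / (2 * eta)) * K t +
     L * ((1 - (1 - s) ^+ 2) / (2 * eta))) = L * (eta + s / eta).
  rewrite rmeanD; [|exact: rintZ|exact: rint_cst].
  by rewrite rmeanZ// rmean_cst mP; field; rewrite gt_eqF.
have iz : rint (fun t => f z * K t) by exact: rintZ.
have -> : f z = rmean (fun t => f z * K t) by rewrite rmeanZ// mP mulr1.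
rewrite -rmeanB// -mK2; apply: rmean_norm_le => //; first exact: rintB.
move=> t; apply: le_trans (hK t).
have -> : complex.Re (szego_kernel w t) * f (expi t) - f z * K t = K t * (f (expi t) - f z).
  by rewrite /K; ring.
by rewrite normrM ger0_norm// kernel_Re_ge0.
Qed.

(** Real parts of polynomials are the real trigonometric polynomials on the circle. Abel means of
    the Fourier series approximate [f] uniformly, and their geometric tail can be cut off. *)
Lemma circle_weierstrass f e : circle_lipschitz f -> 0 < e ->
  exists P : {poly R[i]}, forall z, circle R z -> `|f z - complex.Re P.[z]| <= e.
Proof.
move=> hf e0; have mf := circle_lipschitz_measurable_expi hf.
have if_ := circle_lipschitz_rint hf.
have [_ [L [M [L0 M0 hM hL]]]] := hf.
pose eta := Num.min (e / (4 * L)) 2^-1.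
have eta0 : 0 < eta by rewrite lt_min invr_gt0 ltr0n andbT divr_gt0 ?mulr_gt0.
have eta1 : eta <= 2^-1 by rewrite ge_min lexx orbT.
have eta2 : L * eta <= e / 4.
  rewrite mulrC -ler_pdivlMr//; have : eta <= e / (4 * L) by rewrite ge_min lexx.
  by rewrite invfM mulrA.
(* This choice balances [eta + s / eta] to [2 eta], so the Poisson error is at most [e / 2]; [N] is
   then chosen to keep the truncation below the other half. *)
pose s := eta ^+ 2.
have s0 : 0 < s < 1.
  by rewrite /s exprn_gt0//= expr_lt1 ?(ltW eta0)//; lra.
pose r := 1 - s; have [r0 r1] : 0 < r /\ r < 1 by move: s0 => /andP[]; rewrite /r; lra.
have sr : 0 < 1 - r by rewrite subr_gt0.
have [N hN] : exists N, 2 * r ^+ N / (1 - r) * M <= e / 2.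
  have : r ^+ n @[n --> \oo] --> 0 by apply: cvg_expr; rewrite ger0_norm ?(ltW r0).
  have g0 : 0 < e / 2 / M * (1 - r) / 2 by rewrite !(divr_gt0, mulr_gt0).
  move=> /cvgrPdist_le/(_ _ g0)[N _ h]; exists N; have := h N (leqnn _).
  rewrite sub0r normrN ger0_norm ?exprn_ge0 ?(ltW r0)// => hh.
  rewrite -ler_pdivlMr// ler_pdivrMr// mulrC -ler_pdivlMr//.
pose a k := amean (fun t => (f (expi t))%:C * (expi t ^+ k)^*).
have bf : angular_bounded (fun t => (f (expi t))%:C).
  split; last by exists M => t; rewrite cabsC hM//; exact: circle_expi.
  by split => //=; exact: measurable_funTS.
have iak k : angular_int (fun t => (f (expi t))%:C * (expi t ^+ k)^*).
  apply/angular_bounded_angular_int/angular_boundedM => //.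
  exact/angular_boundedJ/angular_boundedX.
exists (\sum_(k < N) (2 * r%:C ^+ k * a k) *: 'X^k - (a 0)%:P) => z zc.
have z1 := (circleP z).1 zc; pose w := r%:C * z.
have cw : cabs w = r by rewrite /w cabsM cabsC z1 mulr1 ger0_norm ?(ltW r0).
have w1 : cabs w < 1 by rewrite cw.
(* With [x = w * conj(expi t)] the kernel is [2 / (1 - x) - 1]; [T] truncates the geometric series
   after [N] terms. *)
pose T t := 2 * (\sum_(k < N) (w * (expi t)^*) ^+ k) - 1.
have PE : (\sum_(k < N) (2 * r%:C ^+ k * a k) *: 'X^k - (a 0)%:P).[z] =
    amean (fun t => (f (expi t))%:C * T t).
  rewrite hornerD hornerN hornerC horner_sum.
  rewrite (@amean_eq _ _ (fun t => \sum_(k < N) (2 * w ^+ k) * ((f (expi t))%:C * (expi t ^+ k)^*) +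
     -1 * ((f (expi t))%:C * (expi t ^+ 0)^*))); last first.
    move=> t; rewrite /T mulrBr mulr1 expr0 rmorph1 mulr1 mulN1r; congr (_ - _).
    rewrite mulr_sumr mulr_sumr; apply: eq_bigr => k _.
    by rewrite exprMn rmorphXn /=; ring.
  rewrite ameanD; last 2 first.
  - by apply: Cintegrable_sum; [exact: measurable_arcI|move=> k; exact: angular_intZ].
  - exact: angular_intZ.
  rewrite ameanZ// mulN1r amean_sum; last by move=> k; exact: angular_intZ.
  congr (_ - _); apply: eq_bigr => k _.
  by rewrite ameanZ// hornerZ hornerXn /w exprMn /a; ring.
have iPf : rint (fun t => complex.Re (szego_kernel w t) * f (expi t)).
  have : angular_int (fun t => szego_kernel w t * (f (expi t))%:C).
    apply/angular_bounded_angular_int/angular_boundedM => //.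
    exact: angular_bounded_kernel.
  move=> [+ _]; apply: eq_integrable; first exact: measurable_arcI.
  by move=> t _ /=; rewrite cReM /= mulr0 subr0.
have pa := poisson_approx hL iPf L0 eta0 s0 zc.
have iT : angular_int (fun t => (f (expi t))%:C * T t).
  apply/angular_bounded_angular_int/angular_boundedM => //.
  apply: angular_boundedD; last exact: angular_bounded_cst.
  apply: angular_boundedM; first exact: angular_bounded_cst.
  elim: N {hN PE T} => [|n IH].
    have -> : (fun t : R => \sum_(k < 0) (w * (expi t)^*) ^+ k) = fun=> 0.
      by apply/funext => t; rewrite big_ord0.
    exact: angular_bounded_cst.
  have -> : (fun t : R => \sum_(k < n.+1) (w * (expi t)^*) ^+ k) =
     fun t => (\sum_(k < n) (w * (expi t)^*) ^+ k) + w ^+ n * (expi t ^+ n)^*.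
    by apply/funext => t; rewrite big_ord_recr/= exprMn rmorphXn.
  apply: angular_boundedD => //; apply: angular_boundedM; first exact: angular_bounded_cst.
  exact/angular_boundedJ/angular_boundedX.
have tail t : cabs (szego_kernel w t - T t) <= 2 * r ^+ N / (1 - r).
  have en := expi_neq0 t; have h := expi_sub_neq0 t w1.
  have x1 : cabs (w * (expi t)^*) = r by rewrite cabsM cabsJ cabs_expi mulr1.
  have x0 : 1 - w * (expi t)^* != 0.
    rewrite -cabs_gt0; apply: lt_le_trans (lerB_cabs _ _).
    by rewrite cabs1 x1.
  have -> : szego_kernel w t - T t = 2 * (w * (expi t)^*) ^+ N / (1 - w * (expi t)^*).
    have -> : szego_kernel w t = 2 / (1 - w * (expi t)^*) - 1.
      rewrite /szego_kernel -expiV; move: x0; rewrite -expiV.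
      move: (expi t) en h => v en h x0; field; rewrite en h //=.
    have := subrX1 (w * (expi t)^*) N; rewrite /T.
    move: (w * _) x0 => x x0; move: (\sum_(_ < _) _) (x ^+ N) => S xN hS.
    have -> : xN = (x - 1) * S + 1 by rewrite -hS subrK.
    by field.
  rewrite cabs_div !cabsM cabsX x1.
  have -> : cabs (2 : R[i]) = 2 by rewrite -(rmorph_nat (real_complex R)) cabsC ger0_norm.
  apply: ler_pM => //; first by rewrite mulr_ge0 ?exprn_ge0 ?(ltW r0).
    by rewrite invr_ge0 cabs_ge0.
  rewrite lef_pV2 ?posrE ?cabs_gt0//.
  by apply: le_trans (lerB_cabs _ _); rewrite cabs1 x1.
have h1 : `|f z - rmean (fun t => complex.Re (szego_kernel w t) * f (expi t))| <= e / 2.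
  rewrite distrC; apply: (le_trans pa).
  by rewrite /s expr2 mulfK ?gt_eqF// mulrDr; lra.
have h2 : `|rmean (fun t => complex.Re (szego_kernel w t) * f (expi t)) -
     complex.Re (amean (fun t => (f (expi t))%:C * T t))| <= e / 2.
  rewrite -rmean_Re; apply: (le_trans (rmean_dist (e := 2 * r ^+ N / (1 - r) * M) _ _ _)) => //.
    by have [] := iT.
  move=> t; have -> : complex.Re (szego_kernel w t) * f (expi t) - complex.Re ((f (expi t))%:C * T t)
     = complex.Re (szego_kernel w t - T t) * f (expi t).
    by rewrite cReMr [in RHS]cReB; ring.
  rewrite normrM; apply: ler_pM => //; last by apply: hM; exact: circle_expi.
  exact: le_trans (cabs_Re _) (tail t).
rewrite PE (splitr e); apply: le_trans (lerD h1 h2).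
by rewrite -(subrKA (rmean (fun t => complex.Re (szego_kernel w t) * f (expi t)))) ler_normD.
Qed.

End CircleLipschitz.

Section UniformLimit.
Variable R : realType.

Lemma complex_cauchy_cvg (u : nat -> R[i]) :
  (forall e, 0 < e -> exists N, forall m n, (N <= m)%N -> (N <= n)%N ->
    cabs (u n - u m) <= e) ->
  exists l : R[i], forall e, 0 < e -> exists N, forall n, (N <= n)%N ->
    cabs (u n - l) <= e.
Proof.
move=> hu.
have cv (v : nat -> R) : (forall m n, `|v n - v m| <= cabs (u n - u m)) -> cvgn v.
  move=> hv; apply: cauchy_cvg; apply/cauchy_ballP => e e0.
  have [N hN] := hu (e / 2) (divr_gt0 e0 (ltr0n _ 2)).
  exists (v @` [set n | (N <= n)%N], v @` [set n | (N <= n)%N]) => /=.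
    by split; exists N => // n Nn; exists n.
  move=> [_ _] /= [[m Nm <-] [n Nn <-]]; rewrite /ball/= distrC.
  apply: le_lt_trans (hv m n) _; apply: le_lt_trans (hN _ _ Nm Nn) _.
  by rewrite ltr_pdivrMr// ltr_pMr// ltr1n.
have cR : cvgn (fun n => complex.Re (u n)).
  by apply: cv => m n; rewrite -cReB cabs_Re.
have cI : cvgn (fun n => complex.Im (u n)).
  by apply: cv => m n; rewrite -cImB cabs_Im.
exists (limn (fun n => complex.Re (u n)) +i* limn (fun n => complex.Im (u n))) => e e0.
have e2 : 0 < e / 2 by rewrite divr_gt0.
move: cR => /cvgrPdist_le/(_ _ e2)[N1 _ h1].
move: cI => /cvgrPdist_le/(_ _ e2)[N2 _ h2].
exists (maxn N1 N2) => n; rewrite geq_max => /andP[n1 n2].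
apply: le_trans (cabs_ReIm _) _; rewrite cReB cImB /= (splitr e) lerD// distrC.
  exact: h1.
exact: h2.
Qed.

Lemma uniform_limit (S : nat -> R[i] -> R[i]) (Om : R -> set R[i]) :
  (forall d, 0 < d -> forall e, 0 < e -> exists N, forall m n z, (N <= m)%N ->
    (N <= n)%N -> Om d z -> cabs (S n z - S m z) <= e) ->
  exists Soo : R[i] -> R[i], forall d, 0 < d -> forall e, 0 < e -> exists N,
    forall n z, (N <= n)%N -> Om d z -> cabs (S n z - Soo z) <= e.
Proof.
move=> hS.
have lz z : exists l : R[i], forall d, 0 < d -> Om d z -> forall e, 0 < e ->
    exists N, forall n, (N <= n)%N -> cabs (S n z - l) <= e.
  (* The pointwise limit does not depend on [d], so one function serves all the sets [Om d]; points
     in none of them get the value 0. *)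
  have [[d [d0 dz]]|h] := pselect (exists d, 0 < d /\ Om d z); last first.
    by exists 0 => d d0 dz; exfalso; apply: h; exists d.
  have [|l hl] := @complex_cauchy_cvg (fun n => S n z).
    move=> e e0; have [N hN] := hS d d0 e e0.
    by exists N => m n Nm Nn; exact: hN.
  by exists l.
have [Soo hSoo] := choice lz; exists Soo => d d0 e e0.
have [|N hN] := hS d d0 (e / 2); first by rewrite divr_gt0.
exists N => n z Nn dz.
have [|N' hN'] := hSoo z d d0 dz (e / 2); first by rewrite divr_gt0.
apply: le_trans (ler_cabs_dist (S (maxn N N') z) _ _) _; rewrite (splitr e) lerD//.
  by apply: hN => //; exact: leq_maxl.
by apply: hN'; exact: leq_maxr.
Qed.

End UniformLimit.

Section Rakhmanov.
Variables (R : realType) (mu : probability R[i] R) (Phi : nat -> {poly R[i]})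
  (alpha : nat -> R[i]).
Hypotheses (muC : mu (circle R) = 1%E)
  (suppC : infinite_set (msupport mu))
  (orth : forall n, monic_orthogonal mu n (Phi n))
  (szego : verblunsky Phi alpha).
Notation C := (circle R).
Notation nun := (nu mu Phi).
Variable nuoo : R.
Hypotheses (nuoo0 : 0 < nuoo) (nu_ge : forall n, nuoo <= nun n)
  (nu_lim : forall e, 0 < e -> exists N, forall n, (N <= n)%N -> `|nun n - nuoo| <= e)
  (alpha_lim : forall e, 0 < e -> exists N, forall n, (N <= n)%N -> cabs (alpha n) <= e).

Let mC : measurable C := @measurable_circle R.
Let finC : (mu C < +oo)%E.
Proof. by rewrite muC ltry. Qed.

Lemma circle_lipschitz_int f : circle_lipschitz f -> mu.-integrable C (EFin \o f).
Proof.
by move=> [mf [L [M [_ _ hM _]]]]; exact: (integrable_bounded mC finC mf hM).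
Qed.

(** Weak convergence of [|phi_n|^2 dmu] to normalized arc length: against a trigonometric polynomial
    only the constant term survives, by [moment_bound]. Taking real parts of [P] spares the negative
    frequencies. *)
Lemma rakhmanov (f : R[i] -> R) (e : R) : circle_lipschitz f -> 0 < e ->
  exists N, forall n, (N <= n)%N ->
    `|(\int[mu]_(z in C) (f z * cabs (Phi n).[z] ^+ 2)) / nun n -
      rmean (fun t => f (expi t))| <= e.
Proof.
move=> hf e0; have e4 : 0 < e / 4 by rewrite divr_gt0.
have [P hP] := circle_weierstrass hf e4.
pose A := \sum_(k < size P) cabs P`_k.
have A0 : 0 <= A by apply: sumr_ge0 => k _; exact: cabs_ge0.
(* With [|alpha| <= e / (4 B)] the nonconstant moments add up to at most [A * size P * e / (4 B)],
   below [e / 4 * nuoo]; the added 1 keeps [B] positive when [A] vanishes. *)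
pose B := A * (size P)%:R / nuoo + 1.
have B0 : 0 < B by rewrite ltr_wpDl// divr_ge0 ?mulr_ge0 ?(ltW nuoo0).
have [N hN] := alpha_lim (divr_gt0 e4 B0).
exists N => n Nn; have nn0 : 0 < nun n by exact: lt_le_trans (nu_ge n).
have if2 : mu.-integrable C (EFin \o (fun z => f z * cabs (Phi n).[z] ^+ 2)).
  apply: circle_lipschitz_int; apply: circle_lipschitzM => //.
  exact: circle_lipschitz_cabs2.
have bP : circle_bounded (fun z => P.[z]) := circle_bounded_horner P.
have bPhi : circle_bounded (fun z => (cabs (Phi n).[z] ^+ 2)%:C).
  have b := circle_bounded_horner (Phi n).
  have := circle_boundedM b (circle_boundedJ b).
  by under eq_fun do rewrite mulcJ.
have bXP k : circle_bounded (fun z => z ^+ k * (cabs (Phi n).[z] ^+ 2)%:C).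
  by apply: circle_boundedM => //; exact: circle_boundedX.
have iPC : Cintegrable mu C (fun z => P.[z] * (cabs (Phi n).[z] ^+ 2)%:C).
  by apply: (circle_bounded_int muC); exact: circle_boundedM.
have iP2 : mu.-integrable C (EFin \o (fun z => complex.Re P.[z] * cabs (Phi n).[z] ^+ 2)).
  have [+ _] := iPC; apply: eq_integrable => // z _ /=.
  by rewrite cReM /= mulr0 subr0.
have h1 : `|\int[mu]_(z in C) (f z * cabs (Phi n).[z] ^+ 2) -
    \int[mu]_(z in C) (complex.Re P.[z] * cabs (Phi n).[z] ^+ 2)| <= e / 4 * nun n.
  rewrite -RintegralB//; apply: le_trans (le_normr_Rintegral _ _) _ => //.
    exact: (integrableBR mC if2 iP2).
  rewrite /nu -RintegralZl//; last exact: int_cabs2.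
  apply: le_Rintegral => //.
  - by apply: integrable_norm; exact: (integrableBR mC if2 iP2).
  - by apply: (integrableZlR mC); exact: int_cabs2.
  - move=> z zc; rewrite -mulrBl normrM ler_pM// ?hP// ger0_norm//.
    exact: sqr_ge0.
have E : \int[mu]_(z in C) (complex.Re P.[z] * cabs (Phi n).[z] ^+ 2) =
    complex.Re (\sum_(k < size P) P`_k *
      Cintegral mu C (fun z => z ^+ k * (cabs (Phi n).[z] ^+ 2)%:C)).
  transitivity (complex.Re (Cintegral mu C (fun z => P.[z] * (cabs (Phi n).[z] ^+ 2)%:C))).
    by rewrite /=; apply: eq_Rintegral => z _; rewrite cReM /= mulr0 subr0.
  rewrite (@eq_Cintegral _ _ _ _ _ _ (fun z : R[i] => \sum_(k < size P) P`_k *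
      (z ^+ k * (cabs (Phi n).[z] ^+ 2)%:C))); last first.
    move=> z _; rewrite horner_coef mulr_suml; apply: eq_bigr => k _.
    by rewrite mulrA.
  rewrite Cintegral_sum//; last first.
    by move=> k; apply: CintegrableZ => //; exact: (circle_bounded_int muC).
  congr complex.Re; apply: eq_bigr => k _; rewrite CintegralZ//.
  exact: (circle_bounded_int muC).
have h2 : `|\int[mu]_(z in C) (complex.Re P.[z] * cabs (Phi n).[z] ^+ 2) -
    complex.Re P`_0 * nun n| <= e / 4 * nun n.
  rewrite E.
  have E0 : complex.Re P`_0 * nun n = complex.Re (\sum_(k < size P)
      if k == 0%N :> nat then P`_0 * (nun n)%:C else 0).
    case: (size P) (@nth_default _ 0 P 0) => [->//|s _].
      by rewrite big_ord0 mul0r.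
    by rewrite big_ord_recl/= big1 ?addr0 ?cReM /= ?mulr0 ?subr0.
  rewrite E0 -cReB -sumrB; apply: le_trans (cabs_Re _) _.
  apply: le_trans (ler_cabs_sum _ _ _) _.
  apply: (@le_trans _ _ (\sum_(k < size P) cabs P`_k * ((size P)%:R * (e / 4 / B)))).
    apply: ler_sum => k _; case: eqP => [k0|/eqP k0].
      rewrite k0 (_ : Cintegral _ _ _ = (nun n)%:C) ?subrr ?cabs0.
        by rewrite mulr_ge0 ?cabs_ge0// mulr_ge0// divr_ge0// ltW.
      apply: complexP => /=; first by apply: eq_Rintegral => z _; rewrite mul1r mul0r subr0.
      rewrite (@eq_Rintegral _ _ _ _ _ (fun=> 0)) ?/Rintegral ?integral0//.
      by move=> z _; rewrite mul1r mul0r addr0.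
    rewrite subr0 cabsM ler_wpM2l ?cabs_ge0//.
    have k1 : (0 < k)%N by rewrite lt0n.
    apply: le_trans (moment_bound muC suppC orth szego n k1) _.
    apply: (@le_trans _ _ (\sum_(j < k) (e / 4 / B))).
      by apply: ler_sum => j _; apply: hN; rewrite (leq_trans Nn) ?leq_addr.
    rewrite sumr_const card_ord -[_ *+ k]mulr_natl ler_wpM2r ?divr_ge0 ?(ltW B0) ?(ltW e0)//.
    by rewrite ler_nat ltnW.
  rewrite -mulr_suml -/A.
  apply: (@le_trans _ _ (e / 4 * nuoo)); last by rewrite ler_pM2l.
  have -> : A * ((size P)%:R * (e / 4 / B)) = e / 4 * nuoo * ((B - 1) / B).
    have HB : A * (size P)%:R = (B - 1) * nuoo by rewrite /B addrK divfK// gt_eqF.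
    by rewrite mulrA HB; field; rewrite gt_eqF.
  rewrite ler_piMr//; first by rewrite mulr_ge0// ltW.
  by rewrite ler_pdivrMr// mul1r gerBl.
have [iPm mPm] := rmean_Re_horner P.
have h3 : `|complex.Re P`_0 - rmean (fun t => f (expi t))| <= e / 4.
  rewrite -horner_coef0 -mPm distrC; apply: rmean_dist => //.
    exact: circle_lipschitz_rint.
  by move=> t; apply: hP; exact: circle_expi.
set I1 := \int[mu]_(z in C) (f z * _) in h1 *.
set I2 := \int[mu]_(z in C) (complex.Re _ * _) in h1 h2.
have h12 : `|I1 / nun n - complex.Re P`_0| <= e / 2.
  have -> : I1 / nun n - complex.Re P`_0 = (I1 - I2 + (I2 - complex.Re P`_0 * nun n)) / nun n.
    by field; rewrite gt_eqF.
  rewrite normrM normfV (gtr0_norm nn0) ler_pdivrMr//.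
  by apply: le_trans (ler_normD _ _) _; lra.
rewrite -(subrKA (complex.Re P`_0)); apply: le_trans (ler_normD _ _) _.
by lra.
Qed.

End Rakhmanov.

Section WeightedIdentity.
Variables (R : realType) (mu : probability R[i] R) (Phi : nat -> {poly R[i]})
  (alpha : nat -> R[i]).
Hypotheses (muC : mu (circle R) = 1%E)
  (suppC : infinite_set (msupport mu))
  (orth : forall n, monic_orthogonal mu n (Phi n))
  (szego : verblunsky Phi alpha).
Notation C := (circle R).
Notation nun := (nu mu Phi).
Notation Phis := (fun n => reversed_poly n (Phi n)).
Notation arcI := (`[0%R, (2 * pi)%R]%classic : set R).
Variable nuoo : R.
Hypotheses (nuoo0 : 0 < nuoo) (nu_ge : forall n, nuoo <= nun n)
  (nu_lim : forall e, 0 < e -> exists N, forall n, (N <= n)%N -> `|nun n - nuoo| <= e)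
  (alpha_lim : forall e, 0 < e -> exists N, forall n, (N <= n)%N -> cabs (alpha n) <= e).
Variables (Soo : R[i] -> R[i]) (Om : set R[i]) (m M : R).
Hypotheses (m0 : 0 < m) (M0 : 0 < M)
  (Sbnd : forall n z, Om z -> m <= cabs (Phis n).[z] <= M)
  (Slim : forall e, 0 < e -> exists N, forall n z, (N <= n)%N -> Om z ->
    cabs ((Phis n).[z] - Soo z) <= e)
  (Slow : forall n, exists2 c : R, 0 < c & forall z, C z -> c <= cabs (Phi n).[z]).

Definition limit_weight z : R := nuoo / cabs (Soo z) ^+ 2.

Let mC : measurable C := @measurable_circle R.
Let finC : (mu C < +oo)%E.
Proof. by rewrite muC ltry. Qed.

Let v n z : R := cabs (Phi n).[z] ^+ 2 / nun n.
Let voo z : R := cabs (Soo z) ^+ 2 / nuoo.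

Lemma Soo_bnd z : Om z -> m <= cabs (Soo z) <= M.
Proof.
move=> zO; apply/andP; split; apply/ler_addgt0Pr => e e0.
  have [N hN] := Slim e0; have /andP[h _] := Sbnd N zO.
  have := lerB_cabs (Phis N).[z] (Soo z); have := hN N z (leqnn _) zO; lra.
have [N hN] := Slim e0; have /andP[_ h] := Sbnd N zO.
have := lerB_cabs (Soo z) (Phis N).[z]; rewrite cabs_distC.
by have := hN N z (leqnn _) zO; lra.
Qed.

Let nun1 n : nun n <= 1 := nu_le1 muC suppC orth szego n.
Let nun0 n : 0 < nun n := lt_le_trans nuoo0 (nu_ge n).

Let v_ge n z : C z -> Om z -> m ^+ 2 <= v n z.
Proof.
move=> zc zO; rewrite /v -(cabs_Phis_circle orth n zc) ler_pdivlMr//.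
have /andP[h _] := Sbnd n zO.
apply: (@le_trans _ _ (m ^+ 2)); first by rewrite ler_piMr ?sqr_ge0.
by rewrite lerXn2r ?nnegrE ?cabs_ge0 ?(ltW m0).
Qed.

Let nuoo1 : nuoo <= 1 := le_trans (nu_ge 0) (nun1 0).

Let voo_ge z : Om z -> m ^+ 2 <= voo z.
Proof.
move=> zO; rewrite /voo ler_pdivlMr//; have /andP[h _] := Soo_bnd zO.
apply: (@le_trans _ _ (m ^+ 2)); first by rewrite ler_piMr ?sqr_ge0.
by rewrite lerXn2r ?nnegrE ?cabs_ge0 ?(ltW m0).
Qed.

Let v_lim e : 0 < e -> exists N, forall n z, (N <= n)%N -> C z -> Om z ->
  `|v n z - voo z| <= e.
Proof.
move=> e0.
have [|N1 h1] := @Slim (e / 2 * nuoo / (2 * M)); first by rewrite !(divr_gt0, mulr_gt0).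
have [|N2 h2] := @nu_lim (e / 2 * nuoo ^+ 2 / M ^+ 2).
  by rewrite !(divr_gt0, mulr_gt0) ?exprn_gt0.
exists (maxn N1 N2) => n z; rewrite geq_max => /andP[n1 n2] zc zO.
rewrite /v /voo -(cabs_Phis_circle orth n zc).
have /andP[s1 s2] := Sbnd n zO; have /andP[t1 t2] := Soo_bnd zO.
set s := cabs _ in s1 s2 *; set t := cabs (Soo z) in t1 t2 *.
have st : `|s - t| <= e / 2 * nuoo / (2 * M).
  apply: le_trans (h1 n z n1 zO); rewrite /s /t.
  rewrite ler_norml lerB_cabs andbT lerNl opprB cabs_distC; exact: lerB_cabs.
have -> : s ^+ 2 / nun n - t ^+ 2 / nuoo =
   (s + t) * (s - t) / nuoo + s ^+ 2 * (nuoo - nun n) / (nun n * nuoo).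
  by field; rewrite !gt_eqF.
apply: le_trans (ler_normD _ _) _; rewrite (splitr e) lerD//.
  rewrite normrM normfV (gtr0_norm nuoo0) ler_pdivrMr// normrM.
  apply: (@le_trans _ _ (2 * M * (e / 2 * nuoo / (2 * M)))).
    apply: ler_pM => //; rewrite ger0_norm ?addr_ge0 ?cabs_ge0//; lra.
  by rewrite le_eqVlt; apply/orP; left; apply/eqP; field; rewrite gt_eqF.
have nn := mulr_gt0 (nun0 n) nuoo0.
rewrite normrM normfV (gtr0_norm nn) ler_pdivrMr// normrM.
apply: (@le_trans _ _ (M ^+ 2 * (e / 2 * nuoo ^+ 2 / M ^+ 2))).
  apply: ler_pM => //; last by rewrite distrC; exact: h2.
  by rewrite ger0_norm ?sqr_ge0// lerXn2r ?nnegrE ?cabs_ge0 ?(ltW M0).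
have -> : M ^+ 2 * (e / 2 * nuoo ^+ 2 / M ^+ 2) = e / 2 * nuoo ^+ 2.
  by field; rewrite gt_eqF.
by rewrite ler_pM2l ?divr_gt0// expr2 ler_pM2r.
Qed.

Let inv_lim e n z : C z -> Om z -> `|v n z - voo z| <= e ->
  `|(v n z)^-1 - limit_weight z| <= e / m ^+ 4.
Proof.
move=> zc zO h; have a0 : 0 < m ^+ 2 by rewrite exprn_gt0.
have hv := v_ge n zc zO; have hoo := voo_ge zO.
have v0 := lt_le_trans a0 hv; have w0 := lt_le_trans a0 hoo.
have -> : limit_weight z = (voo z)^-1 by rewrite /limit_weight /voo invf_div.
have -> : (v n z)^-1 - (voo z)^-1 = (voo z - v n z) / (v n z * voo z).
  by field; rewrite !gt_eqF.
have vw := mulr_gt0 v0 w0.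
rewrite normrM normfV (gtr0_norm vw) distrC; apply: ler_pM => //.
  by rewrite invr_ge0 ltW.
rewrite lef_pV2 ?posrE ?exprn_gt0// (exprM m 2 2) expr2.
by apply: ler_pM => //; exact: ltW.
Qed.

(** The inverse must be Lipschitz on the whole circle, whereas [m] is a lower bound on [Om] only;
    hence the bound of [Slow], which may depend on [n]. *)
Let v_lipschitz n : circle_lipschitz (fun z => (v n z)^-1).
Proof.
have [c c0 hc] := Slow n.
have cst : circle_lipschitz (fun=> nun n).
  split; first exact: measurable_cst.
  exists 1, (nun n); split => //; first by move=> z _; rewrite ger0_norm// ltW.
  by move=> z w _ _; rewrite subrr normr0 mul1r cabs_ge0.
have := circle_lipschitzM cst (circle_lipschitzV (m := c ^+ 2) _ (circle_lipschitz_cabs2 (Phi n)) _).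
rewrite (_ : (fun z => nun n * _) = (fun z => (v n z)^-1)); last first.
  by apply/funext => z; rewrite /v invf_div.
apply; first by rewrite exprn_gt0.
by move=> z zc; rewrite lerXn2r ?nnegrE ?cabs_ge0 ?(ltW c0)// hc.
Qed.

(** [rakhmanov] needs a fixed test function, so [g] is divided by [v N] with [N] frozen. Where [g]
    does not vanish, [v n / v N] is uniformly near 1 for [n >= N], so the integral of [g v_n / v_N]
    is near that of [g]; its limit in [n], the mean of [g / v_N], is near that of [g] times the
    limit weight. *)
Lemma weighted_identity (g : R[i] -> R) : circle_lipschitz g ->
  (forall z, C z -> ~ Om z -> g z = 0) ->
  rint (fun t => g (expi t) * limit_weight (expi t)) /\
  \int[mu]_(z in C) g z = rmean (fun t => g (expi t) * limit_weight (expi t)).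
Proof.
move=> hg g0; have [_ [L [G [L0 G0 hG hL]]]] := hg.
have a0 : 0 < m ^+ 2 by rewrite exprn_gt0.
have b0 : 0 < m ^+ 4 by rewrite exprn_gt0.
have close e n t : 0 <= e -> (Om (expi t) -> `|v n (expi t) - voo (expi t)| <= e) ->
    `|g (expi t) * (v n (expi t))^-1 - g (expi t) * limit_weight (expi t)| <= G * (e / m ^+ 4).
  move=> e0 h; have tc := circle_expi t; have [tO|tO] := pselect (Om (expi t)).
    rewrite -mulrBr normrM; apply: ler_pM => //; first exact: hG.
    by apply: inv_lim => //; exact: h.
  rewrite (g0 _ tc tO) !mul0r subrr normr0 mulr_ge0 ?(ltW G0)//.
  by rewrite divr_ge0// ltW.
have if_ n := circle_lipschitz_rint (circle_lipschitzM hg (v_lipschitz n)).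
have mg : @measurable_fun _ _ (measurableTypeR R) R arcI (fun t => g (expi t) * limit_weight (expi t)).
  apply: (@measurable_fun_cvg _ (measurableTypeR R) R arcI (fun n t => g (expi t) * (v n (expi t))^-1)).
    by move=> n; have /integrableP[/measurable_EFinP] := if_ n.
  move=> t _; apply/cvgrPdist_le => e e0.
  have [|N hN] := @v_lim (e / G * m ^+ 4); first by rewrite !(divr_gt0, mulr_gt0).
  exists N => // n /= Nn; rewrite distrC; apply: le_trans (close (e / G * m ^+ 4) n t _ _) _.
  - by rewrite mulr_ge0 ?divr_ge0 ?ltW.
  - by move=> tO; apply: hN => //; exact: circle_expi.
  - by rewrite le_eqVlt; apply/orP; left; apply/eqP; field; rewrite !gt_eqF.
have rg : rint (fun t => g (expi t) * limit_weight (expi t)).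
  apply: (@rint_bounded _ _ (G * (m ^+ 2)^-1)) => // t.
  have tc := circle_expi t; have [tO|tO] := pselect (Om (expi t)).
    rewrite normrM; apply: ler_pM => //; first exact: hG.
    have -> : limit_weight (expi t) = (voo (expi t))^-1 by rewrite /limit_weight /voo invf_div.
    have hoo := voo_ge tO; have w0 := lt_le_trans a0 hoo.
    by rewrite ger0_norm ?invr_ge0 ?(ltW w0)// lef_pV2 ?posrE.
  by rewrite (g0 _ tc tO) mul0r normr0 mulr_ge0 ?(ltW G0)// invr_ge0 ltW.
split=> //; apply/eqP; rewrite -subr_eq0 -normr_eq0 eq_le normr_ge0 andbT.
apply/ler_addgt0Pr => e e0; rewrite add0r.
(* The first bound controls [1 / v N] against the limit weight, where two lower bounds [m^2] enter;
   the second controls the ratio [v n / v N], where one enters and two distances [e1] add up. *)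
pose e1 := Num.min (e / 3 / G * m ^+ 4) (e / 3 / G * m ^+ 2 / 2).
have e10 : 0 < e1 by rewrite lt_min !(divr_gt0, mulr_gt0).
have [N hN] := v_lim e10.
have hf := circle_lipschitzM hg (v_lipschitz N).
have [|N' hN'] := rakhmanov muC suppC orth szego nuoo0 nu_ge alpha_lim hf (e := e / 3).
  by rewrite divr_gt0.
pose n := maxn N N'; have nN : (N <= n)%N := leq_maxl _ _.
have := hN' n (leq_maxr _ _); set I1 := (\int[mu]_(z in C) _) / _ => h1.
have h2 : `|rmean (fun t => g (expi t) * (v N (expi t))^-1) -
    rmean (fun t => g (expi t) * limit_weight (expi t))| <= e / 3.
  apply: rmean_dist => // t; apply: le_trans (close e1 N t (ltW e10) _) _.
    by move=> tO; apply: hN => //; exact: circle_expi.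
  apply: (@le_trans _ _ (G * (e / 3 / G * m ^+ 4 / m ^+ 4))).
    by rewrite ler_pM2l// ler_pM2r ?invr_gt0// /e1 ge_min lexx.
  by rewrite le_eqVlt; apply/orP; left; apply/eqP; field; rewrite !gt_eqF.
have ig := circle_lipschitz_int muC hg.
have iff : mu.-integrable C (EFin \o (fun z => g z * (v N z)^-1 * cabs (Phi n).[z] ^+ 2)).
  by apply: (circle_lipschitz_int muC); apply: circle_lipschitzM => //; exact: circle_lipschitz_cabs2.
have h3 : `|\int[mu]_(z in C) g z - I1| <= e / 3.
  have -> : I1 = \int[mu]_(z in C) ((nun n)^-1 * (g z * (v N z)^-1 * cabs (Phi n).[z] ^+ 2)).
    by rewrite RintegralZl// mulrC.
  have iff' := integrableZlR mC (nun n)^-1 iff.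
  rewrite -RintegralB//; apply: le_trans (le_normr_Rintegral _ _) _ => //.
    exact: (integrableBR mC ig iff').
  have mu1 : fine (mu C) = 1 by rewrite muC.
  have -> : e / 3 = \int[mu]_(z in C) (e / 3).
    transitivity (e / 3 * fine (mu C)); first by rewrite mu1 mulr1.
    by rewrite Rintegral_cst.
  apply: le_Rintegral => //.
  - by apply: integrable_norm; exact: (integrableBR mC ig iff').
  - by apply: (integrable_bounded mC finC (M := `|e / 3|)) => //.
  - move=> z zc.
    have -> : g z - (nun n)^-1 * (g z * (v N z)^-1 * cabs (Phi n).[z] ^+ 2) =
       g z * (1 - v n z * (v N z)^-1) by rewrite /v; ring.
    have [zO|zO] := pselect (Om z); last first.
      by rewrite (g0 _ zc zO) mul0r normr0 divr_ge0// ltW.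
    have hv := v_ge N zc zO; have v0 := lt_le_trans a0 hv.
    have -> : 1 - v n z * (v N z)^-1 = (v N z - v n z) / v N z by field; rewrite gt_eqF.
    rewrite normrM normrM normfV (gtr0_norm v0).
    have d1 := hN n z nN zc zO; have d2 := hN N z (leqnn _) zc zO.
    have d3 : `|v N z - v n z| <= 2 * e1.
      have -> : v N z - v n z = (v N z - voo z) - (v n z - voo z) by ring.
      by apply: le_trans (ler_normB _ _) _; lra.
    apply: (@le_trans _ _ (G * (2 * (e / 3 / G * m ^+ 2 / 2) / m ^+ 2))).
      apply: ler_pM => //; [by rewrite mulr_ge0 ?invr_ge0 ?(ltW v0)|exact: hG|].
      apply: ler_pM => //; first by rewrite invr_ge0 ltW.
        by apply: (le_trans d3); rewrite ler_pM2l// /e1 ge_min lexx orbT.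
      by rewrite lef_pV2 ?posrE.
    by rewrite le_eqVlt; apply/orP; left; apply/eqP; field; rewrite !gt_eqF.
rewrite -(subrKA I1); apply: le_trans (ler_normD _ _) _.
have := ler_distD (rmean (fun t => g (expi t) * (v N (expi t))^-1)) I1
  (rmean (fun t => g (expi t) * limit_weight (expi t))).
by lra.
Qed.

End WeightedIdentity.

(** * The density of the measure off the exceptional points *)

Section Bump.
Variables (R : realType) (F : set R[i]).
Hypothesis F0 : F !=set0.

Definition cdist (z : R[i]) : R := inf [set cabs (z - w) | w in F].

Let lb z : has_lbound [set cabs (z - w) | w in F].
Proof. by exists 0 => _ [w _ <-]; exact: cabs_ge0. Qed.

Let ne z : [set cabs (z - w) | w in F] !=set0.
Proof. by have [w Fw] := F0; exists (cabs (z - w)), w. Qed.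

Lemma cdist_ge0 z : 0 <= cdist z.
Proof. by apply: lb_le_inf => // _ [w _ <-]; exact: cabs_ge0. Qed.

Lemma cdist_le z w : F w -> cdist z <= cabs (z - w).
Proof. by move=> Fw; apply: ge_inf => //; exists w. Qed.

Lemma cdist_lipschitz z w : `|cdist z - cdist w| <= cabs (z - w).
Proof.
have h x y : cdist x <= cabs (x - y) + cdist y.
  rewrite -lerBlDl; apply: lb_le_inf => // _ [u Fu <-].
  rewrite lerBlDl; apply: le_trans (cdist_le x Fu) _.
  exact: ler_cabs_dist.
have := h z w; have := h w z; rewrite [cabs (w - z)]cabs_distC => *.
by rewrite ler_norml; apply/andP; split; lra.
Qed.

Lemma cdist_gt0 z : open (~` F) -> ~ F z -> 0 < cdist z.
Proof.
move=> /open_cabsP oF nF; have [e e0 he] := oF z nF.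
apply: lt_le_trans e0 _; apply: lb_le_inf => // _ [w Fw <-].
by rewrite leNgt; apply/negP => h; apply: (he w) => //; rewrite cabs_distC.
Qed.

(** A truncated multiple of the distance: it vanishes in a neighbourhood of [F], which gives room
    around the [zeta k], and it increases with [k], which allows monotone convergence. *)
Definition bump k z : R := Num.min 1 (Num.max 0 (k.+1%:R * cdist z - 1)).

Lemma bump_itv k z : 0 <= bump k z <= 1.
Proof. by rewrite /bump ge_min lexx/= le_min ler01 le_max lexx. Qed.

Lemma bump_eq0 k z : cdist z <= k.+1%:R^-1 -> bump k z = 0.
Proof.
move=> h; rewrite /bump max_l; first by rewrite min_r.
by rewrite subr_le0 mulrC -ler_pdivlMr ?ltr0n// mul1r.
Qed.

Lemma bump_in k z : F z -> bump k z = 0.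
Proof.
move=> Fz; apply: bump_eq0; apply: le_trans (cdist_le z Fz) _.
by rewrite subrr cabs0 invr_ge0.
Qed.

Lemma bump_nd z : nondecreasing_seq (bump ^~ z).
Proof.
move=> k l kl; rewrite /bump; apply: le_min2 => //; apply: le_max2 => //.
by rewrite lerB// ler_wpM2r ?cdist_ge0// ler_nat.
Qed.

Lemma bump_cvg z : open (~` F) -> bump k z @[k --> \oo] --> (\1_(~` F) z : R).
Proof.
move=> oF; have [Fz|nFz] := pselect (F z).
  rewrite indicE memNset; last by move=> /(_ Fz).
  by under eq_fun do rewrite (bump_in _ Fz); exact: cvg_cst.
rewrite indicE mem_set//; have d0 := cdist_gt0 oF nFz.
have [N hN] : exists N : nat, 2 / cdist z < N%:R.
  exists (Num.bound (2 / cdist z)); apply: archi_boundP.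
  by rewrite divr_ge0// ltW.
apply: cvg_near_cst; exists N => // k /= Nk.
have key : 1 <= k.+1%:R * cdist z - 1.
  move: hN; rewrite ltr_pdivrMr// => hN.
  have : N%:R * cdist z <= k.+1%:R * cdist z.
    by rewrite ler_wpM2r ?cdist_ge0// ler_nat leqW.
  by lra.
by rewrite /bump max_r ?min_l//; lra.
Qed.

Lemma clamp_lipschitz (a b : R) :
  `|Num.min 1 (Num.max 0 a) - Num.min 1 (Num.max 0 b)| <= `|a - b|.
Proof.
have hmax : `|Num.max 0 a - Num.max 0 b| <= `|a - b|.
  have h1 := ler_norm (a - b); have := ler_norm (b - a); rewrite distrC => h2.
  rewrite ler_norml /Num.max.
  by apply/andP; split; case: (ltP 0 a) => ?; case: (ltP 0 b) => ?; lra.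
apply: le_trans hmax; move: (Num.max 0 a) (Num.max 0 b) => x y.
have h1 := ler_norm (x - y); have := ler_norm (y - x); rewrite distrC => h2.
rewrite ler_norml /Num.min.
by apply/andP; split; case: (ltP 1 x) => ?; case: (ltP 1 y) => ?; lra.
Qed.

Lemma circle_lipschitz_bump k : circle_lipschitz (bump k).
Proof.
have lip z w : `|bump k z - bump k w| <= k.+1%:R * cabs (z - w).
  apply: le_trans (clamp_lipschitz _ _) _.
  have -> : k.+1%:R * cdist z - 1 - (k.+1%:R * cdist w - 1) = k.+1%:R * (cdist z - cdist w) by ring.
  by rewrite normrM ger0_norm// ler_wpM2l// cdist_lipschitz.
split.
  apply: measurable_funTS; apply: measurable_continuous_complex => z.
  apply/(@cvgrPdist_le _ _ _ (nbhs z) (nbhs_filter z)) => e e0.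
  apply/(@nbhs_cabsP _ z); exists (e / k.+1%:R); first by rewrite divr_gt0.
  move=> w; rewrite ltr_pdivlMr// => h; apply: le_trans (lip z w) _.
  by rewrite mulrC cabs_distC ltW.
exists k.+1%:R, 1; split => // z _.
by have /andP[h0 h1] := bump_itv k z; rewrite ger0_norm.
Qed.

End Bump.

Section DensityIdentity.
Variables (R : realType) (mu : probability R[i] R) (p : nat) (zeta : 'I_p -> R[i]).
Notation C := (circle R).
Notation leb := (@lebesgue_measure R).
Notation arcI := (`[0%R, (2 * pi)%R]%classic : set R).
Notation Z := (range zeta).
Hypotheses (muC : mu (circle R) = 1%E) (p0 : (0 < p)%N).
Variable V : R[i] -> R.
Notation DZ := (arcI `&` [set t | ~ Z (expi t)]).
Hypotheses (V0 : forall z, 0 <= V z)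
  (mV : @measurable_fun _ _ (measurableTypeR R) R DZ (fun t => V (expi t)))
  (ident : forall (g : R[i] -> R) d, circle_lipschitz g -> 0 < d ->
     (forall z, C z -> (exists k, cabs (z - zeta k) < d) -> g z = 0) ->
     rint (fun t => g (expi t) * V (expi t)) /\
     \int[mu]_(z in C) g z = rmean (fun t => g (expi t) * V (expi t))).

Let mC : measurable C := @measurable_circle R.
Let finC : (mu C < +oo)%E.
Proof. by rewrite muC ltry. Qed.

Lemma closed_range_zeta : open (~` Z).
Proof.
rewrite openC; have -> : Z = \bigcup_(k in [set: 'I_p]) [set zeta k].
  by apply/seteqP; split=> [_ [k _ <-]|z [k _ ->]]; exists k.
apply: closed_bigcup => [|k _]; first exact: finite_finset.
exact: closed_set1_complex.
Qed.

Lemma measurable_range_zeta : measurable Z.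
Proof.
by apply: closed_measurable_complex; rewrite -openC; exact: closed_range_zeta.
Qed.

Lemma measurable_DZ : @measurable _ (measurableTypeR R) DZ.
Proof.
apply: measurableI; first exact: measurable_arcI.
have := @measurable_expi R measurableT _ (measurableC measurable_range_zeta).
by rewrite setTI.
Qed.

(** The closed set [F] contains every [zeta k], so [h * bump F k] vanishes near them and [ident]
    applies; then [k] tends to infinity. The integrals are extended-valued because [V] has no bound
    near the [zeta k]. *)
Lemma density_identity (h : R[i] -> R) (U : set R[i]) : circle_lipschitz h ->
  (forall z, C z -> 0 <= h z) -> open U ->
  (\int[mu]_(z in C) (h z * \1_(U `\` Z) z)%:E =
   ((2 * pi)^-1)%:E *
     \int[leb]_(t in DZ) (h (expi t) * \1_(U `\` Z) (expi t) * V (expi t))%:E)%E.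
Proof.
move=> hh h0 oU; set F := ~` (U `\` Z).
have FZ k : F (zeta k) by move=> [_]; apply; exists k.
have F0 : F !=set0 by exists (zeta (Ordinal p0)).
have oF : open (~` F).
  by rewrite /F setCK setDE; apply: openI => //; exact: closed_range_zeta.
have EF z : \1_(~` F) z = \1_(U `\` Z) z :> R by rewrite /F setCK.
pose g k z := h z * bump F k z.
have gL k : circle_lipschitz (g k).
  by apply: circle_lipschitzM => //; exact: circle_lipschitz_bump.
have g0 k z : C z -> 0 <= g k z.
  by move=> zc; rewrite mulr_ge0 ?h0//; have /andP[] := bump_itv F k z.
have gz k z : C z -> (exists j, cabs (z - zeta j) < k.+1%:R^-1) -> g k z = 0.
  move=> zc [j hj]; rewrite /g (bump_eq0 (F := F))// ?mulr0//.
  by apply: le_trans (cdist_le z (FZ j)) (ltW hj).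
have k10 k : 0 < k.+1%:R^-1 :> R by rewrite invr_gt0.
have idk k := ident (gL k) (k10 k) (@gz k).
have eqk k : (\int[mu]_(z in C) (g k z)%:E = ((2 * pi)^-1)%:E *
    \int[leb]_(t in DZ) (g k (expi t) * V (expi t))%:E)%E.
  have [ri E] := idk k.
  have ig := circle_lipschitz_int muC (gL k).
  rewrite -[LHS]fineK; last exact: integrable_fin_num ig.
  rewrite -/(Rintegral mu C (g k)) E /rmean EFinM; congr (_ * _)%E.
  rewrite /Rintegral fineK; last exact: integrable_fin_num ri.
  rewrite integral_mkcondr; apply: eq_integral => t _; rewrite patchE.
  case: ifPn => //; rewrite notin_setE /= => /contrapT [j _ hj].
  have -> : g k (expi t) = 0 by rewrite /g bump_in ?mulr0// -hj; exact: FZ.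
  by rewrite mul0r.
have mg k : measurable_fun C (g k) by have [] := gL k.
have mge k : @measurable_fun _ _ (measurableTypeR R) R DZ (fun t => g k (expi t) * V (expi t)).
  apply: measurable_funM => //.
  exact: measurable_funTS (circle_lipschitz_measurable_expi (gL k)).
have cvL : (\int[mu]_(z in C) (g k z)%:E @[k --> \oo] -->
    \int[mu]_(z in C) (h z * \1_(U `\` Z) z)%:E)%E.
  have := @cvg_monotone_convergence _ _ _ mu C mC (fun k z => (g k z)%:E).
  have -> : (\int[mu]_(z in C) limn (fun k => (g k z)%:E) =
     \int[mu]_(z in C) (h z * \1_(U `\` Z) z)%:E)%E.
    apply: eq_integral => z _; apply/cvg_lim => //.
    apply: cvg_EFin; first by apply: nearW.
    by rewrite -EF; apply: cvgM; [exact: cvg_cst|exact: bump_cvg].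
  apply.
  - by move=> k; exact/measurable_EFinP.
  - by move=> k z zc; rewrite lee_fin g0.
  - move=> z zc k l kl; rewrite lee_fin ler_wpM2l ?h0//.
    exact: bump_nd.
have cvR : (\int[leb]_(t in DZ) (g k (expi t) * V (expi t))%:E @[k --> \oo] -->
    \int[leb]_(t in DZ) (h (expi t) * \1_(U `\` Z) (expi t) * V (expi t))%:E)%E.
  have := @cvg_monotone_convergence _ _ _ leb DZ measurable_DZ (fun k t => (g k (expi t) * V (expi t))%:E).
  have -> : (\int[leb]_(t in DZ) limn (fun k => (g k (expi t) * V (expi t))%:E) =
     \int[leb]_(t in DZ) (h (expi t) * \1_(U `\` Z) (expi t) * V (expi t))%:E)%E.
    apply: eq_integral => t _; apply/cvg_lim => //.
    apply: cvg_EFin; first by apply: nearW.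
    rewrite -EF; apply: cvgM; last exact: cvg_cst.
    by apply: cvgM; [exact: cvg_cst|exact: bump_cvg].
  apply.
  - by move=> k; exact/measurable_EFinP.
  - by move=> k t _; rewrite lee_fin mulr_ge0// g0//; exact: circle_expi.
  - move=> t _ k l kl; rewrite lee_fin ler_wpM2r// ler_wpM2l ?h0//.
      exact: circle_expi.
    exact: bump_nd.
have cvR' := cvgeZl (y := ((2 * pi)^-1)%:E) isT cvR.
have := cvL; under eq_fun do rewrite eqk; move=> cvL'.
exact: cvg_unique cvL' cvR'.
Qed.

(** The case [h = 1] of [density_identity] settles open sets, a pi-system generating the Borel sets;
    Dynkin's theorem extends the identity. *)
Lemma density_measure (A : set R[i]) : measurable A ->
  (mu (C `&` (A `\` Z)) = ((2 * pi)^-1)%:E *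
    \int[leb]_(t in DZ `&` expi (R:=R) @^-1` A) (V (expi t))%:E)%E.
Proof.
move=> mA; pose c := (2 * pi)^-1 : R.
pose P A := (mu (C `&` (A `\` Z)) = c%:E *
    \int[leb]_(t in DZ `&` expi (R:=R) @^-1` A) (V (expi t))%:E)%E.
rewrite -/(P A); move: A mA.
have c0 : 0 <= c by rewrite invr_ge0 ltW// twopi_gt0.
have mZ := measurable_range_zeta; have mDZ := measurable_DZ.
have mCA A : measurable A -> measurable (C `&` (A `\` Z)).
  by move=> mA; apply: measurableI => //; exact: measurableD.
have mE A : measurable A -> @measurable _ (measurableTypeR R) (DZ `&` expi (R:=R) @^-1` A).
  move=> mA; apply: measurableI => //.
  by have := @measurable_expi R measurableT _ mA; rewrite setTI.
have mVA A : measurable A -> @measurable_fun _ _ (measurableTypeR R) _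
    (DZ `&` expi (R:=R) @^-1` A) (fun t => (V (expi t))%:E).
  by move=> mA; apply/measurable_EFinP; apply: measurable_funS mV.
have Popen A : open A -> P A.
  move=> oA; have h1 : circle_lipschitz (fun=> 1 : R).
    split; first exact: measurable_cst.
    exists 1, 1; split => // [z _|z w _ _]; first by rewrite normr1.
    by rewrite subrr normr0 mul1r cabs_ge0.
  have := density_identity h1 (fun z _ => ler01) oA.
  under eq_integral do rewrite mul1r.
  rewrite integral_indic//; last by apply: measurableD => //; exact: open_measurable_complex.
  rewrite setIC => E; rewrite /P.
  rewrite E [in RHS]integral_mkcondr; congr (_ * _)%E; apply: eq_integral => t.
  rewrite inE => -[_ tZ]; rewrite patchE mul1r.
  case: ifPn => [|]; rewrite ?inE ?notin_setE /= => tA.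
    by rewrite indicE mem_set ?mul1r.
  by rewrite indicE memNset ?mul0r// => -[].
have PT : P setT by apply: Popen; exact: openT.
have fin A : measurable A -> mu (C `&` (A `\` Z)) \is a fin_num.
  by move=> mA; apply: fin_num_measure; exact: mCA.
have tsplit A : measurable A -> (\int[leb]_(t in DZ `&` expi (R:=R) @^-1` setT) (V (expi t))%:E =
   \int[leb]_(t in DZ `&` expi (R:=R) @^-1` A) (V (expi t))%:E +
   \int[leb]_(t in DZ `&` expi (R:=R) @^-1` (~` A)) (V (expi t))%:E)%E.
  move=> mA; rewrite -ge0_integral_setU//.
  - by rewrite -setIUr -preimage_setU setUv.
  - exact: mE.
  - by apply: mE; exact: measurableC.
  - rewrite -setIUr -preimage_setU setUv; exact: mVA.
  - by move=> t _; rewrite lee_fin.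
  - by apply/disj_setPS => t [[_ h1] [_ h2]].
apply: (@dynkin_induction _ _ (@open R[i]) P) => //.
- by move=> A B; exact: openI.
(* Complements are obtained by subtraction from the whole space, which is legitimate because [mu] is
   finite. *)
- move=> A mA PA; rewrite /P.
  have -> : C `&` (~` A `\` Z) = (C `&` (setT `\` Z)) `\` (C `&` (A `\` Z)).
    apply/seteqP; split=> z /=; first by move=> [zc [zA zZ]]; do !split => //; move=> [_ []].
    move=> [[zc [_ zZ]] h]; split => //; split => // zA; exact: h.
  have mD A1 B1 : measurable A1 -> measurable B1 ->
      (mu (A1 `\` B1) = mu A1 - mu (A1 `&` B1))%E.
    move=> mA1 mB1; apply: measureD => //.
    by rewrite ltey_eq fin_num_measure.
  rewrite mD; [|exact: mCA|exact: mCA].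
  rewrite (_ : _ `&` (C `&` (A `\` Z)) = C `&` (A `\` Z)); last first.
    by apply/seteqP; split=> z /= => [[_ []]|[zc [zA zZ]]].
  rewrite PT (tsplit A mA) muleDr//; last first.
    by rewrite ge0_adde_def// inE; apply: integral_ge0 => t _; rewrite lee_fin.
  by rewrite PA addeAC subee ?add0e// -PA fin.
- move=> F mF tF PF; rewrite /P.
  have -> : C `&` (\bigcup_k F k `\` Z) = \bigcup_k (C `&` (F k `\` Z)).
    apply/seteqP; split=> z /=; first by move=> [zc [[k _ Fz] zZ]]; exists k.
    by move=> [k _ [zc [Fz zZ]]]; split => //; split => //; exists k.
  have -> : DZ `&` expi (R:=R) @^-1` (\bigcup_k F k) = \bigcup_k (DZ `&` expi (R:=R) @^-1` (F k)).
    by rewrite preimage_bigcup setI_bigcupr.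
  have mB (G : (set R[i])^nat) : (forall k, measurable (G k)) -> trivIset setT G ->
      measurable (\bigcup_k G k) -> (mu (\bigcup_k G k) = \sum_(k <oo) mu (G k))%E.
    by move=> *; exact: measure_semi_bigcup.
  rewrite mB//; first last.
  + by apply: bigcup_measurable => k _; exact: mCA.
  + by move=> i j _ _ [z [[_ [zi _]] [_ [zj _]]]]; apply: tF => //; exists z.
  + by move=> k; exact: mCA.
  rewrite ge0_integral_bigcup//; first last.
  + by move=> i j _ _ [z [[_ zi] [_ zj]]]; apply: tF => //; exists (expi z).
  + by move=> t _; rewrite lee_fin.
  + rewrite -setI_bigcupr -preimage_bigcup; apply: mVA; exact: bigcup_measurable.
  + by move=> k; exact: mE.
  rewrite -nneseriesZl//; first by apply: eq_eseriesr => k _; exact: PF.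
  by move=> k _; apply: integral_ge0 => t _; rewrite lee_fin.
Qed.

End DensityIdentity.

Section Angle.
Variable R : realType.
Notation arcI := (`[0%R, (2 * pi)%R]%classic : set R).
Notation arcO := (`[0%R, (2 * pi)%R[%classic : set R).

(** The inverse of [expi] on [0, 2 pi[, used to turn a measurable set of angles into a Borel subset
    of the circle. *)
Definition carg (z : R[i]) : R :=
  if 0 <= complex.Im z then acos (complex.Re z) else 2 * pi - acos (complex.Re z).

Lemma carg_expi t : 0 <= t < 2 * pi -> carg (expi t) = t.
Proof.
move=> /andP[t0 t1]; rewrite /carg /=.
have [tp|pt] := leP t pi.
  by rewrite sin_ge0_pi ?t0// cosK// in_itv/= t0.
have s2 : t = - (2 * pi - t) + pi *+ 2 by rewrite -mulr_natl; ring.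
have s0 : 0 < 2 * pi - t < pi by apply/andP; split; have := @pi_gt0 R; lra.
have -> : cos t = cos (2 * pi - t) by rewrite {1}s2 (@cosD2pi R) cosN.
have -> : sin t = - sin (2 * pi - t) by rewrite {1}s2 (@sinD2pi R) sinN.
rewrite oppr_ge0 leNgt sin_gt0_pi//=; move: s0 => /andP[h1 h2].
by rewrite cosK ?in_itv/= ?(ltW h1) ?(ltW h2)//; ring.
Qed.

Lemma measurable_carg : measurable_fun (circle R) carg.
Proof.
(* Clamping to [-1, 1] makes [acos] nonincreasing on the whole line, hence measurable; on the circle
   the clamp does nothing. *)
pose cl (x : R) := Num.max (-1) (Num.min 1 x).
have clI x : -1 <= cl x <= 1.
  by rewrite /cl le_max lexx/= ge_max ge_min lexx/=; lra.
have acl : measurable_fun setT (fun x => acos (cl x)).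
  apply: nonincreasing_measurable => // x y xy.
  have cxy : cl x <= cl y by apply: le_max2 => //; exact: le_min2.
  rewrite leNgt; apply/negP => h.
  have ix := clI x; have iy := clI y.
  have bx := acos_ge0 ix; have by_ := acos_ge0 iy.
  have cx := acos_lepi ix; have cy := acos_lepi iy.
  have := @ltr_cos R (acos (cl x)) (acos (cl y)).
  rewrite !in_itv/= bx by_ cx cy => /(_ isT isT).
  by rewrite !acosK ?in_itv//= h ltNge cxy.
have mRe : measurable_fun setT (@complex.Re R).
  by apply: measurable_continuous_complex; exact: continuous_cRe.
have mIm : measurable_fun setT (@complex.Im R).
  by apply: measurable_continuous_complex; exact: continuous_cIm.
have ma := measurableT_comp acl mRe.
have := measurable_fun_ifT (measurable_fun_ler (@measurable_cst _ _ R[i] R setT 0) mIm)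
   ma (measurable_funB (@measurable_cst _ _ R[i] R setT (2 * pi)) ma).
move=> /(measurable_funTS (D := circle R)); apply: eq_measurable_fun => z.
rewrite inE => /circleP z1; have := cabs_Re z; rewrite z1 ler_norml => /andP[h1 h2].
have E : cl (complex.Re z) = complex.Re z by rewrite /cl min_r// max_r.
by rewrite /carg /= E.
Qed.

(** [carg] allows one angle per [zeta k] in [0, 2 pi[, so [A] is finite; the endpoint 2 pi, which
    repeats the angle 0, has to be listed apart. *)
Lemma null_expi_range p (zeta : 'I_p -> R[i]) (A : set R) : A `<=` arcI ->
  (forall t, A t -> range zeta (expi t) \/ t = 2 * pi) ->
  @lebesgue_measure R A = 0%E.
Proof.
move=> AI hA; apply: countable_lebesgue_measure0; apply: finite_set_countable.
apply: (@sub_finite_set _ _ (range (carg \o zeta) `|` [set 2 * pi])).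
  move=> t At; have [->|nt] := eqVneq t (2 * pi); first by right.
  have [[k _ hk]|h] := hA t At; last by rewrite h eqxx in nt.
  left; exists k => //=; rewrite hk carg_expi//.
  have := AI t At; rewrite /= in_itv/= => /andP[-> h] /=.
  by rewrite lt_neqAle nt.
rewrite finite_setU; split; last exact: finite_set1.
by apply: finite_image; exact: finite_finset.
Qed.

End Angle.

Section Decomposition.
Variables (R : realType) (mu : probability R[i] R) (p : nat) (zeta : 'I_p -> R[i]).
Notation C := (circle R).
Notation leb := (@lebesgue_measure R).
Notation arcI := (`[0%R, (2 * pi)%R]%classic : set R).
Notation arcO := (`[0%R, (2 * pi)%R[%classic : set R).
Notation Z := (range zeta).
Notation DZ := (arcI `&` [set t | ~ Z (expi t)]).
Notation DO := (arcO `&` [set t | ~ Z (expi t)]).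
Hypothesis muC : mu (circle R) = 1%E.
Variable V : R[i] -> R.
Hypotheses (V0 : forall z, 0 <= V z)
  (mV : @measurable_fun _ _ (measurableTypeR R) R DZ (fun t => V (expi t)))
  (dens : forall A : set R[i], measurable A ->
    (mu (C `&` (A `\` Z)) = ((2 * pi)^-1)%:E *
    \int[leb]_(t in DZ `&` expi (R:=R) @^-1` A) (V (expi t))%:E)%E).
Variables (w : R -> R) (mus : {measure set R[i] -> \bar R}).
Hypothesis dec : lebesgue_decomposition mu w mus.

Let mC : measurable C := @measurable_circle R.
Let mZ : measurable Z := measurable_range_zeta zeta.
Let c0 : 0 < (2 * pi)^-1 :> R.
Proof. by rewrite invr_gt0 twopi_gt0. Qed.

Let mw : @measurable_fun _ _ (measurableTypeR R) R arcO w.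
Proof. by have [] := dec. Qed.

Let w0 t : arcO t -> 0 <= w t.
Proof. by have [_ h _ _] := dec => ht; apply: h; rewrite inE. Qed.

Let muE A : measurable A -> (mu A = ((2 * pi)^-1)%:E *
    \int[leb]_(t in arcO `&` expi (R:=R) @^-1` A) (w t)%:E + mus A)%E.
Proof. by have [_ _ h _] := dec; exact: h. Qed.

Let mDO : @measurable _ (measurableTypeR R) DO.
Proof.
apply: measurableI; first exact: measurable_itv.
have := @measurable_expi R measurableT _ (measurableC mZ).
by rewrite setTI.
Qed.

Let mOA A : measurable A -> @measurable _ (measurableTypeR R) (arcO `&` expi (R:=R) @^-1` A).
Proof.
move=> mA; apply: measurableI; first exact: measurable_itv.
by have := @measurable_expi R measurableT _ mA; rewrite setTI.
Qed.

Let mIA A : measurable A -> @measurable _ (measurableTypeR R) (DZ `&` expi (R:=R) @^-1` A).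
Proof.
move=> mA; apply: measurableI; first exact: measurable_DZ.
by have := @measurable_expi R measurableT _ mA; rewrite setTI.
Qed.

Let int_w_ge0 A : (0 <= ((2 * pi)^-1)%:E *
    \int[leb]_(t in arcO `&` expi (R:=R) @^-1` A) (w t)%:E)%E.
Proof.
rewrite mule_ge0 ?lee_fin ?(ltW c0)//; apply: integral_ge0 => t [tO _].
by rewrite lee_fin w0.
Qed.

Let mus_le A : measurable A -> (mus A <= mu A)%E.
Proof. by move=> mA; rewrite muE// leeDr. Qed.

Let mu_nC A : measurable A -> A `<=` ~` C -> mu A = 0%E.
Proof.
move=> mA AC; have nC : mu (~` C) = 0%E by rewrite probability_setC// muC subee.
by apply: (subset_measure0 mA (measurableC mC) AC).
Qed.

(** [mus] is carried by a set [N] of arc measure 0. Off the [zeta k] the measure [mu] has a density,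
    so it gives [N] no mass there, and [mus] is dominated by [mu]. *)
Lemma singular_off_range : mus (~` Z) = 0%E.
Proof.
have [_ _ _ [N [mN aN musN]]] := dec.
have mNZ : measurable (N `\` Z) by exact: measurableD.
have muNZ : mu (N `\` Z) = 0%E.
  have h1 : mu (C `&` (N `\` Z)) = 0%E.
    rewrite dens// null_set_integral ?mule0//; first exact: mIA.
      apply/measurable_EFinP; apply: measurable_funS mV; first exact: measurable_DZ.
      exact: subIsetl.
    have aN0 : leb (arcO `&` expi (R:=R) @^-1` N) = 0%E.
      move: aN; rewrite /arc_measure => /eqP; rewrite mule_eq0 => /orP[/eqP[/eqP]|/eqP//].
      by rewrite gt_eqF.
    have h2 : leb ([set 2 * pi] : set R) = 0%E by rewrite lebesgue_measure_set1.
    apply: (@subset_measure0 _ (measurableTypeR R) _ leb _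
       ((arcO `&` expi (R:=R) @^-1` N) `|` [set 2 * pi])).
    + exact: mIA.
    + by apply: measurableU; [exact: mOA|exact: measurable_set1].
    + move=> t [[tI _] tN]; have [->|nt] := eqVneq t (2 * pi); [by right|left; split => //].
      by move: tI; rewrite /= !in_itv/= => /andP[-> h] /=; rewrite lt_neqAle nt.
    + apply/eqP; rewrite eq_le measure_ge0 andbT.
      have := measureU2 leb (mOA mN) (measurable_set1 (2 * pi)).
      by rewrite [X in (_ <= X + _)%E]aN0 [X in (_ <= _ + X)%E]h2 adde0.
  apply/eqP; rewrite eq_le measure_ge0 andbT.
  have mCN := measurableI _ _ mC mNZ; have mCN' := measurableI _ _ (measurableC mC) mNZ.
  have := measureU2 mu mCN mCN'; rewrite -setIUl setUv setTI.
  move/le_trans; apply; rewrite [X in (X + _)%E]h1 add0e.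
  by rewrite [X in (X <= _)%E](mu_nC mCN')//; exact: subIsetl.
have h3 : mus (N `\` Z) = 0%E.
  by apply/eqP; rewrite eq_le measure_ge0 andbT -muNZ; exact: mus_le.
have mNC := measurableC mN.
apply/eqP; rewrite eq_le measure_ge0 andbT.
apply: (@le_trans _ _ (mus ((~` N) `|` (N `\` Z)))).
  apply: le_measure; rewrite ?inE//; [exact: measurableC|exact: measurableU|].
  by move=> z zZ; have [zN|zN] := pselect (N z); [right|left].
apply: le_trans (measureU2 mus mNC mNZ) _.
by rewrite [X in (X + _)%E]musN [X in (_ + X)%E]h3 adde0.
Qed.

Lemma singular_pure_point : pure_point mus.
Proof.
move=> A mA; have mAZ := measurableI _ _ mA mZ.
have mAnZ : measurable (A `&` ~` Z) by apply: measurableI => //; exact: measurableC.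
have s1 z : ~ Z z -> mus [set z] = 0%E.
  move=> nz; apply: (subset_measure0 (measurable_set1_complex z) (measurableC mZ)) => //.
    by move=> _ ->.
  exact: singular_off_range.
have fZ : finite_set (A `&` Z).
  apply: (@sub_finite_set _ _ Z); first exact: subIsetr.
  by apply: finite_image; exact: finite_finset.
have -> : (\esum_(z in A) mus [set z] = \esum_(z in A `&` Z) mus [set z])%E.
  rewrite (esum_mkcondr _ Z); apply: eq_esum => z Az; case: ifPn => //.
  by rewrite notin_setE => /s1.
have -> : mus A = mus (A `&` Z).
  apply/eqP; rewrite eq_le; apply/andP; split; last first.
    by apply: le_measure; rewrite ?inE//; exact: subIsetl.
  have := measureU2 mus mAZ mAnZ; rewrite -setIUr setUv setIT.
  move/le_trans; apply; rewrite -[leRHS]adde0 leeD2l//.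
  rewrite le_eqVlt; apply/orP; left; apply/eqP.
  apply: (subset_measure0 mAnZ (measurableC mZ)) => //.
  exact: singular_off_range.
rewrite esum_fset//.
have E : A `&` Z = \bigcup_(z in A `&` Z) [set z].
  by apply/seteqP; split=> [z zA|z [y yA ->]//]; exists z.
rewrite {1}E measure_fin_bigcup//; first by move=> x y _ _ [z [-> ->]].
by move=> z _; exact: measurable_set1_complex.
Qed.

(** Off the [zeta k] the singular part vanishes, so both densities have the same integral over every
    measurable set of angles; finiteness of [mu] provides the integrability of [w] behind this
    comparison. *)
Lemma ac_weight_ae : ae_eq leb DO (EFin \o w) (fun t => (V (expi t))%:E).
Proof.
have fO : (\int[leb]_(t in arcO) (w t)%:E < +oo)%E.
  have := muE (@measurableT _ R[i]); rewrite preimage_setT setIT => E.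
  have h : (((2 * pi)^-1)%:E * \int[leb]_(t in arcO) (w t)%:E <= 1)%E.
    apply: (@le_trans _ _ (mu setT)); last exact: probability_le1.
    by rewrite E leeDl.
  have f0 : (0 <= \int[leb]_(t in arcO) (w t)%:E)%E.
    by apply: integral_ge0 => t tO; rewrite lee_fin w0.
  move: h f0; case: (\int[leb]_(t in arcO) (w t)%:E)%E => [r _ _|h _|_ //].
    exact: ltry.
  by move: h; rewrite gt0_muley ?lte_fin.
have fwO : leb.-integrable arcO (EFin \o w).
  apply/integrableP; split; first exact/measurable_EFinP.
  apply: le_lt_trans fO; rewrite le_eqVlt; apply/orP; left; apply/eqP.
  by apply: eq_integral => t; rewrite inE => tO /=; rewrite ger0_norm// w0.
have fw : leb.-integrable DO (EFin \o w).
  exact: integrableS fwO.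
have mVO : @measurable_fun _ _ (measurableTypeR R) _ DO (fun t => (V (expi t))%:E).
  apply/measurable_EFinP; apply: measurable_funS mV; first exact: measurable_DZ.
  move=> t [+ tZ]; rewrite /= !in_itv/= => /andP[-> h]; split => //=; exact: ltW.
apply: (integral_ae_eq mDO fw mVO) => B BD mB.
(* The identities for [mu] speak of Borel sets of the plane; this one has exactly the angles [B] in
   [0, 2 pi[. *)
pose A := C `&` @carg R @^-1` B.
have mA : measurable A := @measurable_carg R mC B mB.
have mAZ : measurable (A `\` Z) by exact: measurableD.
have cB t : arcO t -> A (expi t) <-> B t.
  rewrite /= in_itv/= => tO; split=> [[_ /=]|Bt]; first by rewrite carg_expi.
  by split; [exact: circle_expi|rewrite /= carg_expi].
have E1 : arcO `&` expi (R:=R) @^-1` (A `\` Z) = B.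
  apply/seteqP; split=> [t [tO [/(cB t tO)]]//|t Bt].
  have [tO tZ] := BD t Bt; split => //; split => //; exact/(cB t tO).
have E2 : (DZ `&` expi (R:=R) @^-1` A) `\ (2 * pi) = B.
  apply/seteqP; split=> [t [[[tI tZ] tA] /= tn]|t Bt].
    apply/(cB t _) => //; move: tI; rewrite /= !in_itv/= => /andP[-> h] /=.
    by rewrite lt_neqAle h andbT; apply/eqP.
  have [tO tZ] := BD t Bt; move: (tO); rewrite /= in_itv/= => /andP[t0 t1].
  split; last by move=> /= h; move: t1; rewrite h ltxx.
  split; last exact/(cB t tO).
  by split => //=; rewrite in_itv/= t0 ltW.
have m1 : mu (A `\` Z) = (((2 * pi)^-1)%:E * \int[leb]_(t in B) (w t)%:E)%E.
  rewrite muE// E1 (_ : mus (A `\` Z) = 0%E) ?adde0//.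
  apply: (subset_measure0 mAZ (measurableC mZ)); first by move=> z [].
  exact: singular_off_range.
have m2 : mu (A `\` Z) = (((2 * pi)^-1)%:E * \int[leb]_(t in B) (V (expi t))%:E)%E.
  have -> : A `\` Z = C `&` (A `\` Z) by apply/seteqP; split=> z [] // [].
  rewrite dens// -(@integral_setD1 _ _ (2 * pi)) ?E2//.
  by apply: measurable_funS mVO.
have key (x : \bar R) : (x = (2 * pi)%:E * (((2 * pi)^-1)%:E * x))%E.
  by rewrite muleA -EFinM mulfV ?mul1e// gt_eqF// twopi_gt0.
rewrite [LHS]key [RHS]key; congr (_ * _)%E.
by rewrite -[LHS]m1 m2.
Qed.

End Decomposition.

(* With [x] the ratio of the limit weight to the n-th weight, the mean of
   [x - 1 - ln x] is at most [ln (nu n) - ln nuoo], which tends to 0. *)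
Lemma abs_ln_le (R : realType) (x d : R) : 0 < x -> 0 < d < 1 ->
  `|ln x| <= (x - 1 - ln x) / d + d.
Proof.
move=> x0 /andP[d0 d1].
(* The sum of [ln (x / a) <= x / a - 1] and [ln a <= a - 1], multiplied by [a]. The values
   [a = 1 + d] and [a = 1 - d] bound [ln x] from above and from below. *)
have h (a : R) : 0 < a -> a * ln x <= x - a * (2 - a).
  move=> a0; have := ln_sub1 (divr_gt0 x0 a0).
  rewrite lnM ?posrE ?invr_gt0// lnV ?posrE// => h1.
  have h2 := ln_sub1 a0.
  have : ln x <= x / a - 1 + (a - 1) by lra.
  rewrite -(ler_pM2l a0) => /le_trans; apply.
  by rewrite le_eqVlt; apply/orP; left; apply/eqP; field; rewrite gt_eqF.
have h1 := h (1 + d) (addr_gt0 ltr01 d0).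
have d1' : 0 < 1 - d by rewrite subr_gt0.
have h2 := h _ d1'.
rewrite -(ler_pM2l d0) -{1}(gtr0_norm d0) -normrM mulrDr mulrCA mulfV ?gt_eqF// mulr1.
by rewrite ler_norml; apply/andP; split; nra.
Qed.

(** The final arithmetic of [log_L1], with the integrals replaced by variables: [a] and [b] are
    those of [X n] and [ln VT], [c = 2 pi], [f = d^-1], and [u], [v] are [ln (nu n)], [ln nuoo]. *)
Lemma log_gap_arith (R : realType) (a b c d f u v : R) : a <= c -> c * v <= b -> 0 < f ->
  f * (a - 1 * c - (b - c * u)) + d * c <= c * ((u - v) * f + d).
Proof. by move=> *; nra. Qed.

Lemma natrC (R : realType) n : (n%:R : R)%:C = n%:R :> R[i].
Proof. by rewrite rmorphMn /= rmorph1. Qed.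

Lemma halfC (R : realType) : (2^-1 : R)%:C = 2^-1 :> R[i].
Proof. by rewrite -(natrC R 2) fmorphV. Qed.

(** * Convergence of the logarithms in L1 *)

Section LogLimit.
Variables (R : realType) (F S : nat -> {poly R[i]}) (alpha : nat -> R[i]) (nu : nat -> R).
Notation leb := (@lebesgue_measure R).
Notation arcI := (`[0%R, (2 * pi)%R]%classic : set R).
Hypotheses (F0 : forall z, (F 0).[z] = 1) (S0 : forall z, (S 0).[z] = 1)
  (FS : forall n z, (F n.+1).[z] = z * (F n).[z] - (alpha n)^* * (S n).[z])
  (SS : forall n z, (S n.+1).[z] = (S n).[z] - alpha n * (z * (F n).[z]))
  (alpha1 : forall n, cabs (alpha n) < 1)
  (nu0 : nu 0 = 1) (nuS : forall n, nu n.+1 = (1 - cabs (alpha n) ^+ 2) * nu n).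
Variables (nuoo : R) (D : set R) (VT : R -> R).
Hypotheses (nuoo0 : 0 < nuoo) (nu_cvg : nu n @[n --> \oo] --> nuoo)
  (mD : @measurable _ (measurableTypeR R) D) (DI : D `<=` arcI)
  (nullD : leb (arcI `\` D) = 0%E)
  (VT0 : forall t, D t -> 0 < VT t)
  (mVT : @measurable_fun _ _ (measurableTypeR R) R D VT)
  (cvW : forall t, D t -> weight S nu n t @[n --> \oo] --> VT t)
  (jensen : forall n, (\int[leb]_(t in D) (VT t / weight S nu n t)%:E <= (2 * pi)%:E)%E).

Notation W := (weight S nu).
Let W0 n t : 0 < W n t := weight_gt0 F0 S0 FS SS alpha1 nu0 nuS n t.
Let nup n : 0 < nu n := nu_pos alpha1 nu0 nuS n.
Let iW n := weight_int F0 S0 FS SS alpha1 nu0 nuS n.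
Let ilW n := log_weight_int F0 S0 FS SS alpha1 nu0 nuS n.
Let mW n := weight_mean F0 S0 FS SS alpha1 nu0 nuS n.
Let mlW n := log_weight_mean F0 S0 FS SS alpha1 nu0 nuS n.
Let p2 : 0 < 2 * pi :> R := twopi_gt0 R.

Lemma rint_D f : rint f -> leb.-integrable D (EFin \o f) /\
  (\int[leb]_(t in D) (f t)%:E = (2 * pi * rmean f)%:E)%E.
Proof.
move=> hf; have ifD : leb.-integrable D (EFin \o f).
  by apply: integrableS hf => //; exact: measurable_arcI.
split => //; have mN := measurableD (@measurable_arcI R) mD.
have := negligible_integral mN (@measurable_arcI R) hf nullD.
have -> : arcI `\` (arcI `\` D) = D.
  by rewrite setDD; apply/seteqP; split=> [t []//|t Dt]; split => //; exact: DI.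
move=> <-; rewrite /rmean mulrA mulfV ?mul1r ?gt_eqF//.
by rewrite /Rintegral fineK//; exact: integrable_fin_num hf.
Qed.

Let fatou_fun e n t : R := e * W n t - 1 - ln (e * W n t).

(* Fatou for [e W_n - 1 - ln (e W_n) >= 0]: [e = 1] makes the limit weight
   log-integrable, and [e -> 0] gives [log_limit_lower]. *)
Lemma fatou_bound e : 0 < e -> (\int[leb]_(t in D) (e * VT t - 1 - ln (e * VT t))%:E <=
  (2 * pi * (e - 1 - ln e - ln nuoo))%:E)%E.
Proof.
move=> e0.
have fE n t : fatou_fun e n t = e * W n t + (- (1 + ln e)) - ln (W n t).
  by rewrite /fatou_fun lnM ?posrE//; ring.
have iff n : rint (fatou_fun e n).
  have : rint (fun t => e * W n t + (- (1 + ln e)) - ln (W n t)).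
    by apply: rintB => //; apply: rintD; [exact: rintZ|exact: rint_cst].
  by apply: eq_integrable; [exact: measurable_arcI|move=> t _ /=; rewrite fE].
have mf n : rmean (fatou_fun e n) = e - 1 - ln e - ln (nu n).
  rewrite (eq_rmean (fE n)) rmeanB//; last by apply: rintD; [exact: rintZ|exact: rint_cst].
  rewrite rmeanD; [|exact: rintZ|exact: rint_cst].
  by rewrite rmeanZ// mW rmean_cst mlW; ring.
have := @fatou _ _ _ leb D mD (fun n t => (fatou_fun e n t)%:E).
have -> : (\int[leb]_(t in D) limn_einf (fun n => (fatou_fun e n t)%:E) =
    \int[leb]_(t in D) (e * VT t - 1 - ln (e * VT t))%:E)%E.
  apply: eq_integral => t; rewrite inE => Dt; apply: (cvg_limn_einf_sup _).1.
  apply: cvg_EFin; first by apply: nearW.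
  have c1 : e * W n t @[n --> \oo] --> e * VT t by apply: cvgM; [exact: cvg_cst|exact: cvW].
  apply: cvgB; first by apply: cvgB => //; exact: cvg_cst.
  apply: (@continuous_cvg _ _ _ _ _ (fun n => e * W n t) (@ln R) (e * VT t) _ c1).
  by apply: continuous_ln; rewrite mulr_gt0 ?VT0.
have -> : limn_einf (fun n => \int[leb]_(t in D) (fatou_fun e n t)%:E)%E =
    (2 * pi * (e - 1 - ln e - ln nuoo))%:E.
  apply: (cvg_limn_einf_sup _).1.
  under eq_fun do rewrite (rint_D (iff _)).2 mf.
  apply: cvg_EFin; first by apply: nearW.
  apply: cvgM; first exact: cvg_cst.
  apply: cvgB; first exact: cvg_cst.
  by apply: (@continuous_cvg _ _ _ _ _ nu (@ln R) nuoo _ nu_cvg); exact: continuous_ln.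
apply.
- by move=> n; have /integrableP[] := (rint_D (iff n)).1.
- by move=> n t _; rewrite lee_fin subr_ge0; apply: ln_sub1; rewrite mulr_gt0.
Qed.

Let mlnVT : @measurable_fun _ _ (measurableTypeR R) R D (fun t => ln (VT t)).
Proof. exact: (measurableT_comp (@measurable_ln R) mVT). Qed.

Let leb_D : leb D = (2 * pi)%:E.
Proof.
have [_] := rint_D (rint_cst 1); rewrite rmean_cst mulr1 => <-.
by rewrite integral_cst// mul1e.
Qed.

Let icst c : leb.-integrable D (EFin \o (fun=> c)) := (rint_D (rint_cst c)).1.

Let int_gap : leb.-integrable D (EFin \o (fun t => VT t - 1 - ln (VT t))).
Proof.
have := fatou_bound ltr01; under eq_integral do rewrite mul1r.
move=> h; apply/integrableP; split.
  apply/measurable_EFinP; apply: measurable_funB => //.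
  by apply: measurable_funB => //; exact: measurable_cst.
apply: le_lt_trans (ltry (2 * pi * (1 - 1 - ln 1 - ln nuoo))).
apply: le_trans h; rewrite le_eqVlt; apply/orP; left; apply/eqP.
apply: eq_integral => t; rewrite inE => Dt /=.
by rewrite ger0_norm// subr_ge0; apply: ln_sub1; exact: VT0.
Qed.

Lemma int_VT : leb.-integrable D (EFin \o VT).
Proof.
(* From [ln (V / 2) <= V / 2 - 1] follows [V <= 2 (V - 1 - ln V) + 2 ln 2], an integrable
   majorant. *)
have h := integrableDR mD (integrableZlR mD 2 int_gap) (icst (2 * ln 2)).
apply: (le_integrable mD) h; first exact/measurable_EFinP.
move=> t Dt /=; rewrite lee_fin; have v0 := VT0 Dt.
rewrite (gtr0_norm v0); apply: le_trans (ler_norm _).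
have := ln_sub1 (divr_gt0 v0 (ltr0n _ 2)).
rewrite lnM ?posrE ?invr_gt0// lnV ?posrE//.
by lra.
Qed.

Lemma int_lnVT : leb.-integrable D (EFin \o (fun t => ln (VT t))).
Proof.
have := integrableBR mD (integrableBR mD int_VT (icst 1)) int_gap.
apply: eq_integrable => // t _ /=; congr EFin; ring.
Qed.

Lemma log_limit_lower : 2 * pi * ln nuoo <= \int[leb]_(t in D) ln (VT t).
Proof.
set I := \int[leb]_(t in D) ln (VT t); set J := \int[leb]_(t in D) VT t.
have key e : 0 < e -> 2 * pi * ln nuoo + e * (J - 2 * pi) <= I.
  move=> e0; have := fatou_bound e0.
  have E t : D t -> e * VT t - 1 - ln (e * VT t) = e * VT t - (1 + ln e) - ln (VT t).
    by move=> Dt; rewrite lnM ?posrE ?VT0//; ring.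
  have i1 := integrableZlR mD e int_VT.
  have i2 := integrableBR mD i1 (icst (1 + ln e)).
  have i3 := integrableBR mD i2 int_lnVT.
  have -> : (\int[leb]_(t in D) (e * VT t - 1 - ln (e * VT t))%:E =
     (\int[leb]_(t in D) (e * VT t - (1 + ln e) - ln (VT t)))%:E)%E.
    rewrite /Rintegral fineK; last exact: integrable_fin_num i3.
    by apply: eq_integral => t; rewrite inE => Dt; rewrite E.
  rewrite lee_fin (RintegralB mD i2 int_lnVT) (RintegralB mD i1 (icst _)).
  rewrite (RintegralZl e mD int_VT) -/I -/J Rintegral_cst//.
  have -> : fine (leb D) = 2 * pi by rewrite leb_D.
  by lra.
apply/ler_addgt0Pr => e e0.
(* The inequality [key] loses [e (2 pi - J)]. This is no loss if [J >= 2 pi]; if mass has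
   disappeared in the limit, the parameter is scaled to make the loss exactly the prescribed one. *)
have [Jp|Jn] := leP (2 * pi) J.
  by have := key 1 ltr01; lra.
have d0 : 0 < 2 * pi - J by rewrite subr_gt0.
have := key (e / (2 * pi - J)) (divr_gt0 e0 d0).
have -> : e / (2 * pi - J) * (J - 2 * pi) = - e.
  by rewrite -[J - _]opprB mulrN divfK// gt_eqF.
by lra.
Qed.

Let X n t : R := VT t / W n t.
Let X0 n t : D t -> 0 < X n t.
Proof. by move=> Dt; rewrite divr_gt0 ?VT0. Qed.

Let lnX n t : D t -> ln (X n t) = ln (VT t) - ln (W n t).
Proof. by move=> Dt; rewrite lnM ?posrE ?invr_gt0 ?VT0// lnV ?posrE. Qed.

(** The mean of [X n] is bounded by [jensen] and that of its logarithm by [log_limit_lower]; the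
    free [d] is later balanced against [ln (nu n) - ln nuoo]. *)
Lemma log_L1 d n : 0 < d < 1 ->
  leb.-integrable D (EFin \o (fun t => ln (VT t) - ln (W n t))) /\
  \int[leb]_(t in D) `|ln (VT t) - ln (W n t)| <=
    2 * pi * ((ln (nu n) - ln nuoo) / d + d).
Proof.
move=> d01; have /andP[d0 d1] := d01.
have iX : leb.-integrable D (EFin \o X n).
  apply/integrableP; split.
    apply/measurable_EFinP; apply: measurable_funM => //.
    apply: measurable_fun_inv_gt0 => //.
    by have /integrableP[/measurable_EFinP] := (rint_D (iW n)).1.
  apply: le_lt_trans (ltry (2 * pi)); apply: le_trans (jensen n).
  rewrite le_eqVlt; apply/orP; left; apply/eqP.
  by apply: eq_integral => t; rewrite inE => Dt /=; rewrite gtr0_norm// X0.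
have ilX : leb.-integrable D (EFin \o (fun t => ln (VT t) - ln (W n t))).
  exact: (integrableBR mD int_lnVT (rint_D (ilW n)).1).
split => //.
have iXB := integrableBR mD iX (icst 1).
have iXg := integrableBR mD iXB ilX.
have ib := integrableDR mD (integrableZlR mD d^-1 iXg) (icst d).
apply: (@le_trans _ _ (\int[leb]_(t in D) (d^-1 * (X n t - 1 - (ln (VT t) - ln (W n t))) + d))).
  apply: le_Rintegral => //; first exact: integrable_norm.
  by move=> t Dt; rewrite -lnX// mulrC; apply: abs_ln_le => //; exact: X0.
have eD : fine (leb D) = 2 * pi by rewrite leb_D.
rewrite (RintegralD mD (integrableZlR mD d^-1 iXg) (icst d)) Rintegral_cst//.
rewrite (RintegralZl d^-1 mD iXg) (RintegralB mD iXB ilX) (RintegralB mD iX (icst 1)).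
rewrite (RintegralB mD int_lnVT (rint_D (ilW n)).1) Rintegral_cst//.
have JX : \int[leb]_(t in D) X n t <= 2 * pi.
  rewrite -lee_fin /Rintegral fineK; first exact: jensen.
  exact: integrable_fin_num iX.
have JW : \int[leb]_(t in D) ln (W n t) = 2 * pi * ln (nu n).
  by rewrite /Rintegral (rint_D (ilW n)).2 /= mlW.
have JV := log_limit_lower; rewrite JW.
have b0 : 0 < d^-1 by rewrite invr_gt0.
move: (fine _) eD => m ->; by apply: log_gap_arith.
Qed.

(** To be instantiated with [ln w]: it is integrated over the whole closed interval in [szego_fun],
    and is known to equal [ln VT] only almost everywhere on [D]. *)
Variable LV : R -> R.
Hypotheses (mLV : @measurable_fun _ _ (measurableTypeR R) R arcI LV)
  (LVE : {ae leb, forall t, D t -> LV t = ln (VT t)}).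

Let mAD := measurableD (@measurable_arcI R) mD.

Lemma integral_ae_D (f g : R -> R) :
  @measurable_fun _ _ (measurableTypeR R) R arcI f ->
  @measurable_fun _ _ (measurableTypeR R) R D g ->
  {ae leb, forall t, D t -> f t = g t} ->
  (\int[leb]_(t in arcI) `|f t|%:E = \int[leb]_(t in D) `|g t|%:E)%E.
Proof.
move=> mf mg fg.
have mf' : @measurable_fun _ _ (measurableTypeR R) R D f by apply: measurable_funS mf => //; exact: measurable_arcI.
have mf1 : @measurable_fun _ _ (measurableTypeR R) (\bar R) arcI (fun t => `|f t|%:E).
  by apply/measurable_EFinP; exact: measurableT_comp.
have f1 t : arcI t -> (0 <= `|f t|%:E)%E by rewrite lee_fin.
rewrite (ge0_negligible_integral mAD (@measurable_arcI R) mf1 f1 nullD).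
have -> : arcI `\` (arcI `\` D) = D.
  by rewrite setDD; apply/seteqP; split=> [t []//|t Dt]; split => //; exact: DI.
apply: ge0_ae_eq_integral => //.
- by apply/measurable_EFinP; exact: measurableT_comp.
- by apply/measurable_EFinP; exact: measurableT_comp.
- by case: fg => N [mN N0 h]; exists N; split=> // t nP; apply: h => /= fgt; apply: nP => Dt; rewrite fgt.
Qed.

Lemma rint_LV : rint LV.
Proof.
apply/integrableP; split; first exact/measurable_EFinP.
rewrite (integral_ae_D mLV mlnVT LVE).
by have /integrableP[] := int_lnVT.
Qed.

Lemma rint_mul_bounded (h : R -> R) (f : R -> R) (K : R) :
  @measurable_fun _ _ (measurableTypeR R) R arcI h -> (forall t, `|h t| <= K) ->
  rint f -> rint (fun t => h t * f t).
Proof.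
move=> mh hK hf; have hK' := rintZ K hf; apply: (le_integrable (@measurable_arcI R)) hK'.
  apply/measurable_EFinP; apply: measurable_funM => //.
  by have /integrableP[/measurable_EFinP] := hf.
by move=> t _ /=; rewrite lee_fin !normrM ler_wpM2r// (le_trans (hK t))// ler_norm.
Qed.

Lemma angular_int_kernelM (z : R[i]) f : cabs z < 1 -> rint f ->
  angular_int (fun t => szego_kernel z t * (f t)%:C).
Proof.
move=> z1 hf; have [[mr mi] [M hM]] := angular_bounded_kernel z1.
split.
  have : rint (fun t => complex.Re (szego_kernel z t) * f t).
    by apply: (@rint_mul_bounded _ _ M) => // t; exact: le_trans (cabs_Re _) (hM t).
  by apply: eq_integrable; [exact: measurable_arcI|move=> t _ /=; rewrite [in RHS]mulrC cReMr mulrC].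
have : rint (fun t => complex.Im (szego_kernel z t) * f t).
  by apply: (@rint_mul_bounded _ _ M) => // t; exact: le_trans (cabs_Im _) (hM t).
by apply: eq_integrable; [exact: measurable_arcI|move=> t _ /=; rewrite [in RHS]mulrC cImMr mulrC].
Qed.

Lemma kernel_L1 (z : R[i]) (K : R) (f : R -> R) :
  cabs z < 1 -> (forall t, cabs (szego_kernel z t) <= K) -> rint f ->
  cabs (amean (fun t => szego_kernel z t * (f t)%:C)) <=
  K * (2 * pi)^-1 * \int[leb]_(t in arcI) `|f t|.
Proof.
move=> z1 hK hf; rewrite /amean cabsM cabsC ger0_norm ?invr_ge0 ?(ltW p2)//.
rewrite [K * _]mulrC -mulrA ler_wpM2l ?invr_ge0 ?(ltW p2)//.
have hn : rint (fun t => `|f t|) by exact: integrable_norm.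
rewrite -(RintegralZl K (@measurable_arcI R) hn).
apply: Cintegral_le.
- exact: measurable_arcI.
- exact: angular_int_kernelM.
- exact: rintZ.
- by move=> t _; rewrite cabsM cabsC ler_wpM2r.
Qed.

(** On the circle [ln (W n)] is [e]-close to the real part of the polynomial [ln (nu n) + 2 q],
    which the Schwarz formula evaluates at [z]. The rest is the L1 distance of [LV] to that real
    part against a kernel bounded by [K]. *)
Lemma szego_approx (z : R[i]) (K d : R) (n : nat) (q : {poly R[i]}) (e : R) :
  cabs z < 1 -> (forall t, cabs (szego_kernel z t) <= K) -> 0 < d < 1 ->
  q.[0] = 0 ->
  (forall t, `|ln (W n t) - (ln (nu n) + 2 * complex.Re q.[expi t])| <= e) ->
  cabs (amean (fun t => szego_kernel z t * (LV t)%:C) - ((ln (nu n))%:C + 2 * q.[z])) <=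
  K * ((ln (nu n) - ln nuoo) / d + d + e).
Proof.
move=> z1 hK d01 q0 hq; pose P := (ln (nu n))%:C%:P + 2%:P * q.
pose r t := complex.Re P.[expi t].
have K0 : 0 <= K by exact: le_trans (cabs_ge0 _) (hK 0).
have rE t : r t = ln (nu n) + 2 * complex.Re q.[expi t].
  by rewrite /r !hornerE cReD; congr (_ + _); rewrite -(@natrC R 2) cReMr.
have [ir _] := rmean_Re_horner P.
have iL := rint_LV; have iB := rintB iL ir.
have -> : (ln (nu n))%:C + 2 * q.[z] = amean (fun t => szego_kernel z t * (r t)%:C).
  rewrite schwarz_formula//; first by rewrite !hornerE.
  by rewrite coefD coefC eqxx coefCM -horner_coef0 q0 mulr0 addr0.
have i1 := angular_int_kernelM z1 iL; have i2 := angular_int_kernelM z1 ir.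
have -> : amean (fun t => szego_kernel z t * (LV t)%:C) - amean (fun t => szego_kernel z t * (r t)%:C) =
    amean (fun t => szego_kernel z t * (LV t - r t)%:C).
  rewrite /amean -mulrBr -(CintegralB (@measurable_arcI R) i1 i2).
  by congr (_ * _); apply: eq_Cintegral => t _; rewrite rmorphB /= mulrBr.
apply: le_trans (kernel_L1 z1 hK iB) _; rewrite -mulrA ler_wpM2l//.
rewrite ler_pdivrMl//.
have mr : @measurable_fun _ _ (measurableTypeR R) R arcI r.
  by have /integrableP[/measurable_EFinP] := ir.
have mrD : @measurable_fun _ _ (measurableTypeR R) R D r.
  by apply: measurable_funS mr => //; exact: measurable_arcI.
have E : (\int[leb]_(t in arcI) `|LV t - r t|%:E =
    \int[leb]_(t in D) `|ln (VT t) - r t|%:E)%E.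
  apply: integral_ae_D; [exact: measurable_funB|exact: measurable_funB|].
  by case: LVE => N [mN N0 h]; exists N; split=> // t nP; apply: h => /= fgt; apply: nP => Dt; rewrite fgt.
rewrite /Rintegral E; have [iw bw] := log_L1 n d01.
have ig : leb.-integrable D (EFin \o (fun t => ln (VT t) - r t)).
  apply: integrableBR => //; first exact: int_lnVT.
  exact: (rint_D ir).1.
have ib := integrableDR mD (integrable_norm iw) (icst e).
apply: (@le_trans _ _ (\int[leb]_(t in D) (`|ln (VT t) - ln (W n t)| + e))).
  apply: le_Rintegral => //; first exact: integrable_norm.
  move=> t Dt; have := hq t; rewrite -rE => h.
  have -> : ln (VT t) - r t = (ln (VT t) - ln (W n t)) + (ln (W n t) - r t) by ring.
  by apply: le_trans (ler_normD _ _) _; rewrite lerD2l.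
rewrite (RintegralD mD (integrable_norm iw) (icst e)) Rintegral_cst//.
have eD : fine (leb D) = 2 * pi by rewrite leb_D.
move: (fine _) eD => m ->.
apply: le_trans (lerD bw (lexx _)) _.
by rewrite le_eqVlt; apply/orP; left; apply/eqP; ring.
Qed.

Lemma nu_le_one n : nu n <= 1.
Proof.
elim: n => [|n IH]; first by rewrite nu0.
rewrite nuS -[leRHS]mulr1; apply: ler_pM => //.
- by rewrite subr_ge0 expr_le1 ?cabs_ge0// ltW.
- exact: ltW.
- by rewrite gerBl sqr_ge0.
Qed.

Lemma cexp_half_ln (x : R) : 0 < x -> cexp ((2^-1 * ln x)%:C) = (Num.sqrt x)%:C.
Proof.
move=> x0; rewrite cexpC; congr _%:C; apply/eqP.
rewrite -(@eqrXn2 _ 2) ?expR_ge0 ?sqrtr_ge0// sqr_sqrtr ?(ltW x0)//.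
rewrite expr2 -expRD (_ : _ + _ = ln x) ?lnK//.
by move: (ln x) => y; lra.
Qed.

Lemma szego_quotient (z : R[i]) (e : R) : cabs z < 1 -> 0 < e ->
  \forall n \near \oo,
    cabs (cexp (2^-1 * amean (fun t => szego_kernel z t * (LV t)%:C)) * (S n).[z] -
      (Num.sqrt (nu n))%:C) <= e.
Proof.
move=> z1 e0; have [_ [K0 hK0]] := angular_bounded_kernel z1.
pose K := Num.max 1 K0; have K1 : 1 <= K by rewrite le_max lexx.
have Kp : 0 < K := lt_le_trans ltr01 K1.
have hK t : cabs (szego_kernel z t) <= K by rewrite le_max hK0 orbT.
(* Once [ln (nu n) - ln nuoo <= d^2], [szego_approx] with [e = 4 d] gives [6 K d]; halving and
   exponentiating give [3 K d] and [9 K d], and the product with the factor within [d] of 1 stays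
   below [13 K d]. *)
pose d := Num.min 4^-1 (Num.min e 1 / (13 * K)).
have d0 : 0 < d by rewrite /d lt_min invr_gt0 ltr0n/= divr_gt0 ?mulr_gt0// lt_min e0 ltr01.
have d4 : d <= 4^-1 by rewrite /d ge_min lexx.
have dK : 13 * (K * d) <= Num.min e 1.
  rewrite mulrA mulrC -ler_pdivlMr ?mulr_gt0//; by rewrite /d ge_min lexx orbT.
have [dKe dK1] : 13 * (K * d) <= e /\ 13 * (K * d) <= 1.
  by move: dK; rewrite le_min => /andP[].
have d01 : 0 < d < 1 by rewrite d0 (le_lt_trans d4)// invf_lt1// ltr1n.
have : ln (nu n) @[n --> \oo] --> ln nuoo.
  by apply: (@continuous_cvg _ _ _ _ _ nu (@ln R) nuoo _ nu_cvg); exact: continuous_ln.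
move/cvgrPdist_le => /(_ (d ^+ 2) (exprn_gt0 _ d0)); apply: filterS => n hn.
have [|q [q0 hq hl]] := @log_weight_approx _ F S alpha nu F0 S0 FS SS alpha1 nu0 nuS n d.
  by rewrite d0.
have hap := szego_approx z1 hK d01 q0 hl.
set I := amean _ in hap *.
set P := _ + 2 * _ in hap.
have bI : cabs (I - P) <= 6 * (K * d).
  apply: le_trans hap _; rewrite mulrCA ler_pM2l//.
  have : (ln (nu n) - ln nuoo) / d <= d.
    rewrite ler_pdivrMr// -expr2; move: hn; rewrite distrC => hn.
    exact: le_trans (ler_norm _) hn.
  by lra.
have by2 : cabs (2^-1 * (I - P)) <= 3 * (K * d).
  have -> : (2^-1 : R[i]) = (2^-1)%:C by rewrite halfC.
  by rewrite cabsM cabsC ger0_norm ?invr_ge0// ; lra.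
have h2 : cabs (2^-1 * (I - P)) <= 2^-1 by lra.
have h3 := cexp_sub1_bound h2.
have h4 : cabs (cexp (2^-1 * (I - P)) - 1) <= 9 * (K * d) by lra.
have h5 := mul_near1 h4 (hq z (ltW z1)).
have -> : cexp (2^-1 * I) * (S n).[z] - (Num.sqrt (nu n))%:C =
  (Num.sqrt (nu n))%:C * (cexp (2^-1 * (I - P)) * (cexp q.[z] * (S n).[z]) - 1).
  have -> : 2^-1 * I = (2^-1 * ln (nu n))%:C + q.[z] + 2^-1 * (I - P).
    have -> : (2^-1 * ln (nu n))%:C = 2^-1 * (ln (nu n))%:C :> R[i].
      by rewrite rmorphM /= halfC.
    by rewrite /P; field.
  by rewrite !cexpD cexp_half_ln//; ring.
rewrite cabsM cabsC ger0_norm ?sqrtr_ge0//.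
have sn1 : Num.sqrt (nu n) <= 1 by rewrite -sqrtr1 ler_wsqrtr// nu_le_one.
apply: (@le_trans _ _ (cabs (cexp (2^-1 * (I - P)) * (cexp q.[z] * (S n).[z]) - 1))).
  by rewrite ler_piMl ?cabs_ge0.
apply: le_trans h5 _; apply: le_trans dKe.
by have := mulr_ge0 (ltW d0) (ltW Kp); nra.
Qed.

Lemma szego_in_disc (z s : R[i]) : cabs z < 1 ->
  (S n).[z] @[n --> \oo] --> s ->
  cexp ((4 * pi)^-1%:C * Cintegral leb arcI (fun t => szego_kernel z t * (LV t)%:C)) * s =
  (Num.sqrt nuoo)%:C.
Proof.
move=> z1 cs; pose Y := cexp (2^-1 * amean (fun t => szego_kernel z t * (LV t)%:C)).
have -> : cexp ((4 * pi)^-1%:C * Cintegral leb arcI (fun t => szego_kernel z t * (LV t)%:C)) = Y.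
  congr cexp; rewrite /amean mulrA; congr (_ * _).
  have -> : (2^-1 : R[i]) = (2^-1)%:C by rewrite halfC.
  rewrite -rmorphM -invfM; congr (_ ^-1%:C); ring.
apply/eqP; rewrite -subr_eq0 -cabs_eq0 eq_le cabs_ge0 andbT.
apply/ler_addgt0Pr => e e0; rewrite add0r.
have e3 : 0 < e / 3 by rewrite divr_gt0.
have Y1 : 0 < cabs Y + 1 by rewrite ltr_wpDl ?cabs_ge0.
have c1 := (cvg_cabsP _ _).1 cs _ (divr_gt0 e3 Y1).
have : Num.sqrt (nu n) @[n --> \oo] --> Num.sqrt nuoo.
  by apply: (@continuous_cvg _ _ _ _ _ nu (@Num.sqrt R) nuoo _ nu_cvg); exact: sqrt_continuous.
move/cvgrPdist_le => /(_ _ e3) c2; have c3 := szego_quotient z1 e3.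
have [n [h1 [h2 h3]]] := filter_ex (filterI (c1 _) (filterI c2 c3)).

have -> : Y * s - (Num.sqrt nuoo)%:C = Y * (s - (S n).[z]) +
    (Y * (S n).[z] - (Num.sqrt (nu n))%:C) - (Num.sqrt nuoo - Num.sqrt (nu n))%:C.
  by rewrite rmorphB /=; ring.
apply: le_trans (ler_cabsB _ _) _; rewrite cabsC.
have h4 := ler_cabsD (Y * (s - (S n).[z])) (Y * (S n).[z] - (Num.sqrt (nu n))%:C).
have h5 : cabs (Y * (s - (S n).[z])) <= e / 3.
  rewrite cabsM cabs_distC.
  apply: (@le_trans _ _ ((cabs Y + 1) * (e / 3 / (cabs Y + 1)))).
    by apply: ler_pM; rewrite ?cabs_ge0 ?lerDl// ltW.
  by rewrite mulrCA mulfV ?mulr1// gt_eqF.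
by move: h2 h3 h4 h5; set a := cabs _; set b := cabs _; set c := cabs _; lra.
Qed.

End LogLimit.

(** * Distance to the exceptional points *)

Section PuncturedCircle.
Variables (R : realType) (p : nat) (zeta : 'I_p -> R[i]).

Lemma common_lower_bound (A : set R[i]) :
  (forall k, exists2 d : R, 0 < d & forall z, A z -> d <= cabs (z - zeta k)) ->
  exists2 d : R, 0 < d & forall z, A z -> forall k, d <= cabs (z - zeta k).
Proof.
move=> h; have /choice[f hf] : forall k, exists d : R, 0 < d /\
    forall z, A z -> d <= cabs (z - zeta k).
  by move=> k; have [d] := h k; exists d.
exists (\big[Order.min/1]_(k < p) f k).
  by apply: lt_bigmin => // k _; have [] := hf k.
move=> z Az k; apply: le_trans ((hf k).2 z Az).
exact: bigmin_le.
Qed.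

Lemma off_range_away z : ~ range zeta z ->
  exists2 d : R, 0 < d & forall k, d <= cabs (z - zeta k).
Proof.
move=> nz; have [k|d d0 hd] := @common_lower_bound [set z]; last first.
  by exists d => // k; exact: hd.
exists (cabs (z - zeta k)); last by move=> _ ->.
by rewrite cabs_gt0 subr_eq0; apply: contra_notN nz => /eqP ->; exists k.
Qed.

Lemma compact_away (K : set R[i]) : compact K -> K `<=` ~` range zeta ->
  exists2 d : R, 0 < d & forall z, K z -> forall k, d <= cabs (z - zeta k).
Proof.
move=> cK KZ; apply: common_lower_bound => k.
pose f (z : R[i]) := cabs (z - zeta k).
have cf : continuous f.
  move=> z; apply: (@continuous_cvg _ _ _ (nbhs z) (nbhs_filter z) (fun z => z - zeta k)
    (@cabs R) (z - zeta k) (@continuous_cabs R _)).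
  apply/(@cvg_cabsP _ _ (nbhs z) (nbhs_filter z)) => e e0; apply/nbhs_cabsP; exists e => // y.
  by rewrite opprB addrA subrK.
(* The distances from [K] to [zeta k] form a compact, hence closed, set of reals missing 0; an empty
   [K] needs no separate case. *)
have : compact [set f z | z in K] by apply: continuous_compact => //; exact: continuous_subspaceT.
move/(compact_closed (@norm_hausdorff _ R)) => cl.
have : (~` [set f z | z in K]) 0.
  move=> [z Kz /eqP]; rewrite cabs_eq0 subr_eq0 => /eqP E.
  by apply: (KZ z Kz); exists k.
move: (cl); rewrite -openC => oK n0.
have /nbhs_ballP[e /= e0 he] := open_nbhs_nbhs (conj oK n0).
exists e => // z Kz; rewrite leNgt; apply/negP => fe.
by apply: (he (f z)) => /=; [rewrite /ball/= sub0r normrN ger0_norm ?cabs_ge0|exists z].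
Qed.

End PuncturedCircle.

Lemma series_sum_cvg (R : realType) (I : Type) (r : seq I) (u : nat -> I -> R) :
  (forall k, cvgn (series (fun n => u n k))) ->
  cvgn (series (fun n => \sum_(k <- r) u n k)).
Proof.
move=> h; elim: r => [|k r IH].
  under eq_fun do rewrite big_nil.
  by rewrite (_ : series _ = fun=> 0); [exact: is_cvg_cst|apply/funext => n; rewrite /series /= big1].
under eq_fun do rewrite big_cons.
by rewrite seriesD; exact: is_cvgD.
Qed.

(** * The limit function and the Szego function *)

Section Assembly.
Variables (R : realType) (p : nat) (zeta : 'I_p -> R[i])
  (mu : probability R[i] R) (Phi : nat -> {poly R[i]}) (alpha : nat -> R[i])
  (w : R -> R) (mus : {measure set R[i] -> \bar R}) (beta : nat -> 'I_p -> R[i]).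
Hypotheses (p0 : (0 < p)%N) (zetaC : forall k, circle R (zeta k))
  (muC : mu (circle R) = 1%E) (suppC : infinite_set (msupport mu))
  (orth : forall n, monic_orthogonal mu n (Phi n)) (szego : verblunsky Phi alpha)
  (dec : lebesgue_decomposition mu w mus)
  (alphaE : forall n, alpha n = \sum_(k < p) beta n k)
  (eps_sum : forall k, cvgn (series (fun n => cabs (zeta k * beta n.+1 k - beta n k))))
  (beta_sum : forall k, cvgn (series (fun n => cabs (beta n k) ^+ 2))).
Notation C := (circle R).
Notation leb := (@lebesgue_measure R).
Notation arcI := (`[0%R, (2 * pi)%R]%classic : set R).
Notation arcO := (`[0%R, (2 * pi)%R[%classic : set R).
Notation Z := (range zeta).
Notation DZ := (arcI `&` [set t | ~ Z (expi t)]).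
Notation DO := (arcO `&` [set t | ~ Z (expi t)]).
Notation Phis := (fun n => reversed_poly n (Phi n)).
Notation S n z := (reversed_poly n (Phi n)).[z].
Notation nun := (nu mu Phi).

Let zeta1 k : cabs (zeta k) = 1.
Proof. exact/circleP. Qed.

Lemma alpha_sq_cvg : cvgn (series (fun n => cabs (alpha n) ^+ 2)).
Proof.
(* The double sum dominates the square of [\sum_k |beta n k|], since each product of two moduli is
   at most the sum of their squares. *)
pose v n (k : 'I_p) := \sum_(j < p) (cabs (beta n k) ^+ 2 + cabs (beta n j) ^+ 2).
apply: (@series_le_cvg _ _ (fun n => \sum_(k < p) v n k)).
- by move=> n; exact: sqr_ge0.
- by move=> n; apply: sumr_ge0 => k _; apply: sumr_ge0 => j _; rewrite addr_ge0 ?sqr_ge0.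
- move=> n; rewrite alphaE.
  apply: (@le_trans _ _ ((\sum_(k < p) cabs (beta n k)) ^+ 2)).
    by rewrite lerXn2r ?nnegrE ?cabs_ge0 ?sumr_ge0 ?ler_cabs_sum// => k _; exact: cabs_ge0.
  rewrite expr2 big_distrl /=; apply: ler_sum => k _.
  rewrite big_distrr /=; apply: ler_sum => j _.
  have := cabs_ge0 (beta n k); have := cabs_ge0 (beta n j).
  by move: (cabs (beta n k)) (cabs (beta n j)) => a b; nra.
- apply: series_sum_cvg => k; apply: series_sum_cvg => j.
  by rewrite (_ : (fun n => _) = (fun n => cabs (beta n k) ^+ 2) \+ (fun n => cabs (beta n j) ^+ 2))// seriesD; exact: is_cvgD.
Qed.

Lemma alpha_lim e : 0 < e -> exists N, forall n, (N <= n)%N -> cabs (alpha n) <= e.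
Proof.
move=> e0; have st := cvg_small_tails alpha_sq_cvg.
have [n|N hN] := small_tails_term _ st (exprn_gt0 2 e0); first exact: sqr_ge0.
by exists N => n /hN; rewrite ler_sqr ?nnegrE ?cabs_ge0 ?(ltW e0).
Qed.

Let F0 := Phi0E orth.
Let S0 := Phis0E orth.
Let FS := Phi_rec szego.
Let SS := Phis_rec orth szego.
Let alpha1 := alpha_lt1 muC suppC orth szego.
Let nu00 := nu0 muC orth.
Let nuS := nu_rec muC orth szego.
Let W := weight Phis nun.

Lemma nu_limit_exists : exists2 l : R, 0 < l & nun n @[n --> \oo] --> l.
Proof. exact: (nu_cvg muC suppC orth szego alpha_sq_cvg). Qed.

Lemma Soo_exists : exists Soo : R[i] -> R[i], forall d, 0 < d -> forall e, 0 < e ->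
  exists N, forall n z, (N <= n)%N -> punctured_disc zeta d z -> cabs (S n z - Soo z) <= e.
Proof.
apply: uniform_limit => d d0 e e0.
exact: (@star_cauchy _ _ (fun n z => (Phi n).[z]) (fun n z => S n z) F0 S0 FS SS alpha1 _ _ _
  zeta1 alphaE eps_sum beta_sum d d0 e e0).
Qed.

Lemma S_bounds d : 0 < d -> exists m M : R, [/\ 0 < m, 0 < M &
  forall n z, punctured_disc zeta d z -> m <= cabs (S n z) <= M].
Proof.
move=> d0.
exact: (@star_bounds _ _ (fun n z => (Phi n).[z]) (fun n z => S n z) F0 S0 FS SS alpha1 _ _ _
  zeta1 alphaE eps_sum beta_sum d d0).
Qed.

Variables (nuoo : R) (Soo : R[i] -> R[i]).
Hypotheses (nuoo0 : 0 < nuoo) (nu_lim : nun n @[n --> \oo] --> nuoo)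
  (Slim : forall d, 0 < d -> forall e, 0 < e ->
  exists N, forall n z, (N <= n)%N -> punctured_disc zeta d z -> cabs (S n z - Soo z) <= e).

Let nu_ge n : nuoo <= nun n.
Proof.
rewrite -(cvg_lim (@norm_hausdorff _ _) nu_lim).
apply: nonincreasing_cvgn_ge; last by apply/cvg_ex; exists nuoo.
by move=> a b ab; exact: (nu_nincr muC suppC orth szego ab).
Qed.

Let nu_near e : 0 < e -> exists N, forall n, (N <= n)%N -> `|nun n - nuoo| <= e.
Proof.
move=> e0; have /cvgrPdist_le /(_ e e0) [N _ hN] := nu_lim.
by exists N => n /hN; rewrite distrC.
Qed.

Lemma S_cvg z : cabs z <= 1 -> ~ Z z -> S n z @[n --> \oo] --> Soo z.
Proof.
move=> z1 /off_range_away[d d0 hd]; apply/cvg_cabsP => e e0.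
have [N hN] := Slim d0 (divr_gt0 e0 (ltr0n _ 2)).
exists N => // n /= Nn; apply: le_lt_trans (hN n z Nn _) _; first by split.
by rewrite ltr_pdivrMr// mulr_natr mulr2n ltrDl.
Qed.

Let Soo_bounds d : 0 < d -> exists m M : R, [/\ 0 < m, 0 < M &
  forall z, punctured_disc zeta d z -> m <= cabs (Soo z) <= M].
Proof.
move=> d0; have [m [M [m0 M0 h]]] := S_bounds d0; exists m, M; split => // z zd.
exact: (Soo_bnd h (Slim d0) zd).
Qed.

Lemma Soo_neq0 z : cabs z <= 1 -> ~ Z z -> Soo z != 0.
Proof.
move=> z1 /off_range_away[d d0 hd]; have [m [M [m0 _ h]]] := Soo_bounds d0.
have /andP[hm _] := h z (conj z1 hd).
by rewrite -cabs_gt0; exact: lt_le_trans hm.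
Qed.

Notation V := (limit_weight nuoo Soo).

Let V0 z : 0 <= V z.
Proof. by rewrite divr_ge0 ?sqr_ge0// ltW. Qed.

Let V_gt0 z : cabs z <= 1 -> ~ Z z -> 0 < V z.
Proof. by move=> z1 nz; rewrite divr_gt0// exprn_gt0// cabs_gt0 Soo_neq0. Qed.

Lemma weight_cvg t : ~ Z (expi t) -> W n t @[n --> \oo] --> V (expi t).
Proof.
move=> nz; have t1 : cabs (expi t : R[i]) <= 1 by rewrite cabs_expi.
have c1 := S_cvg t1 nz.
have c2 : cabs (S n (expi t)) @[n --> \oo] --> cabs (Soo (expi t)).
  exact: (@continuous_cvg _ _ _ _ _ (fun n => S n (expi t)) (@cabs R) _ (@continuous_cabs R _) c1).
apply: cvgM => //; apply: cvgV; first by rewrite sqrf_eq0 cabs_eq0 Soo_neq0.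
by apply: cvgM.
Qed.

Lemma measurable_limit_weight :
  @measurable_fun _ _ (measurableTypeR R) R DZ (fun t => V (expi t)).
Proof.
apply: (@measurable_fun_cvg _ (measurableTypeR R) R DZ W).
  move=> n; have := @measurable_weight _ Phi Phis alpha nun F0 S0 FS SS alpha1 nu00 nuS n.
  by apply: measurable_funS; [exact: measurable_arcI|exact: subIsetl].
by move=> t [_ nz]; exact: weight_cvg.
Qed.

Let ident (g : R[i] -> R) d : circle_lipschitz g -> 0 < d ->
  (forall z, C z -> (exists k, cabs (z - zeta k) < d) -> g z = 0) ->
  rint (fun t => g (expi t) * V (expi t)) /\
  \int[mu]_(z in C) g z = rmean (fun t => g (expi t) * V (expi t)).
Proof.
move=> hg d0 gd; have [m [M [m0 M0 hS]]] := S_bounds d0.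
apply: (weighted_identity muC suppC orth szego nuoo0 nu_ge nu_near alpha_lim m0 M0 hS (Slim d0)) => //.
  move=> n; exists (\prod_(j < n) (1 - cabs (alpha j))).
    by apply: prodr_gt0 => j _; rewrite subr_gt0.
  move=> z zc; rewrite -(cabs_Phis_circle orth n zc).
  apply: (@star_ge_prod _ _ (fun n z => (Phi n).[z]) (fun n z => S n z) F0 S0 FS SS alpha1).
  by rewrite (circleP z).1.
move=> z zc nO; apply: gd => //; apply: contrapT => nk; apply: nO; split.
  by rewrite (circleP z).1.
by move=> k; rewrite leNgt; apply/negP => h; apply: nk; exists k.
Qed.

Let dens := fun A : set R[i] => @density_measure _ _ _ zeta muC p0 _ V0 measurable_limit_weight ident A.

Lemma measurable_DO : @measurable _ (measurableTypeR R) DO.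
Proof.
apply: measurableI; first exact: measurable_itv.
have := @measurable_expi R measurableT _ (measurableC (measurable_range_zeta zeta)).
by rewrite setTI.
Qed.

(** On the circle [V / W n] is [|Phi_n|^2 V / nu n], so its integral is [2 pi / nu n] times the part
    of [nu n] coming from off the [zeta k]. Possible point masses of [mu] make this an
    inequality. *)
Lemma weight_ratio_mean n : (\int[leb]_(t in DO) (V (expi t) / W n t)%:E <= (2 * pi)%:E)%E.
Proof.
pose h z := cabs (Phi n).[z] ^+ 2.
have hl : circle_lipschitz h by exact: circle_lipschitz_cabs2.
have h0 z : C z -> 0 <= h z by rewrite sqr_ge0.
have np : 0 < nun n := nu_gt0 muC suppC orth n.
have E := density_identity muC p0 V0 measurable_limit_weight ident hl h0 openT.
pose G (t : R) := h (expi t) * V (expi t).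
have mG : @measurable_fun _ _ (measurableTypeR R) R DZ G.
  apply: measurable_funM; last exact: measurable_limit_weight.
  exact: measurable_funTS (circle_lipschitz_measurable_expi hl).
have G0 t : DZ t -> (0 <= (G t)%:E)%E.
  by move=> _; rewrite lee_fin mulr_ge0// h0//; exact: circle_expi.
have EG : (\int[leb]_(t in DZ) (G t)%:E = (2 * pi)%:E *
    \int[mu]_(z in C) (h z * \1_([set: R[i]] `\` Z) z)%:E)%E.
  rewrite E muleA -EFinM mulfV ?mul1e ?gt_eqF ?twopi_gt0//.
  apply: eq_integral => t; rewrite inE => -[_ tZ].
  by rewrite indicE mem_set ?mulr1.
have E1 : (\int[leb]_(t in DO) (V (expi t) / W n t)%:E =
    \int[leb]_(t in DO) ((nun n)^-1%:E * (G t)%:E))%E.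
  apply: eq_integral => t _; rewrite -EFinM; congr EFin.
  rewrite /W /weight /G /h (cabs_Phis_circle orth n (circle_expi t)).
  by rewrite invf_div; ring.
rewrite E1.
apply: (@le_trans _ _ (\int[leb]_(t in DZ) ((nun n)^-1%:E * (G t)%:E))%E).
  apply: ge0_subset_integral.
  - exact: measurable_DO.
  - exact: measurable_DZ.
  - by apply/measurable_EFinP; apply: measurable_funM => //; exact: measurable_cst.
  - by move=> t tD; rewrite mule_ge0 ?G0// lee_fin invr_ge0 ltW.
  - by move=> t [+ tZ]; rewrite /= !in_itv/= => /andP[-> /ltW ->].
rewrite ge0_integralZl_EFin//; first last.
- by rewrite invr_ge0 ltW.
- exact/measurable_EFinP.
- exact: measurable_DZ.
rewrite EG.
have h1 : (\int[mu]_(z in C) (h z * \1_([set: R[i]] `\` Z) z)%:E <= (nun n)%:E)%E.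
  have mC := @measurable_circle R.
  have ih := circle_lipschitz_int muC hl.
  have mh : measurable_fun C h by have [] := hl.
  rewrite [X in (_ <= X)%E](_ : _ = \int[mu]_(z in C) (h z)%:E)%E; last first.
    by rewrite /nu /Rintegral fineK//; exact: integrable_fin_num ih.
  apply: ge0_le_integral => //.
  - by move=> z zc; rewrite lee_fin mulr_ge0 ?h0.
  - apply/measurable_EFinP; apply: measurable_funM => //; apply: measurable_funTS.
    apply: measurable_indic; apply: measurableD => //; exact: measurable_range_zeta.
  - exact/measurable_EFinP.
  - by move=> z zc; rewrite lee_fin ler_piMr ?h0// indicE lern1 leq_b1.
apply: (@le_trans _ _ ((nun n)^-1%:E * ((2 * pi)%:E * (nun n)%:E))%E).
  apply: lee_wpmul2l; first by rewrite lee_fin invr_ge0 ltW.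
  by apply: lee_wpmul2l => //; rewrite lee_fin ltW// twopi_gt0.
by rewrite -!EFinM lee_fin mulrCA mulVf ?mulr1// gt_eqF.
Qed.

Lemma null_DO : leb (arcI `\` DO) = 0%E.
Proof.
apply: (null_expi_range (zeta := zeta)); first by move=> t [].
move=> t [tI nt]; have [->|t2] := eqVneq t (2 * pi); [by right|left].
apply: contrapT => nz; apply: nt; split=> //.
by move: tI; rewrite /= !in_itv/= => /andP[-> tl] /=; rewrite lt_neqAle t2.
Qed.

Lemma szego_fun_disc z : cabs z < 1 -> szego_fun w z * Soo z = (Num.sqrt nuoo)%:C.
Proof.
move=> z1; have nz : ~ Z z.
  by move=> [k _ E]; move: z1; rewrite -E zeta1 ltxx.
have mV : @measurable_fun _ _ (measurableTypeR R) R DO (fun t => V (expi t)).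
  apply: measurable_funS measurable_limit_weight; first exact: measurable_DZ.
  by move=> t [+ tZ]; rewrite /= !in_itv/= => /andP[-> /ltW ->].
apply: (@szego_in_disc R Phi Phis alpha nun F0 S0 FS SS alpha1 nu00 nuS nuoo DO
  (fun t => V (expi t)) nuoo0 nu_lim measurable_DO _ null_DO _ mV _ weight_ratio_mean
  (fun t => ln (w t)) _ _ z (Soo z) z1).
- by move=> t [+ _]; rewrite /= !in_itv/= => /andP[-> /ltW ->].
- by move=> t [_ tZ]; apply: V_gt0 => //; rewrite cabs_expi.
- by move=> t [_ tZ]; exact: weight_cvg.
(* [w] is given on the half-open interval, while the Szego integral runs over the closed one. *)
- apply/measurable_fun_itv_bndo_bndcP.
  have [mw _ _ _] := dec.
  exact: (measurableT_comp (@measurable_ln R) mw).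
- have [N [mN N0 h]] := ac_weight_ae muC measurable_limit_weight dens dec.
  exists N; split=> // t nP; apply: h => /= e; apply: nP => tD.
  by have [->] := e tD.
- by apply: S_cvg => //; exact: ltW.
Qed.

Lemma limit_density : [/\ forall z, 0 <= V z,
  @measurable_fun _ _ (measurableTypeR R) R DZ (fun t => V (expi t))
  & forall A : set R[i], measurable A ->
    (mu (C `&` (A `\` Z)) = ((2 * pi)^-1)%:E *
      \int[leb]_(t in DZ `&` expi (R:=R) @^-1` A) (V (expi t))%:E)%E].
Proof. by split; [exact: V0|exact: measurable_limit_weight|exact: dens]. Qed.

End Assembly.

(** * Boundary values *)

Section BoundaryLimit.
Variables (R : realType) (p : nat) (zeta : 'I_p -> R[i]) (P : nat -> {poly R[i]})
  (Soo : R[i] -> R[i]).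
Hypothesis Slim : forall d, 0 < d -> forall e, 0 < e -> exists N, forall n z,
  (N <= n)%N -> punctured_disc zeta d z -> cabs ((P n).[z] - Soo z) <= e.

(** Continuity relative to the closed disc, which covers both continuity along the circle and the
    radial approach. A polynomial [P N] uniformly close to [Soo] near [z] carries its Lipschitz
    bound over. *)
Lemma limit_modulus z : cabs z <= 1 -> ~ range zeta z -> forall e, 0 < e ->
  exists2 r : R, 0 < r & forall y, cabs y <= 1 -> cabs (y - z) < r ->
    cabs (Soo y - Soo z) < e.
Proof.
move=> z1 /off_range_away[d d0 hd] e e0.
(* Halving [d] keeps a neighbourhood of [z], and not only [z], inside a set of uniform
   convergence. *)
have d2 : 0 < d / 2 by rewrite divr_gt0.
have e4 : 0 < e / 4 by rewrite divr_gt0.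
have [N hN] := Slim d2 e4; have [L L0 hL] := horner_lipschitz (P N) 1.
exists (Num.min (d / 2) (e / 4 / L)); first by rewrite lt_min d2 divr_gt0.
move=> y y1; rewrite lt_min => /andP[yd]; rewrite ltr_pdivlMr// => ye.
have zd : punctured_disc zeta (d / 2) z.
  by split=> // k; apply: le_trans (hd k); rewrite ler_pdivrMr// ler_peMr ?ler1n ?ltW.
have yd' : punctured_disc zeta (d / 2) y.
  split=> // k; have := hd k; have := ler_cabs_dist y z (zeta k).
  by rewrite [cabs (z - y)]cabs_distC; lra.
have h1 := hN N y (leqnn _) yd'; have h2 := hN N z (leqnn _) zd.
have h3 := hL y z y1 z1; rewrite [L * _]mulrC in h3.
have -> : Soo y - Soo z = ((P N).[y] - (P N).[z]) - ((P N).[y] - Soo y) +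
  ((P N).[z] - Soo z) by ring.
have := ler_cabsD ((P N).[y] - (P N).[z] - ((P N).[y] - Soo y)) ((P N).[z] - Soo z).
have := ler_cabsB ((P N).[y] - (P N).[z]) ((P N).[y] - Soo y).
by lra.
Qed.

Lemma limit_continuous (g : R[i] -> R[i]) (c : R[i]) (E : set R[i]) :
  (forall z, E z -> cabs z <= 1 /\ ~ range zeta z) ->
  (forall z, g z = c * Soo z) -> {within E, continuous g}.
Proof.
move=> hE gE; apply/subspace_continuousP => z Ez; apply/cvg_cabsP => e e0.
have [z1 nz] := hE z Ez; have c1 : 0 < cabs c + 1 by rewrite ltr_wpDl ?cabs_ge0.
have [r r0 hr] := limit_modulus z1 nz (divr_gt0 e0 c1).
rewrite /within /=; apply/nbhs_cabsP; exists r => // y yr Ey.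
rewrite [X in cabs X](_ : _ = c * (Soo y - Soo z)); last by rewrite mulrBr -!gE.
rewrite cabsM; have := hr y (hE y Ey).1 yr.
rewrite ltr_pdivlMr// mulrC => h; apply: le_lt_trans h.
by rewrite ler_wpM2r ?cabs_ge0// lerDl.
Qed.

(** Inside the disc [D] is the quotient [s / Soo], so its radial limit comes from the continuity of
    [Soo] and no boundary theory of Poisson integrals enters. *)
Lemma radial_quotient (D : R[i] -> R[i]) (s z : R[i]) :
  (forall y, cabs y < 1 -> D y * Soo y = s) -> s != 0 ->
  cabs z = 1 -> ~ range zeta z -> Soo z != 0 ->
  D (r%:C * z) @[r --> (1%R : R)^'-] --> s / Soo z.
Proof.
move=> hD s0 z1 nz Sz.
have cS : Soo (r%:C * z) @[r --> (1%R : R)^'-] --> Soo z.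
  apply/cvg_cabsP => e e0.
  have z1' : cabs z <= 1 by rewrite z1.
  have [d d0 hd] := limit_modulus z1' nz e0.
  near=> r.
  have r1 : r < 1 by near: r; exact: nbhs_left_lt.
  have r0 : 0 <= r by near: r; exact: nbhs_left_ge.
  have rd : 1 - d < r by near: r; apply: nbhs_left_gt; rewrite gtrBl.
  apply: hd; first by rewrite cabsM z1 mulr1 cabsC ger0_norm// ltW.
  have -> : r%:C * z - z = (r - 1)%:C * z by rewrite rmorphB /= mulrBl mul1r.
  by rewrite cabsM z1 mulr1 cabsC distrC gtr0_norm ?subr_gt0//; lra.
have cV : s * (Soo (r%:C * z))^-1 @[r --> (1%R : R)^'-] --> s / Soo z.
  by apply: cvgM; [exact: cvg_cst|exact: cvgV].
apply: cvg_trans cV; apply: near_eq_cvg; near=> r.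
have r1 : r < 1 by near: r; exact: nbhs_left_lt.
have r0 : 0 <= r by near: r; exact: nbhs_left_ge.
have h : cabs (r%:C * z) < 1 by rewrite cabsM z1 mulr1 cabsC ger0_norm.
have := hD _ h => E.
have n0 : Soo (r%:C * z) != 0.
  by apply: contraNneq s0 => E0; rewrite -E E0 mulr0.
by rewrite -E mulfK.
Unshelve. all: by end_near. Qed.

End BoundaryLimit.

Lemma cvg_uniform_cabs (R : realType) (K : set R[i]) (f : nat -> R[i] -> R[i])
    (g : R[i] -> R[i]) :
  (forall e : R, 0 < e -> exists N, forall n z, (N <= n)%N -> K z ->
    cabs (f n z - g z) <= e) ->
  {uniform K, f n @[n --> \oo] --> g}.
Proof.
move=> h A /uniform_nbhs[E [+ EA]]; rewrite -entourage_from_ballE => -[e /= e0 he].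
have [r r0 eE] := posC_cabs e0.
have [N hN] := h _ (divr_gt0 r0 (ltr0n _ 2)).
exists N => // n /= Nn; apply: EA => z Kz; apply: he.
rewrite /ball /= eE -cabsE ltcR cabs_distC; apply: le_lt_trans (hN n z Nn Kz) _.
by rewrite ltr_pdivrMr// mulr_natr mulr2n ltrDl.
Qed.

Theorem theorem2p2 (R : realType) (p : nat) (zeta : 'I_p -> R[i])
    (mu : probability R[i] R) (Phi : nat -> {poly R[i]}) (alpha : nat -> R[i])
    (w : R -> R) (mus : {measure set R[i] -> \bar R})
    (beta : nat -> 'I_p -> R[i]) :
  (0 < p)%N ->
  (forall k, circle R (zeta k)) ->
  injective zeta ->
  mu (circle R) = 1%E ->
  infinite_set (msupport mu) ->
  (forall n, monic_orthogonal mu n (Phi n)) ->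
  verblunsky Phi alpha ->
  lebesgue_decomposition mu w mus ->
  (forall n, alpha n = \sum_(k < p) beta n k) ->
  (forall k, cvgn (series (fun n => cabs (zeta k * beta n.+1 k - beta n k)))) ->
  (forall k, cvgn (series (fun n => cabs (beta n k) ^+ 2))) ->
  let E := circle R `\` range zeta in
  let D := szego_fun w in
  let Phistar := fun (n : nat) (z : R[i]) => (reversed_poly n (Phi n)).[z] in
  let phistar := fun (n : nat) (z : R[i]) =>
    (reversed_orthonormal mu n (Phi n)).[z] in
  (forall K : set R[i], compact K -> K `<=` E ->
     exists M : R, forall n z, K z -> cabs (Phistar n z) <= M)
  /\
  (exists Phi_oo phi_oo : R[i] -> R[i],
     [/\ forall z, E z -> radial_cvg D z /\ radial_lim D z != 0,
         forall z, E z ->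
           Phistar n z @[n --> \oo] --> Phi_oo z /\
           Phi_oo z = D 0 * (radial_lim D z)^-1,
         forall z, E z ->
           phistar n z @[n --> \oo] --> phi_oo z /\
           phi_oo z = (radial_lim D z)^-1,
         {within E, continuous Phi_oo} /\ {within E, continuous phi_oo}
       & forall K : set R[i], compact K -> K `<=` E ->
           {uniform K, Phistar n @[n --> \oo] --> Phi_oo} /\
           {uniform K, phistar n @[n --> \oo] --> phi_oo}])
  /\
  (pure_point mus /\ mus (~` range zeta) = 0%E).
Proof.
move=> p0 zetaC _ muC suppC orth szego dec alphaE eps_sum beta_sum E D Phistar phistar.
have [nuoo nuoo0 nu_lim] := nu_limit_exists muC suppC orth szego alphaE beta_sum.
have [Soo Slim] := Soo_exists zetaC muC suppC orth szego alphaE eps_sum beta_sum.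
have Sbnd := S_bounds zetaC muC suppC orth szego alphaE eps_sum beta_sum.
have S0 := Soo_neq0 zetaC muC suppC orth szego alphaE eps_sum beta_sum Slim.
have hD := szego_fun_disc p0 zetaC muC suppC orth szego dec alphaE eps_sum beta_sum nuoo0 nu_lim Slim.
set s := (Num.sqrt nuoo)%:C in hD.
have s0 : s != 0 by rewrite -cabs_gt0 cabsC gtr0_norm sqrtr_gt0.
have EP z : E z -> cabs z <= 1 /\ ~ range zeta z.
  by move=> [/circleP -> ].
have K_away K : compact K -> K `<=` E ->
    exists2 d : R, 0 < d & forall z, K z -> punctured_disc zeta d z.
  move=> cK KE; have [|d d0 hd] := compact_away cK (zeta := zeta).
    by move=> z /KE[].
  exists d => // z Kz; split; last exact: hd.
  by have [] := EP z (KE z Kz).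
have rad z : E z -> D (r%:C * z) @[r --> (1%R : R)^'-] --> s / Soo z.
  move=> [zc nz]; have z1 : cabs z = 1 by exact/circleP.
  apply: (radial_quotient Slim hD s0 z1 nz).
  by apply: S0 => //; rewrite z1.
have radE z : E z -> radial_lim D z = s / Soo z.
  by move=> /rad; apply: cvg_lim; exact: norm_hausdorff.
have Soo0 : Soo 0 = 1.
  apply/eqP; rewrite -subr_eq0 -cabs_eq0 eq_le cabs_ge0 andbT.
  apply/ler_addgt0Pr => e e0; rewrite add0r.
  (* The value [d = 1] still admits the origin, which is at distance exactly 1 from every
     [zeta k]. *)
  have [N hN] := Slim 1 ltr01 e e0; have := hN N 0 (leqnn _).
  rewrite (S_at0 (S := fun n => reversed_poly n (Phi n)) (Phis0E orth) (Phis_rec orth szego)) cabs_distC.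
  apply; split; first by rewrite cabs0.
  by move=> k; rewrite sub0r cabsN ((circleP (zeta k)).1 (zetaC k)).
have D0 : D 0 = s by rewrite -(hD 0) ?cabs0// Soo0 mulr1.
have npos n := nu_gt0 muC suppC orth n.
pose c n : R[i] := (Num.sqrt (nu mu Phi n))^-1%:C.
have phiE n z : phistar n z = c n * Phistar n z.
  by rewrite /phistar /reversed_orthonormal hornerZ normmu_nu.
have c_lim e : 0 < e -> exists N, forall n, (N <= n)%N -> cabs (c n - s^-1) <= e.
  move=> e0; have sn0 : Num.sqrt nuoo != 0 by rewrite gt_eqF// sqrtr_gt0.
  have : (Num.sqrt (nu mu Phi n))^-1 @[n --> \oo] --> (Num.sqrt nuoo)^-1.
    apply: cvgV => //.
    apply: (@continuous_cvg _ _ _ _ _ (fun n => nu mu Phi n) (@Num.sqrt R) nuoo _ nu_lim).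
    exact: sqrt_continuous.
  move/cvgrPdist_le => /(_ e e0) [N _ hN]; exists N => n /hN; rewrite distrC.
  by rewrite /c /s -fmorphV -rmorphB cabsC.
have phi_lim d : 0 < d -> forall e, 0 < e -> exists N, forall n z,
    (N <= n)%N -> punctured_disc zeta d z -> cabs (phistar n z - s^-1 * Soo z) <= e.
  move=> d0 e e0; have [m [M [m0 M0 hb]]] := Sbnd d d0.
  have hS := Soo_bnd hb (Slim d d0).
  pose B := cabs s^-1 + 1; have B0 : 0 < B by rewrite ltr_wpDl ?cabs_ge0.
  have [N1 h1] := c_lim 1 ltr01.
  have [|N2 h2] := Slim d d0 (e / (2 * B)); first by rewrite divr_gt0 ?mulr_gt0.
  have [|N3 h3] := c_lim (e / (2 * M)); first by rewrite divr_gt0 ?mulr_gt0.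
  exists (maxn N1 (maxn N2 N3)) => n z; rewrite !geq_max => /and3P[n1 n2 n3] zd.
  have {}h1 := h1 n n1; have {}h2 := h2 n z n2 zd; have {}h3 := h3 n n3.
  have /andP[_ hz] := hS z zd.
  have cB : cabs (c n) <= B.
    by have := ler_cabsD (c n - s^-1) s^-1; rewrite subrK /B; lra.
  rewrite phiE (_ : _ - _ = c n * (Phistar n z - Soo z) + (c n - s^-1) * Soo z); last by ring.
  apply: le_trans (ler_cabsD _ _) _; rewrite !cabsM.
  have -> : e = B * (e / (2 * B)) + e / (2 * M) * M by field; rewrite !gt_eqF.
  by apply: lerD; apply: ler_pM; rewrite ?cabs_ge0.
split.
  move=> K cK KE; have [d d0 Kd] := K_away K cK KE.
  have [m [M [_ _ h]]] := Sbnd d d0; exists M => n z /Kd zd.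
  by have /andP[_ ->] := h n z zd.
have [V0 mV dens] := limit_density p0 zetaC muC suppC orth szego alphaE eps_sum beta_sum nuoo0 nu_lim Slim.
split; last first.
  split; first exact: (singular_pure_point muC mV dens dec).
  exact: (singular_off_range muC mV dens dec).
exists Soo, (fun z => s^-1 * Soo z); split.
- move=> z Ez; split; first by apply/cvg_ex; exists (s / Soo z); exact: rad.
  by rewrite radE// mulf_neq0// invr_eq0 S0//; have [] := EP z Ez.
- move=> z Ez; have [z1 nz] := EP z Ez; split.
    exact: (S_cvg Slim z1 nz).
  by rewrite radE// D0 invf_div mulrC divfK.
- move=> z Ez; have [z1 nz] := EP z Ez; split; last by rewrite radE// invf_div mulrC.
  have [d d0 hd] := off_range_away nz; apply/cvg_cabsP => e e0.
  have [N hN] := phi_lim d d0 _ (divr_gt0 e0 (ltr0n _ 2)).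
  exists N => // n /= Nn; apply: le_lt_trans (hN n z Nn _) _; first by split.
  by rewrite ltr_pdivrMr// mulr_natr mulr2n ltrDl.
- split; first by apply: (limit_continuous (c := 1) Slim EP) => z; rewrite mul1r.
  exact: (limit_continuous (c := s^-1) Slim EP).
- move=> K cK KE; have [d d0 Kd] := K_away K cK KE; split; apply: cvg_uniform_cabs => e e0.
    by have [N hN] := Slim d d0 e e0; exists N => n z Nn /Kd; exact: hN.
  by have [N hN] := phi_lim d d0 e e0; exists N => n z Nn /Kd; exact: hN.
Qed.
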